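(* Let $(\mathcal G_n)_{n\ge 0}\sim\mathscr P(1,\pi,\kappa)$ on $[K]$ with $\pi_a>0$ and $\kappa_{a,b}>0$ for all $a,b\in[K]$, and fix $c\in(0,1)$ and $a\in[K]$. Then: (a) The random variable $\mathcal R_{\emptyset,c}$ is finite almost surely under $\mathbb P_a$. (b) For every continuity point $r$ of the distribution of $\mathcal R_{\emptyset,c}$ under $\mathbb P_a$, as $n\to\infty$, almost surely $$n^{-1}\sum_{v\in\mathcal G_n}\mathbf 1\{\mathrm{type}(v)=a,\ R_{v,c}(n)>r\}\to\pi_a\,\mathbb P_a(\mathcal R_{\emptyset,c}>r).$$
   Context: Model. Fix an integer $K\ge1$, $[K]=\{1,\dots,K\}$, a probability mass function $\pi=(\pi_a)_{a\in[K]}$ and a matrix $\kappa=(\kappa_{a,b})_{a,b\in[K]}$. The random network sequence $(\mathcal G_n)_{n\ge0}\sim\mathscr P(1,\pi,\kappa)$ is built on one probability space as follows. $\mathcal G_0$ is a finite rooted tree whose vertices carry types in $[K]$. Given $\mathcal G_0,\dots,\mathcal G_n$, a new vertex $v_{n+1}$ arrives with $\mathrm{type}(v_{n+1})\sim\pi$, independent of $\mathcal G_0,\dots,\mathcal G_n$, and is attached by a single edge to a vertex of $\mathcal G_n$; given $\mathcal G_n$ and $\mathrm{type}(v_{n+1})=b$, it attaches to $v\in\mathcal G_n$ with probability $$\frac{\kappa_{\mathrm{type}(v),b}\deg(v,n)}{\sum_{v'\in\mathcal G_n}\kappa_{\mathrm{type}(v'),b}\deg(v',n)},$$ where $\deg(v,n)$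 is the degree of $v$ in $\mathcal G_n$ (if $\mathcal G_0$ is a single vertex its degree is initialized to be $1$ and increases by one with every edge received). Each $\mathcal G_n$ is a tree rooted at the root of $\mathcal G_0$, with edges directed from child to parent. Derived constants. Let $V_\pi(y)=1-\frac12\sum_{j}\pi_j\big(\log y_j+\log\sum_k y_k\kappa_{k,j}\big)$ for $y$ in the interior of the simplex of probability vectors on $[K]$. It is known to have a unique minimizer $\eta=(\eta_1,\dots,\eta_K)$ there. Set $\nu_b=\pi_b/\sum_l\kappa_{l,b}\eta_l$, $\phi_{a,b}=\kappa_{a,b}\nu_b$, $\phi_a=\sum_b\phi_{a,b}$. Branching process. For $a\in[K]$, $(\mathrm{BP}_a(t))_{t\ge0}$ is the continuous-time multi-type branching process (without deaths) started at time $0$ from one individual (the root $\emptyset$) of type $a$, in which, independently across individuals, an individual of type $a'$ that currently has $N$ children gives birth to a child of type $b$ at rate $\phi_{a',b}(N+1)$. $\mathrm{BP}_a(t)$ is viewed as the family tree of all individuals born by time $t$. PageRank. For $v\in\mathcal G_n$ let $P_l(v,n)$ be the number of directed paths of length $l$ ending at $v$ (descendants of $v$ at generation $l$). The graph-normalized PageRank score with damping factor $c$ (number of vertices times the PageRank score) is $R_{v,c}(n)=(1-c)\big(1+\sum_{l\ge1}c^lP_l(v,n)\big)$. Let $P_{l,\emptyset}(t)$ be the number of individuals of generation $l$ in $\mathrm{BP}_a(t)$, let $\tau$ be exponential with rate $2$ and independent of the branching process, and $\mathcal R_{\emptyset,c}=(1-c)\big(1+\sum_{l\ge1}c^lP_{l,\emptyset}(\tau)\big)$.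 $\mathbb P_a$ denotes the law of $\mathrm{BP}_a(\tau)$ (root of type $a$). *)

(* Defs.v *)
From HB Require Import structures.
From mathcomp Require Export all_boot all_order all_algebra.
From mathcomp Require Export all_classical all_reals all_analysis.

Set Implicit Arguments.
Unset Strict Implicit.
Unset Printing Implicit Defensive.

Import Order.TTheory GRing.Theory Num.Theory.
Import numFieldNormedType.Exports.

Local Open Scope classical_set_scope.
Local Open Scope ring_scope.

(* [(a, [:: (b_1, p_1); ...; (b_m, p_m)])] has vertices 0, ..., m: vertex 0 is
   the root, of type a, and vertex i >= 1 has type b_i and parent p_i.
   Under [wf_tree] each vertex comes after its parent; every finite rooted tree
   can be numbered in this way. *)
Definition rtree (K : nat) : Type := ('I_K * seq ('I_K * nat))%type.

Section Trees.
Variable K : nat.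
Implicit Types (g : rtree K) (v u l : nat).

Definition order g : nat := (size g.2).+1.

(* Meaningful for v < order g only. *)
Definition vtype g v : 'I_K := nth g.1 (g.1 :: unzip1 g.2) v.

Definition parent g v : option nat :=
  if v is v'.+1 then onth (unzip2 g.2) v' else None.

Definition wf_tree g : Prop :=
  forall v p, parent g v = Some p -> (p < v)%N.

Definition attach g (b : 'I_K) (p : nat) : rtree K := (g.1, rcons g.2 (b, p)).

(* [g0] is the initial tree: when it is a single vertex, its degree starts
   from 1 rather than from 0. *)
Definition degree (g0 g : rtree K) v : nat :=
  (#|[pred u : 'I_(order g) | parent g u == Some v]|
   + ((0 < v)%N || (order g0 == 1%N)))%N.

Definition ancestor g l v : option nat := iter l (obind (parent g)) (Some v).

(* Edges point from child to parent, so a directed path of length l ending at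
   v is determined by its starting vertex, a descendant of v at depth l. *)
Definition npaths g l v : nat :=
  #|[pred u : 'I_(order g) | ancestor g l u == Some v]|.

End Trees.

(* Graph-normalized score of a vertex at which [N l] paths of length l end. *)
Definition pagerank (R : realType) (c : R) (N : nat -> \bar R) : \bar R :=
  ((1 - c)%:E * (1 + \sum_(1 <= l <oo) (c ^+ l)%:E * N l))%E.

Definition tree_pagerank (R : realType) (K : nat) (c : R) (g : rtree K)
    (v : nat) : \bar R :=
  pagerank c (fun l => (npaths g l v)%:R%:E).

Section Network.
Context (R : realType) (K : nat).
Variables (mu : 'I_K -> R) (kappa : 'M[R]_K).
Context d (T : measurableType d) (P : probability T R).

Definition attach_prob (g0 g : rtree K) (b : 'I_K) (v : nat) : R :=
  kappa (vtype g v) b * (degree g0 g v)%:R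
  / \sum_(u < order g) kappa (vtype g u) b * (degree g0 g u)%:R.

(* [ty n] and [par n] are the type and the parent of the vertex v_{n+1}. *)
Fixpoint network (g0 : rtree K) (ty : nat -> T -> 'I_K) (par : nat -> T -> nat)
    (n : nat) (w : T) : rtree K :=
  if n is m.+1 then attach (network g0 ty par m w) (ty m w) (par m w) else g0.

Definition history (G : nat -> T -> rtree K) (h : nat -> rtree K) (n : nat) :
    set T :=
  [set w | forall i, (i <= n)%N -> G i w = h i].

Definition is_network (g0 : rtree K) (ty : nat -> T -> 'I_K)
    (par : nat -> T -> nat) : Prop :=
  let G := network g0 ty par in
  [/\ forall n b, measurable [set w | ty n w = b],
      forall n v, measurable [set w | par n w = v],
      forall n h b,
        P (history G h n `&` [set w | ty n w = b])
        = (P (history G h n) * (mu b)%:E)%E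
    & forall n h b v, (v < order (h n))%N ->
        P (history G h n `&` [set w | ty n w = b] `&` [set w | par n w = v])
        = (P (history G h n `&` [set w | ty n w = b])
           * (attach_prob g0 (h n) b v)%:E)%E].

End Network.

Section Constants.
Context (R : realType) (K : nat).
Variables (mu : 'I_K -> R) (kappa : 'M[R]_K).

Definition open_simplex (y : 'I_K -> R) : Prop :=
  (forall i, 0 < y i) /\ \sum_i y i = 1.

Definition Vpot (y : 'I_K -> R) : R :=
  1 - 2^-1 * \sum_j mu j * (ln (y j) + ln (\sum_k y k * kappa k j)).

Definition is_minimizer (eta : 'I_K -> R) : Prop :=
  open_simplex eta /\ forall y, open_simplex y -> Vpot eta <= Vpot y.

Definition nu (eta : 'I_K -> R) (b : 'I_K) : R :=
  mu b / \sum_l kappa l b * eta l.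

Definition phi (eta : 'I_K -> R) (a b : 'I_K) : R := kappa a b * nu eta b.

End Constants.

(* Individuals are Ulam-Harris words: [::] is the root and [k :: u] is the k-th
   child (k = 0, 1, ...) of u. For an individual u of type x that has k
   children, [clk (u, x, k, b)] is the waiting time, counted from the birth of
   the previous child (or of u if k = 0), after which u would give birth to a
   child of type b. The next child of u is the one whose clock rings first; by
   lack of memory the clocks may be renewed at each birth. *)
Definition clock_idx (K : nat) : Type := (seq nat * 'I_K * nat * 'I_K)%type.

Section Branching.
Context (R : realType) (K : nat).
Variables (a : 'I_K) (clk : clock_idx K -> R).

Definition next_child (u : seq nat) (x : 'I_K) (k : nat) : 'I_K :=
  [arg min_(b < x) clk (u, x, k, b)]%O.

Definition waiting_time (u : seq nat) (x : 'I_K) (k : nat) : R :=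
  clk (u, x, k, next_child u x k).

Fixpoint bp_type (u : seq nat) : 'I_K :=
  if u is k :: u' then next_child u' (bp_type u') k else a.

Fixpoint birth_time (u : seq nat) : R :=
  if u is k :: u' then
    birth_time u' + \sum_(j < k.+1) waiting_time u' (bp_type u') j
  else 0.

Definition BP (t : R) : set (seq nat) := [set u | birth_time u <= t].

(* Number of individuals of generation l, possibly infinite a priori. *)
Definition generation_size (t : R) (l : nat) : \bar R :=
  \esum_(u in BP t `&` [set u | size u = l]) 1%E.

Definition bp_pagerank (c t : R) : \bar R := pagerank c (generation_size t).

End Branching.

Section Clocks.
Context (R : realType) d (T : measurableType d) (P : probability T R).

Definition mutually_independent (I : eqType) (X : I -> {RV P >-> R}) : Prop :=
  forall (s : seq I) (A : I -> set R), uniq s -> (forall i, measurable (A i)) ->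
    P (\big[setI/setT]_(i <- s) (X i @^-1` A i))
    = (\prod_(i <- s) P (X i @^-1` A i))%E.

Definition exponentially_distributed (rate : R) (X : {RV P >-> R}) : Prop :=
  forall A, measurable A -> distribution P X A = exponential_prob rate A.

(* [ph x b * (k + 1)] is the rate at which an individual of type x with k
   children gives birth to a child of type b. *)
Definition bp_clocks (K : nat) (ph : 'I_K -> 'I_K -> R)
    (clk : clock_idx K -> {RV P >-> R}) (tau : {RV P >-> R}) : Prop :=
  [/\ forall u x k b,
        exponentially_distributed (ph x b * k.+1%:R) (clk (u, x, k, b)),
      exponentially_distributed 2 tau
    & mutually_independent (fun o : option (clock_idx K) =>
        if o is Some i then clk i else tau)].

End Clocks.

(* Main.v *)
(* The PageRank score of a vertex depends only on its fringe tree, formed by its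
   descendants and recorded in their order of arrival. The share of the total
   degree held by each type converges almost surely to [eta]: the relative
   entropy of [eta] with respect to these shares is a Lyapunov function of the
   recursion, by the first-order condition for the minimum of [Vpot]. Hence the
   number of vertices whose fringe tree is a given tree [h] follows, after
   division by n, a linear recursion with asymptotically constant coefficients.
   Its limit obeys the same one-birth recursion as the probability that the
   branching process, observed at an independent exponential time of rate 2, has
   undergone exactly the births recorded by [h]: at each birth the clocks and the
   observation time compete in a race of independent exponentials. Since the
   branching process does not explode, finitely many histories [h] carry all but
   epsilon of its law, which squeezes the proportion of vertices with a large
   score. Noise is controlled along the times k^4 by second moments and the
   Borel-Cantelli lemma, and the increments are bounded in between. *)
Require Import Defs.
From mathcomp Require Import measurable_realfun.
From mathcomp Require Import zify ring lra.

Set Implicit Arguments.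
Unset Strict Implicit.
Unset Printing Implicit Defensive.

Import Order.TTheory GRing.Theory Num.Theory.
Import numFieldNormedType.Exports.

Local Open Scope classical_set_scope.
Local Open Scope ring_scope.

#[local] Arguments order : simpl never.

(** The network and the branching process live on unrelated probability spaces and are never
    coupled: they are compared only through the numbers [stop_weight h], obtained once (up to the
    factor [mu h.1]) as almost sure limiting frequencies and once as probabilities of disjoint
    events. Since a tree records its own order of arrival, [G n] determines its whole past; the law
    of the network is then the iterate of a finite averaging operator on trees, and martingale
    arguments need neither filtrations nor conditional expectations. The rate 2 comes from the total
    degree, which grows by 2 at each arrival: [n] times the rate at which a fringe tree grows tends
    to half its total birth rate, and the unit contraction due to dividing by the number of vertices
    becomes, after doubling, the rate of the observation time. The obstacle in all these recursions
    is that the noise is bounded but does not vanish; only its averages do, so they are solved after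
    subtracting the running average of the noise. *)

(** * Real recursions with steps of order 1/n *)

Lemma cvgn_epsP (R : realType) (u : nat -> R) (l : R) :
  (u n @[n --> \oo] --> l) <->
  (forall e : R, 0 < e -> exists N, forall n, (N <= n)%N -> `|u n - l| <= e).
Proof.
split=> [/cvgrPdist_le H e e0|H].
  have [N _ HN] := H e e0.
  by exists N => n Hn; rewrite distrC; apply: HN.
apply/cvgrPdist_le => e e0; have [N HN] := H e e0.
by exists N => // n /= Hn; rewrite distrC; apply: HN.
Qed.

Lemma eq_cvgn (R : realType) (u v : nat -> R) (l : R) :
  (forall n, u n = v n) ->
  u n @[n --> \oo] --> l -> v n @[n --> \oo] --> l.
Proof. by move=> /funext ->. Qed.

Lemma cvgn_sum (R : realType) (I : Type) (s : seq I) (u : I -> nat -> R)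
    (l : I -> R) :
  (forall i, u i n @[n --> \oo] --> l i) ->
  (\sum_(i <- s) u i n) @[n --> \oo] --> \sum_(i <- s) l i.
Proof.
move=> H; elim: s => [|i s IH].
  by under eq_fun do rewrite big_nil; rewrite big_nil; exact: cvg_cst.
by under eq_fun do rewrite big_cons; rewrite big_cons; apply: cvgD.
Qed.

Lemma series_harmonic_unbounded (R : realType) (C : R) (N : nat) :
  exists n, (N <= n)%N /\ C < \sum_(N <= i < n) i.+1%:R^-1.
Proof.
apply: contrapT => Hn.
have bd n : (N <= n)%N -> \sum_(N <= i < n) i.+1%:R^-1 <= C.
  move=> le_Nn; rewrite leNgt; apply/negP => lt_C.
  by apply: Hn; exists n.
apply: (@dvg_harmonic R); apply: nondecreasing_is_cvgn.
  by apply: nondecreasing_series => i _ _; exact: harmonic_ge0.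
exists (\sum_(0 <= i < N) i.+1%:R^-1 + Num.max C 0) => _ [n _ <-].
rewrite /series /= /harmonic.
have [le_Nn|lt_nN] := leqP N n.
  rewrite (big_cat_nat (leq0n N) le_Nn) /= lerD2l le_max.
  by rewrite bd.
rewrite (big_cat_nat (leq0n n) (ltnW lt_nN)) /= -addrA lerDl addr_ge0 //.
  by apply: sumr_ge0 => i _; rewrite invr_ge0.
by rewrite le_max lexx orbT.
Qed.

(** As long as [x] exceeds [del], each step lowers it by at least [c * del / 2] times a harmonic
    term, so divergence of the harmonic series brings it below [del]; from then on the contraction
    absorbs the error. The one-sided form suits Lyapunov functions. *)
Lemma contraction_limsup_le0 (R : realType) (c : R) (x e : nat -> R) (N0 : nat) :
  0 < c ->
  (forall n, (N0 <= n)%N ->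
     x n.+1 <= x n * (1 - c / n.+1%:R) + e n / n.+1%:R) ->
  e n @[n --> \oo] --> 0 ->
  forall del : R, 0 < del -> exists N, forall n, (N <= n)%N -> x n <= del.
Proof.
move=> c0 Hx /cvgn_epsP He del del0.
have [|N1 HN1] := He (c * del / 2); first by rewrite divr_gt0 ?mulr_gt0.
pose N2 := Num.trunc c.
(* Past [N2] the factor [1 - c / n.+1] is nonnegative, so that upper bounds on [x n] can be
   multiplied by it. *)
pose N := maxn N0 (maxn N1 N2.+1).
have step n : (N <= n)%N -> x n <= del -> x n.+1 <= del.
  rewrite !geq_max => /and3P[n0 n1 n2] Hn.
  have c1 : c <= n.+1%:R.
    by rewrite ltW// (lt_le_trans (truncnS_gt c))// ler_nat (leqW n2).
  have p1 : 0 < n.+1%:R :> R by rewrite ltr0n.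
  apply: le_trans (Hx _ n0) _.
  have := HN1 _ n1; rewrite subr0 ler_norml => /andP[_ en].
  have c2 : 0 <= 1 - c / n.+1%:R by rewrite subr_ge0 ler_pdivrMr ?mul1r.
  apply: le_trans (lerD (ler_wpM2r c2 Hn) (ler_wpM2r _ en)) _.
    by rewrite invr_ge0 ltW.
  rewrite -subr_ge0.
  have -> : del - (del * (1 - c / n.+1%:R) + c * del / 2 / n.+1%:R) =
    c * del / 2 / n.+1%:R by field; rewrite addrC natr1 gt_eqF.
  by rewrite !divr_ge0 ?mulr_ge0 // ltW.
have [m [le_m Hm]] : exists m, (N <= m)%N /\ x m <= del.
  apply: contrapT => Hno.
  have big n : (N <= n)%N -> del < x n.
    move=> le_n; rewrite ltNge; apply/negP => le_x.
    by apply: Hno; exists n.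
  have dec n : (N <= n)%N -> x n.+1 <= x n - c * del / 2 / n.+1%:R.
    move=> le_n; have := big _ le_n; move: le_n.
    rewrite !geq_max => /and3P[n0 n1 n2] Hn.
    have p1 : 0 < n.+1%:R :> R by rewrite ltr0n.
    apply: le_trans (Hx _ n0) _.
    have := HN1 _ n1; rewrite subr0 ler_norml => /andP[_ en].
    have p2 : 0 <= n.+1%:R^-1 :> R by rewrite invr_ge0 ltW.
    have := ler_wpM2r p2 en.
    have : 0 <= (x n - del) * c * n.+1%:R^-1.
      by rewrite !mulr_ge0 ?subr_ge0 // ltW.
    rewrite -[_ / n.+1%:R]/(_ * _); set m := n.+1%:R^-1 => h1 h2.
    lra.
  have tel k : x (N + k)%N <=
      x N - c * del / 2 * \sum_(N <= i < N + k) i.+1%:R^-1.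
    elim: k => [|k IH]; first by rewrite addn0 big_geq // mulr0 subr0.
    rewrite addnS; apply: le_trans (dec _ (leq_addr _ _)) _.
    rewrite big_nat_recr ?leq_addr //= mulrDr.
    rewrite -[_ / (N + k).+1%:R]/(_ * _); set m := (N + k).+1%:R^-1.
    lra.
  have cd0 : 0 < c * del / 2 by rewrite divr_gt0 ?mulr_gt0.
  have [n [le_n Hn]] :=
    @series_harmonic_unbounded R ((x N - del) / (c * del / 2)) N.
  have := tel (n - N)%N; rewrite subnKC // leNgt => /negP; apply.
  apply: lt_trans (big n le_n).
  by move: Hn; rewrite ltr_pdivrMr // [X in _ < X]mulrC; lra.
exists m => n /subnK <-; elim: (n - m)%N => [|k IH] //.
by rewrite addSn; apply: step => //; rewrite (leq_trans le_m) // leq_addl.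
Qed.

(** The noise [e] need not vanish, only its averages [q]. They satisfy [q n.+1 = q n * (1 - 1 /
    n.+1) + e n / n.+1], so [x - q] obeys the same contraction with [e] replaced by [(1 - c) * q],
    which tends to zero. *)
Lemma cesaro_contraction_limsup_le0 (R : realType) (c : R) (x e r : nat -> R)
    (N0 : nat) :
  0 < c ->
  (forall n, (N0 <= n)%N ->
     x n.+1 <= x n * (1 - c / n.+1%:R) + (e n + r n) / n.+1%:R) ->
  n%:R^-1 * (\sum_(i < n) e i) @[n --> \oo] --> 0 ->
  r n @[n --> \oo] --> 0 ->
  forall del : R, 0 < del -> exists N, forall n, (N <= n)%N -> x n <= del.
Proof.
move=> c0 Hx He Hr del del0.
pose q n : R := n%:R^-1 * \sum_(i < n) e i.
have : (fun n => (1 - c) * q n + r n) n @[n --> \oo] --> 0.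
  rewrite -[X in _ --> X](_ : (1 - c) * 0 + 0 = 0); last by rewrite mulr0 addr0.
  by apply: cvgD => //; apply: cvgM => //; exact: cvg_cst.
move=> /(contraction_limsup_le0 (x := fun n => x n - q n) (N0 := maxn 1 N0) c0).
have d2 : 0 < del / 2 by rewrite divr_gt0.
move=> /(_ _ (del / 2) d2) [|N1 HN1].
  move=> n; rewrite geq_max => /andP[n1 n0].
  have p0 : 0 < n%:R :> R by rewrite ltr0n.
  have p1 : 0 < n.+1%:R :> R by rewrite ltr0n.
  have -> : q n.+1 = q n * (1 - n.+1%:R^-1) + e n / n.+1%:R.
    rewrite /q big_ord_recr /= -natr1; field.
    by rewrite natr1 !gt_eqF.
  have := Hx n n0; rewrite -natr1 => H.
  rewrite -subr_ge0.
  have -> : (x n - q n) * (1 - c / (n%:R + 1)) +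
     ((1 - c) * q n + r n) / (n%:R + 1) -
     (x n.+1 - (q n * (1 - (n%:R + 1)^-1) + e n / (n%:R + 1))) =
     (x n * (1 - c / (n%:R + 1)) + (e n + r n) / (n%:R + 1)) - x n.+1.
    by field; rewrite natr1 gt_eqF.
  by rewrite subr_ge0.
have [N2 HN2] := (cvgn_epsP _ _).1 He _ d2.
exists (maxn N1 N2) => n; rewrite geq_max => /andP[n1 n2].
have := HN1 _ n1; have := HN2 _ n2; rewrite subr0 ler_norml => /andP[_].
rewrite -/(q n); lra.
Qed.

Lemma cesaro_contraction_cvg0 (R : realType) (c : R) (x e r : nat -> R)
    (N0 : nat) :
  0 < c ->
  (forall n, (N0 <= n)%N ->
     x n.+1 = x n * (1 - c / n.+1%:R) + (e n + r n) / n.+1%:R) ->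
  n%:R^-1 * (\sum_(i < n) e i) @[n --> \oo] --> 0 ->
  r n @[n --> \oo] --> 0 ->
  x n @[n --> \oo] --> 0.
Proof.
move=> c0 Hx He Hr; apply/cvgn_epsP => del del0.
have [|N1 HN1] := cesaro_contraction_limsup_le0 c0 _ He Hr del0 (x := x)
  (N0 := N0).
  by move=> n /Hx ->.
have Hr' : (- r n) @[n --> \oo] --> 0.
  by rewrite -[X in _ --> X]oppr0; exact: cvgN.
have He' : n%:R^-1 * (\sum_(i < n) - e i) @[n --> \oo] --> 0.
  apply: (@eq_cvgn _ (fun n => - (n%:R^-1 * \sum_(i < n) e i))) => [n|].
    by rewrite sumrN mulrN.
  by rewrite -[X in _ --> X]oppr0; exact: cvgN.
have [|N2 HN2] := cesaro_contraction_limsup_le0 c0 _ He' Hr' del0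
  (x := fun n => - x n) (e := fun n => - e n) (N0 := N0).
  by move=> n /Hx ->; rewrite le_eqVlt; apply/orP; left; apply/eqP; ring.
exists (maxn N1 N2) => n; rewrite geq_max => /andP[n1 n2].
by rewrite subr0 ler_norml HN1 // lerNl HN2.
Qed.

(** For [u = N / n] the recursion is a contraction of strength [1 + B'] towards its fixed point:
    [B'] is the loss rate and 1 comes from dividing by a growing [n]. The linear bound on [N] keeps
    [u] bounded, which makes the error [(B n - B') * u n] vanish. *)
Lemma linear_recursion_cvg (R : realType) (N A B xi : nat -> R) (A' B' C : R) :
  0 <= B' ->
  (forall n, (0 < n)%N ->
     N n.+1 = N n + A n - B n * (N n / n%:R) + xi n) ->
  (forall n, (0 < n)%N -> `|N n| <= C * n%:R) ->
  A n @[n --> \oo] --> A' -> B n @[n --> \oo] --> B' ->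
  n%:R^-1 * (\sum_(i < n) xi i) @[n --> \oo] --> 0 ->
  n%:R^-1 * N n @[n --> \oo] --> A' / (1 + B').
Proof.
move=> B0 HN bd HA HB Hxi.
pose l := A' / (1 + B').
pose u n : R := n%:R^-1 * N n.
have B1 : 0 < 1 + B' by lra.
have Hr : (fun n => A n - A' - (B n - B') * u n) n @[n --> \oo] --> 0.
  rewrite -[X in _ --> X](_ : (A' - A') - 0 = 0); last by rewrite subrr subr0.
  apply: cvgB; first by apply: cvgB => //; exact: cvg_cst.
  apply/cvgn_epsP => eps e0.
  have C1 : 0 < Num.max C 1 by rewrite lt_max ltr01 orbT.
  have [|M HM] := (cvgn_epsP _ _).1 HB (eps / Num.max C 1).
    by rewrite divr_gt0.
  exists (maxn 1 M) => n; rewrite geq_max => /andP[n1 nM].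
  have p0 : 0 < n%:R :> R by rewrite ltr0n.
  rewrite subr0 normrM.
  have un : `|u n| <= Num.max C 1.
    rewrite /u normrM gtr0_norm ?invr_gt0 // mulrC ler_pdivrMr //.
    by apply: le_trans (bd _ n1) _; rewrite ler_wpM2r ?le_max ?lexx // ltW.
  apply: le_trans (ler_pM _ _ (HM _ nM) un) _ => //.
  by rewrite divfK // gt_eqF.
have : (fun n => u n - l) n @[n --> \oo] --> 0.
  apply: (cesaro_contraction_cvg0 (N0 := 1) B1 _ Hxi Hr) => n n1.
  have p0 : 0 < n%:R :> R by rewrite ltr0n.
  have p1 : 0 < n.+1%:R :> R by rewrite ltr0n.
  rewrite /u /l HN // -natr1; field.
  by rewrite natr1 !gt_eqF.
move=> H; apply: (@eq_cvgn _ (fun n => (u n - l) + l)) => [n|].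
  by rewrite subrK.
by rewrite -[X in _ --> X]add0r; apply: cvgD => //; exact: cvg_cst.
Qed.

(** * Fringe trees *)

Section TreeTheory.
Variable K : nat.
Implicit Types (g h : rtree K) (v u p l : nat) (b : 'I_K).

Definition nchildren g v : nat := count (fun e => e.2 == v) g.2.

Lemma rtree_ind (Pr : rtree K -> Prop) :
  (forall x, Pr (x, [::])) ->
  (forall g b p, Pr g -> Pr (attach g b p)) -> forall g, Pr g.
Proof.
move=> P0 PS [x es]; elim/last_ind: es => [|es [b p] IH]; first exact: P0.
exact: (PS (x, es) b p IH).
Qed.

Lemma order_single (x : 'I_K) : order (x, [::]) = 1%N.
Proof. by []. Qed.

Lemma order_attach g b p : order (attach g b p) = (order g).+1.
Proof. by rewrite /order /= size_rcons. Qed.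

Lemma vtype_attach_lt g b p v :
  (v < order g)%N -> vtype (attach g b p) v = vtype g v.
Proof.
move=> lt_v; rewrite /vtype /= /unzip1 map_rcons -rcons_cons nth_rcons /=.
by rewrite size_map lt_v.
Qed.

Lemma vtype_attach_new g b p : vtype (attach g b p) (order g) = b.
Proof.
by rewrite /vtype /= /unzip1 map_rcons nth_rcons size_map ltnn eqxx.
Qed.

Lemma parent_attach_lt g b p v :
  (v < order g)%N -> parent (attach g b p) v = parent g v.
Proof.
case: v => [|v] //= lt_v; rewrite /unzip2 map_rcons -cats1 onth_cat size_map.
by rewrite -ltnS lt_v.
Qed.

Lemma parent_attach_new g b p : parent (attach g b p) (order g) = Some p.
Proof.
by rewrite /= /unzip2 map_rcons -cats1 onth_cat size_map ltnn subnn.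
Qed.

Lemma parent_lt_order g v p : parent g v = Some p -> (v < order g)%N.
Proof.
case: v => [|v] //= H; rewrite ltnS -(size_map snd) -onthTE.
by rewrite /unzip2 in H; rewrite H.
Qed.

Lemma wf_attach g b p :
  wf_tree (attach g b p) <-> wf_tree g /\ (p < order g)%N.
Proof.
split=> [H|[Hg lt_p] v q Hv].
  split=> [v q Hv|]; last by apply: H; exact: parent_attach_new.
  by apply: H; rewrite parent_attach_lt // (parent_lt_order Hv).
have := parent_lt_order Hv; rewrite order_attach ltnS leq_eqVlt.
case/predU1P => [e|lt_v]; last by apply: Hg; rewrite parent_attach_lt in Hv.
by move: Hv; rewrite e parent_attach_new => -[<-].
Qed.

Lemma wf_tree_ind (Pr : rtree K -> Prop) :
  (forall x, Pr (x, [::])) ->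
  (forall g b p, wf_tree g -> (p < order g)%N -> Pr g -> Pr (attach g b p)) ->
  forall g, wf_tree g -> Pr g.
Proof.
move=> P0 PS; elim/rtree_ind => // g b p IH /wf_attach[wg lt_p].
by apply: PS => //; exact: IH.
Qed.

Lemma nchildren_attach g b p v :
  nchildren (attach g b p) v = (nchildren g v + (p == v))%N.
Proof. by rewrite /nchildren /attach /= -cats1 count_cat /= addn0. Qed.

Lemma card_children g v :
  #|[pred u : 'I_(order g) | parent g u == Some v]| = nchildren g v.
Proof.
rewrite -sum1_card big_mkcond /=.
elim/rtree_ind: g => [x|g b p IH].
  by rewrite big_ord_recl big_ord0.
rewrite order_attach big_ord_recr /= inE parent_attach_new nchildren_attach.
congr addn.
rewrite -[RHS]IH; apply: eq_bigr => i _.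
by rewrite !unfold_in /= parent_attach_lt ?ltn_ord.
Qed.

Lemma degreeE g0 g v :
  degree g0 g v = (nchildren g v + ((0 < v)%N || (order g0 == 1%N)))%N.
Proof. by rewrite /degree card_children. Qed.

Lemma nchildren_ge g v : wf_tree g -> (order g <= v)%N -> nchildren g v = 0%N.
Proof.
move=> wg le_v; rewrite -card_children; apply: eq_card0 => u; rewrite !inE.
apply/eqP => /wg lt_u; have := ltn_ord u; lia.
Qed.

Lemma ancestorS g l v : ancestor g l.+1 v = obind (ancestor g l) (parent g v).
Proof.
rewrite /ancestor iterSr /=; case: (parent g v) => //=.
by elim: l => //= l ->.
Qed.

Lemma ancestor_le g l v u : wf_tree g -> ancestor g l v = Some u -> (u <= v)%N.
Proof.
move=> wg; elim: l v => [|l IH] v; first by move=> [->].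
rewrite ancestorS; case E: (parent g v) => [q|] //= /IH.
by have := wg _ _ E; lia.
Qed.

Lemma ancestor_attach_lt g b p l v : wf_tree g -> (v < order g)%N ->
  ancestor (attach g b p) l v = ancestor g l v.
Proof.
move=> wg; elim: l v => [|l IH] v lt_v //.
rewrite !ancestorS parent_attach_lt //; case E: (parent g v) => [q|] //=.
by apply: IH; have := wg _ _ E; lia.
Qed.

Lemma ancestor_attach_new g b p l : wf_tree g -> (p < order g)%N ->
  ancestor (attach g b p) l.+1 (order g) = ancestor g l p.
Proof.
by move=> wg lt_p; rewrite ancestorS parent_attach_new /= ancestor_attach_lt.
Qed.

Lemma npaths_attach g b p l v : wf_tree g ->
  npaths (attach g b p) l v =
  (npaths g l v + (ancestor (attach g b p) l (order g) == Some v))%N.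
Proof.
move=> wg; rewrite /npaths -!sum1_card big_mkcond.
rewrite [X in _ = (X + _)%N]big_mkcond /=.
rewrite order_attach big_ord_recr /= !inE.
congr addn.
by apply: eq_bigr => i _; rewrite !unfold_in /= ancestor_attach_lt ?ltn_ord.
Qed.

Lemma npaths_ge_order g l v : wf_tree g -> (order g <= l)%N -> npaths g l v = 0%N.
Proof.
move=> wg le_l; apply: eq_card0 => u; rewrite !inE; apply/eqP.
have: (u < l)%N by apply: leq_trans le_l.
elim: l {le_l} (u : nat) => [|l IH] {}u // lt_u.
rewrite ancestorS; case E: (parent g u) => [q|] //=.
by apply: IH; have := wg _ _ E; lia.
Qed.

(** The state consists of the number of the next vertex, the descendants found so far and the edges
    of the renumbered subtree. One pass suffices since parents come before children. *)
Definition fringe_step (s : nat * seq nat * seq ('I_K * nat)) (e : 'I_K * nat) :=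
  if e.2 \in s.1.2
  then (s.1.1.+1, rcons s.1.2 s.1.1, rcons s.2 (e.1, index e.2 s.1.2))
  else (s.1.1.+1, s.1.2, s.2).

Definition fringe_state g v :=
  foldl fringe_step (v.+1, [:: v], [::]) (drop v g.2).

(* The descendants of [v], itself included, in order of arrival. *)
Definition descendants g v : seq nat := (fringe_state g v).1.2.

(* The subtree formed by the descendants of [v], renumbered in order of
   arrival. *)
Definition fringe g v : rtree K := (vtype g v, (fringe_state g v).2).

Lemma fringe_state_attach g b p v : (v < order g)%N ->
  fringe_state (attach g b p) v = fringe_step (fringe_state g v) (b, p).
Proof.
by move=> lt_v; rewrite /fringe_state /= drop_rcons // foldl_rcons.
Qed.

Lemma fringe_state_order g v : (v < order g)%N ->
  (fringe_state g v).1.1 = order g.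
Proof.
elim/rtree_ind: g => [x|g b p IH].
  by rewrite order_single ltnS leqn0 => /eqP ->.
rewrite order_attach ltnS leq_eqVlt => /predU1P[->|lt_v].
  by rewrite /fringe_state drop_oversize // /= size_rcons.
by rewrite fringe_state_attach // /fringe_step; case: ifP => _ /=; rewrite IH.
Qed.

Lemma descendants_attach g b p v : (v < order g)%N ->
  descendants (attach g b p) v =
  if p \in descendants g v then rcons (descendants g v) (order g)
  else descendants g v.
Proof.
move=> lt_v; rewrite /descendants fringe_state_attach // /fringe_step /=.
by case: ifP => //=; rewrite fringe_state_order.
Qed.

Lemma descendants_new g b p : descendants (attach g b p) (order g) = [:: order g].
Proof.
by rewrite /descendants /fringe_state drop_oversize // size_rcons.
Qed.

Lemma fringe_attach g b p v : (v < order g)%N ->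
  fringe (attach g b p) v =
  if p \in descendants g v
  then attach (fringe g v) b (index p (descendants g v)) else fringe g v.
Proof.
move=> lt_v; rewrite /fringe vtype_attach_lt // /attach /=.
rewrite fringe_state_attach // /fringe_step /= -/(descendants g v).
by case: ifP.
Qed.

Lemma fringe_new g b p : fringe (attach g b p) (order g) = (b, [::]).
Proof.
by rewrite /fringe vtype_attach_new /fringe_state drop_oversize // size_rcons.
Qed.

Lemma descendants_bound g v u :
  (v < order g)%N -> u \in descendants g v -> (v <= u < order g)%N.
Proof.
elim/rtree_ind: g u => [x|g b p IH] u.
  by rewrite order_single ltnS leqn0 => /eqP ->; rewrite inE => /eqP ->.
rewrite order_attach ltnS leq_eqVlt => /predU1P[->|lt_v].
  by rewrite descendants_new inE => /eqP ->; rewrite leqnn /=.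
rewrite descendants_attach //; case: ifP => _; last by move/(IH _ lt_v); lia.
by rewrite mem_rcons inE => /predU1P[->|/(IH _ lt_v)]; lia.
Qed.

Lemma descendants_uniq g v : (v < order g)%N -> uniq (descendants g v).
Proof.
elim/rtree_ind: g => [x|g b p IH].
  by rewrite order_single ltnS leqn0 => /eqP ->.
rewrite order_attach ltnS leq_eqVlt => /predU1P[->|lt_v].
  by rewrite descendants_new.
rewrite descendants_attach //; case: ifP => _; last exact: IH.
rewrite rcons_uniq IH // andbT; apply/negP => /(descendants_bound lt_v); lia.
Qed.

Lemma descendants_head g v : (v < order g)%N ->
  exists s, descendants g v = v :: s.
Proof.
elim/rtree_ind: g => [x|g b p IH].
  by rewrite order_single ltnS leqn0 => /eqP ->; exists [::].
rewrite order_attach ltnS leq_eqVlt => /predU1P[->|lt_v].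
  by rewrite descendants_new; exists [::].
have [s E] := IH lt_v.
rewrite descendants_attach // E; case: ifP => _; last by exists s.
by exists (rcons s (order g)).
Qed.

Lemma mem_descendants_self g v : (v < order g)%N -> v \in descendants g v.
Proof. by case/descendants_head => s ->; rewrite inE eqxx. Qed.

Lemma size_descendants g v : (v < order g)%N ->
  size (descendants g v) = order (fringe g v).
Proof.
elim/rtree_ind: g => [x|g b p IH].
  by rewrite order_single ltnS leqn0 => /eqP ->.
rewrite order_attach ltnS leq_eqVlt => /predU1P[->|lt_v].
  by rewrite descendants_new fringe_new.
rewrite descendants_attach // fringe_attach //; case: ifP => _; last exact: IH.
by rewrite size_rcons order_attach IH.
Qed.

Lemma mem_descendants g v u : wf_tree g -> (v < order g)%N -> (u < order g)%N ->
  u \in descendants g v <-> exists l, ancestor g l u = Some v.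
Proof.
move=> wg; elim/wf_tree_ind: g / wg u => [x|g b p wg lt_p IH] u.
  rewrite order_single ltnS leqn0 => /eqP -> /=; rewrite ltnS leqn0 => /eqP ->.
  by rewrite inE; split=> // _; exists 0%N.
rewrite order_attach ltnS leq_eqVlt => /predU1P[->|lt_v].
  rewrite descendants_new inE => lt_u; split.
    by move=> /eqP ->; exists 0%N.
  move=> [l /(@ancestor_le _ _ _ _ ((wf_attach _ _ _).2 (conj wg lt_p)))].
  by lia.
rewrite ltnS leq_eqVlt => /predU1P[->|lt_u]; last first.
  rewrite descendants_attach //.
  have -> : (u \in (if p \in descendants g v then
       rcons (descendants g v) (order g) else descendants g v)) =
       (u \in descendants g v).
    by case: ifP => _ //; rewrite mem_rcons inE ltn_eqF.
  rewrite IH //; split=> -[l Hl]; exists l; move: Hl;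
    by rewrite ancestor_attach_lt.
rewrite descendants_attach //; case: ifP => [/(IH _ lt_v lt_p)[l Hl]|Hp].
  rewrite mem_rcons inE eqxx; split=> // _.
  by exists l.+1; rewrite ancestor_attach_new.
split=> [/(descendants_bound lt_v)|[[|l]]]; first by lia.
  by move=> [] e; rewrite e ltnn in lt_v.
rewrite ancestor_attach_new // => Hl.
by move/negP: Hp; case; apply/IH => //; exists l.
Qed.

Lemma index_new_descendant g v p : (v < order g)%N -> p \in descendants g v ->
  (index p (descendants g v) < order (fringe g v))%N.
Proof. by move=> lt_v Hp; rewrite -size_descendants // index_mem. Qed.

Lemma wf_fringe g v : (v < order g)%N -> wf_tree (fringe g v).
Proof.
elim/rtree_ind: g => [x|g b p IH].
  rewrite order_single ltnS leqn0 => /eqP ->.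
  by move=> [|[|u]] q.
rewrite order_attach ltnS leq_eqVlt => /predU1P[->|lt_v].
  by rewrite fringe_new => -[|[|u]] q.
rewrite fringe_attach //; case: ifP => Hp; last exact: IH.
by apply/wf_attach; split; [exact: IH|exact: index_new_descendant].
Qed.

Lemma vtype_fringe g v i : (v < order g)%N -> (i < order (fringe g v))%N ->
  vtype (fringe g v) i = vtype g (nth 0%N (descendants g v) i).
Proof.
elim/rtree_ind: g i => [x|g b p IH] i.
  by rewrite order_single ltnS leqn0 => /eqP -> /=; rewrite ltnS leqn0 => /eqP ->.
rewrite order_attach ltnS leq_eqVlt => /predU1P[->|lt_v].
  rewrite fringe_new descendants_new order_single ltnS leqn0 => /eqP -> /=.
  by rewrite vtype_attach_new.
rewrite fringe_attach // descendants_attach //; case: ifP => Hp.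
  rewrite order_attach ltnS leq_eqVlt nth_rcons size_descendants //.
  case/predU1P => [->|lt_i].
    by rewrite ltnn eqxx !vtype_attach_new.
  rewrite lt_i !vtype_attach_lt //; first exact: IH.
  have := @descendants_bound _ v (nth 0%N (descendants g v) i) lt_v.
  by rewrite mem_nth ?size_descendants // => /(_ isT)/andP[].
move=> lt_i; rewrite IH // vtype_attach_lt //.
have := @descendants_bound _ v (nth 0%N (descendants g v) i) lt_v.
by rewrite mem_nth ?size_descendants // => /(_ isT)/andP[].
Qed.

(** A fringe tree contains all children of its vertices, so no edge is lost in passing to it. Hence
    the attachment weights inside the fringe tree of a non-root vertex can be read off that tree. *)
Lemma nchildren_fringe g v i : wf_tree g -> (v < order g)%N ->
  (i < order (fringe g v))%N ->
  nchildren (fringe g v) i = nchildren g (nth 0%N (descendants g v) i).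
Proof.
move=> wg; elim/wf_tree_ind: g / wg i => [x|g b p wg lt_p IH] i.
  by rewrite order_single ltnS leqn0 => /eqP -> /=; rewrite ltnS leqn0 => /eqP ->.
rewrite order_attach ltnS leq_eqVlt => /predU1P[->|lt_v].
  rewrite fringe_new descendants_new order_single ltnS leqn0 => /eqP -> /=.
  by rewrite nchildren_attach (nchildren_ge wg) // ltn_eqF.
have nu := descendants_uniq lt_v.
have sz := size_descendants lt_v.
rewrite fringe_attach // descendants_attach //; case: ifP => Hp.
  rewrite order_attach ltnS leq_eqVlt nth_rcons sz.
  rewrite !nchildren_attach.
  case/predU1P => [->|lt_i].
    rewrite ltnn eqxx !nchildren_ge //; last exact: wf_fringe.
    by rewrite !ltn_eqF // index_new_descendant.
  rewrite lt_i IH //; congr addn.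
  rewrite -{2}(nth_index 0%N Hp) nth_uniq // ?sz //.
  exact: index_new_descendant.
move=> lt_i; rewrite IH // nchildren_attach.
case: eqP => [e|]; last by rewrite addn0.
by move: Hp; rewrite e mem_nth // sz.
Qed.

Lemma ancestor_fringe g v l i : wf_tree g -> (v < order g)%N ->
  (i < order (fringe g v))%N ->
  (ancestor (fringe g v) l i == Some 0%N) =
  (ancestor g l (nth 0%N (descendants g v) i) == Some v).
Proof.
move=> wg; elim/wf_tree_ind: g / wg l i => [x|g b p wg lt_p IH] l i.
  by rewrite order_single ltnS leqn0 => /eqP -> /=; rewrite ltnS leqn0 => /eqP ->.
rewrite order_attach ltnS leq_eqVlt => /predU1P[->|lt_v].
  rewrite fringe_new descendants_new order_single ltnS leqn0 => /eqP -> /=.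
  case: l => [|l]; first by rewrite /= !eqxx.
  rewrite ancestorS ancestor_attach_new //.
  by apply/esym/negbTE/eqP => /(ancestor_le wg); lia.
have sz := size_descendants lt_v.
have wf := wf_fringe lt_v.
rewrite fringe_attach // descendants_attach //; case: ifP => Hp; last first.
  move=> lt_i; rewrite IH // ancestor_attach_lt //.
  have := @descendants_bound _ v (nth 0%N (descendants g v) i) lt_v.
  by rewrite mem_nth ?sz // => /(_ isT)/andP[].
rewrite order_attach ltnS leq_eqVlt nth_rcons sz.
case/predU1P => [->|lt_i]; last first.
  rewrite lt_i !ancestor_attach_lt ?IH //.
  have := @descendants_bound _ v (nth 0%N (descendants g v) i) lt_v.
  by rewrite mem_nth ?sz // => /(_ isT)/andP[].
rewrite ltnn eqxx.
case: l => [|l].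
  apply/idP/idP => /eqP[] //.
  by move=> e; rewrite e ltnn in lt_v.
rewrite !ancestor_attach_new //; last exact: index_new_descendant.
by rewrite IH ?index_new_descendant // nth_index.
Qed.

Lemma npaths_fringe g l v : wf_tree g -> (v < order g)%N ->
  npaths (fringe g v) l 0 = npaths g l v.
Proof.
move=> wg; elim/wf_tree_ind: g / wg l => [x|g b p wg lt_p IH] l.
  by rewrite order_single ltnS leqn0 => /eqP ->.
have wa : wf_tree (attach g b p) by apply/wf_attach.
rewrite order_attach ltnS leq_eqVlt => /predU1P[->|lt_v].
  rewrite npaths_attach // [npaths g _ _]eq_card0; last first.
    move=> u; rewrite !inE; apply/eqP => /(ancestor_le wg).
    by have := ltn_ord u; lia.
  rewrite fringe_new add0n; case: l => [|l].
    rewrite eqxx /npaths -sum1_card big_mkcond big_ord_recl big_ord0.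
    by rewrite inE.
  rewrite ancestor_attach_new // npaths_ge_order //; last by case=> [|[]].
  by apply/esym/eqP; rewrite eqb0; apply/eqP => /(ancestor_le wg); lia.
have wf := wf_fringe lt_v.
rewrite npaths_attach // fringe_attach //; case: ifP => Hp.
  rewrite npaths_attach // IH //; congr addn; case: l => [|l].
    apply: (congr1 nat_of_bool); apply/idP/idP => /eqP[] //.
    by move=> e; rewrite e ltnn in lt_v.
  rewrite !ancestor_attach_new //; last exact: index_new_descendant.
  by rewrite ancestor_fringe ?index_new_descendant // nth_index.
rewrite IH // (_ : _ == _ = false) ?addn0 //; apply/eqP; case: l => [|l].
  by move=> [] e; rewrite e ltnn in lt_v.
rewrite ancestor_attach_new // => Hl; move/negP: Hp; case.
by apply/mem_descendants => //; exists l.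
Qed.

(* Two distinct ancestors of the same vertex have nested sets of descendants. *)
Lemma order_fringe_inj g p u v : wf_tree g ->
  (u < order g)%N -> (v < order g)%N -> p \in descendants g u ->
  p \in descendants g v -> order (fringe g u) = order (fringe g v) -> u = v.
Proof.
move=> wg.
have wl u' v' : (u' < order g)%N -> (v' < order g)%N ->
    p \in descendants g u' -> p \in descendants g v' ->
    order (fringe g u') = order (fringe g v') -> ~ (u' < v')%N.
  move=> lt_u lt_v Hu Hv; rewrite -!size_descendants // => e lt_uv.
  have /andP[_ lt_p] := descendants_bound lt_u Hu.
  have [k Hk] := (mem_descendants wg lt_u lt_p).1 Hu.
  have [l Hl] := (mem_descendants wg lt_v lt_p).1 Hv.
  have Hvu : v' \in descendants g u'.
    apply/mem_descendants => //; case: (leqP l k) => [le_lk|lt_kl].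
      exists (k - l)%N; move: Hk Hl; rewrite /ancestor -{1}(subnK le_lk) iterD.
      by move=> <- ->.
    exfalso; move: Hk Hl; rewrite /ancestor -{1}(subnK (ltnW lt_kl)) iterD.
    by move=> -> /(ancestor_le wg); lia.
  (* With [u' < v'], the vertex [v'] descends from [u'], whose descendants then include all those of
     [v'] and [u'] besides: the sizes cannot agree. *)
  have sub : {subset u' :: descendants g v' <= descendants g u'}.
    move=> x; rewrite inE => /predU1P[->|Hx]; first exact: mem_descendants_self.
    have /andP[_ lt_x] := descendants_bound lt_v Hx.
    have [i Hi] := (mem_descendants wg lt_v lt_x).1 Hx.
    have [j Hj] := (mem_descendants wg lt_u lt_v).1 Hvu.
    apply/mem_descendants => //; exists (j + i)%N.
    by move: Hi Hj; rewrite /ancestor iterD => ->.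
  have /uniq_leq_size/(_ sub) : uniq (u' :: descendants g v').
    rewrite /= descendants_uniq // andbT.
    by apply/negP => /(descendants_bound lt_v); lia.
  by rewrite /= e ltnn.
move=> lt_u lt_v Hu Hv e; case: (ltngtP u v) => // lt_uv; exfalso.
  exact: wl lt_uv.
by apply: (wl v u).
Qed.

End TreeTheory.

(** * Real-valued probabilities *)

Section RealProbability.
Context (R : realType) d (T : measurableType d) (P : probability T R).

Definition pr (A : set T) : R := fine (P A).

Lemma prE (A : set T) : measurable A -> P A = (pr A)%:E.
Proof. by move=> mA; rewrite /pr fineK // fin_num_measure. Qed.

Lemma pr_ge0 (A : set T) : 0 <= pr A.
Proof. by rewrite /pr fine_ge0. Qed.

Lemma prT : pr setT = 1.
Proof. by rewrite /pr probability_setT. Qed.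

Lemma pr0 : pr set0 = 0.
Proof. by rewrite /pr measure0. Qed.

Lemma pr_le1 (A : set T) : measurable A -> pr A <= 1.
Proof. by move=> mA; rewrite -lee_fin -prE // probability_le1. Qed.

Lemma pr_le (A B : set T) :
  measurable A -> measurable B -> A `<=` B -> pr A <= pr B.
Proof.
by move=> mA mB AB; rewrite -lee_fin -!prE //; apply: le_measure; rewrite ?inE.
Qed.

Lemma prID (A B : set T) : measurable A -> measurable B ->
  pr A = pr (A `&` B) + pr (A `\` B).
Proof.
move=> mA mB; apply: EFin_inj; rewrite EFinD -!prE //.
- by rewrite addeC; apply: measureDI.
- exact: measurableD.
- exact: measurableI.
Qed.

Lemma prD (A B : set T) : measurable A -> measurable B -> B `<=` A ->
  pr (A `\` B) = pr A - pr B.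
Proof.
move=> mA mB BA; rewrite (prID mA mB) [A `&` B]setIidr //; ring.
Qed.

Lemma prU_le (A B : set T) : measurable A -> measurable B ->
  pr (A `|` B) <= pr A + pr B.
Proof.
move=> mA mB; rewrite -lee_fin EFinD -!prE //; last exact: measurableU.
exact: measureU2.
Qed.

Lemma pr_bigU_le (I : Type) (s : seq I) (A : I -> set T) :
  (forall i, measurable (A i)) ->
  pr (\big[setU/set0]_(i <- s) A i) <= \sum_(i <- s) pr (A i).
Proof.
move=> mA; elim: s => [|i s IH]; first by rewrite !big_nil pr0.
rewrite !big_cons; apply: le_trans (prU_le _ _) _ => //.
  by apply: bigsetU_measurable.
by rewrite lerD2l.
Qed.

Lemma pr_partition (I : choiceType) (s : seq I) (A : set T) (C : I -> set T) :
  uniq s -> measurable A -> (forall i, measurable (C i)) ->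
  (forall i j, i != j -> C i `&` C j = set0) ->
  pr A = \sum_(i <- s) pr (A `&` C i) + pr (A `\` \big[setU/set0]_(i <- s) C i).
Proof.
move=> us mA mC dC; elim: s us => [|i s IH] /=.
  by rewrite !big_nil setD0 add0r.
move=> /andP[i_s us]; rewrite !big_cons (IH us).
have mU : measurable (\big[setU/set0]_(j <- s) C j).
  exact: bigsetU_measurable.
rewrite (prID (measurableD mA mU) (mC i)).
have -> : (A `\` \big[setU/set0]_(j <- s) C j) `&` C i = A `&` C i.
  apply/seteqP; split => [w [[Aw _] Cw] //|w [Aw Cw]].
  split=> //; split=> //; rewrite -bigcup_seq => -[j /= js Cj].
  have ij : i != j by apply: contraNneq i_s => ->.
  by have : (C i `&` C j) w by []; rewrite dC.
rewrite setDDl [in RHS]setUC; ring.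
Qed.

Lemma pr_disjoint_sum_le (I : choiceType) (s : seq I) (A : set T) (C : I -> set T) :
  uniq s -> measurable A -> (forall i, measurable (C i)) ->
  (forall i j, i != j -> C i `&` C j = set0) ->
  \sum_(i <- s) pr (A `&` C i) <= pr A.
Proof.
move=> us mA mC dC; rewrite [leRHS](pr_partition us mA mC dC).
by rewrite lerDl pr_ge0.
Qed.

Lemma borel_cantelli (F : nat -> set T) (b : nat -> R) (B : R) :
  (forall k, measurable (F k)) -> (forall k, pr (F k) <= b k) ->
  (forall n, \sum_(0 <= k < n) b k <= B) ->
  {ae P, forall w, exists k0, forall k, (k0 <= k)%N -> ~ F k w}.
Proof.
move=> mF Fb bB.
have PF k : (P (F k) <= (b k)%:E)%E by rewrite prE // lee_fin.
have H : P (lim_sup_set F) = 0%E.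
  apply: lim_sup_set_cvg0 => //.
  apply: (@le_lt_trans _ _ B%:E); last exact: ltry.
  apply: lime_le; first by apply: is_cvg_nneseries => n _ _; exact: measure_ge0.
  near=> n; apply: (@le_trans _ _ (\sum_(0 <= k < n) b k)%:E); last first.
    by rewrite lee_fin.
  by rewrite -sumEFin; apply: lee_sum => k _; exact: PF.
have mL : measurable (lim_sup_set F).
  apply: bigcapT_measurable => n; apply: bigcup_measurable => k _; exact: mF.
exists (lim_sup_set F); split=> // w /= Hw n _.
apply: contrapT => Hn; apply: Hw; exists n => k le_nk Fk; apply: Hn.
by exists k.
Unshelve. all: end_near. Qed.

End RealProbability.

Lemma sum_inv_square_le (R : realType) (n : nat) :
  \sum_(0 <= k < n) (k.+1%:R ^+ 2)^-1 <= 2 :> R.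
Proof.
have H : \sum_(0 <= k < n.+1) (k.+1%:R ^+ 2)^-1 <= 2 - n.+1%:R^-1 :> R.
  elim: n => [|n IH]; first by rewrite big_nat1 expr1n invr1; lra.
  rewrite big_nat_recr //=; apply: le_trans (lerD IH (lexx _)) _.
  rewrite -[n.+2%:R]natr1.
  have x0 : 0 < n.+1%:R :> R by rewrite ltr0n.
  move: (n.+1%:R : R) x0 => x x0.
  have : (x + 1)^-1 + ((x + 1) ^+ 2)^-1 <= x^-1.
    have x1 : 0 < x + 1 by lra.
    rewrite -subr_ge0.
    have -> : x^-1 - ((x + 1)^-1 + ((x + 1) ^+ 2)^-1) = (x * (x + 1) ^+ 2)^-1.
      by field; rewrite !gt_eqF.
    by rewrite invr_ge0 mulr_ge0 ?exprn_ge0 // ltW.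
  by move: (x + 1)^-1 ((x + 1) ^+ 2)^-1 x^-1 => a b c; lra.
case: n H => [|n] H; first by rewrite big_geq.
rewrite big_nat_recr //= in H; apply: le_trans _ (_ : _ <= 2 - n.+2%:R^-1 :> R) _.
  apply: le_trans H; rewrite lerDl invr_ge0 exprn_ge0 //.
by rewrite gerBl invr_ge0.
Qed.

(* Polynomial gaps: consecutive fourth powers are close enough for bounded
   increments to fill in between them. *)
Lemma bounded_increments_interpolation (R : realType) (S : nat -> R) (C : R) :
  0 <= C -> (forall n, `|S n.+1 - S n| <= C) ->
  (exists k0, forall k, (k0 <= k)%N -> `|S (k ^ 4)%N| <= k%:R ^+ 3) ->
  n%:R^-1 * S n @[n --> \oo] --> 0.
Proof.
move=> C0 incr [k0 Hk0].
have incrk n m : `|S (n + m)%N - S n| <= C * m%:R.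
  elim: m => [|m IH]; first by rewrite addn0 subrr normr0 mulr0.
  rewrite addnS -natr1 mulrDr mulr1.
  rewrite (_ : _ - _ = (S (n + m).+1 - S (n + m)%N) + (S (n + m)%N - S n));
    last by ring.
  by apply: le_trans (ler_normD _ _) _; rewrite addrC lerD.
apply/cvgn_epsP => e e0.
(* The 15 bounds the gap between fourth powers: [(k + 1)^4 - k^4 <= 15 * k^3] for [k >= 1]. Past
   [k1], [1 + 15 * C <= e * k], so that [|S n| <= e * k^4 <= e * n]. *)
pose k1 := (Num.trunc ((1 + 15 * C) / e)).+1.
pose K0 := maxn (maxn k0 k1) 1.
exists (K0 ^ 4)%N => n le_n.
have [k [le_k le_kn lt_nk]] : exists k, [/\ (K0 <= k)%N, (k ^ 4 <= n)%N &
    (n < k.+1 ^ 4)%N].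
  have ex : exists k, (n < k.+1 ^ 4)%N.
    by exists n; rewrite -[X in (X <= _)%N]expn1 leq_pexp2l.
  have [m lt_m min_m] := ex_minnP ex.
  exists m; split=> //.
    by rewrite -ltnS -(ltn_exp2r _ _ (e := 4)) // (leq_ltn_trans le_n).
  case: m lt_m min_m => [|m] _ min_m; first by rewrite exp0n.
  by rewrite leqNgt; apply/negP => /min_m; rewrite ltnn.
have k_gt0 : (0 < k)%N by rewrite (leq_trans _ le_k) // leq_max orbT.
have kR : 0 < k%:R :> R by rewrite ltr0n.
have k1R : 1 <= k%:R :> R by rewrite ler1n.
have n0 : 0 < n%:R :> R.
  by rewrite ltr0n (leq_trans _ le_kn) // expn_gt0 k_gt0.
have hS : `|S n| <= (1 + 15 * C) * k%:R ^+ 3.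
  rewrite (_ : S n = (S n - S (k ^ 4)%N) + S (k ^ 4)%N); last by ring.
  apply: le_trans (ler_normD _ _) _; rewrite mulrDl mul1r addrC lerD //.
    by apply: Hk0; rewrite (leq_trans _ le_k) // !leq_max leqnn.
  rewrite -{1}(subnKC le_kn); apply: le_trans (incrk _ _) _.
  rewrite [15 * C]mulrC -mulrA ler_wpM2l //.
  rewrite natrB //.
  have : (n%:R : R) <= (k.+1 ^ 4)%:R by rewrite ler_nat ltnW.
  rewrite !natrX -natr1.
  have a1 : k%:R <= k%:R ^+ 2 :> R by rewrite expr2 ler_peMl // ltW.
  have a2 : k%:R ^+ 2 <= k%:R ^+ 3 :> R by rewrite [leRHS]exprS ler_peMl // exprn_ge0 // ltW.
  have -> : (k%:R + 1 : R) ^+ 4 = k%:R ^+ 4 + 4 * k%:R ^+ 3 + 6 * k%:R ^+ 2 +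
    4 * k%:R + 1 by ring.
  move: (n%:R : R) k1R a1 a2 => N; move: (k%:R ^+ 4) (k%:R ^+ 3) (k%:R ^+ 2) => a b c'.
  by lra.
rewrite subr0 normrM gtr0_norm ?invr_gt0 // mulrC ler_pdivrMr //.
apply: le_trans hS _.
have le1 : (1 + 15 * C) <= e * k%:R.
  have := truncnS_gt ((1 + 15 * C) / e); rewrite ltr_pdivrMr // => /ltW.
  move=> /le_trans; apply; rewrite mulrC ler_wpM2l ?(ltW e0) // ler_nat.
  by rewrite (leq_trans _ le_k) // !leq_max leqnn orbT.
apply: (@le_trans _ _ (e * k%:R * k%:R ^+ 3)).
  by rewrite ler_wpM2r // exprn_ge0 // ltW.
by rewrite -mulrA -exprS ler_wpM2l ?(ltW e0) // -natrX ler_nat.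
Qed.

(** * A law of large numbers for the network *)

Section Transition.
Context (R : realType) (K : nat).
Variables (mu : 'I_K -> R) (kappa : 'M[R]_K).
Hypothesis mu_gt0 : forall x, 0 < mu x.
Hypothesis mu_sum1 : \sum_x mu x = 1.
Hypothesis kappa_gt0 : forall x y, 0 < kappa x y.
Variable g0 : rtree K.
Hypothesis g0_wf : wf_tree g0.

(** Asks less than being an extension of [g0]: the size comparison already yields a vertex of
    positive degree, which makes the attachment probabilities meaningful, and both clauses persist
    when a vertex is attached to an existing one. *)
Definition reachable (g : rtree K) : Prop :=
  wf_tree g /\ (order g0 <= order g)%N.

Lemma reachable_attach g b p : reachable g -> (p < order g)%N ->
  reachable (attach g b p).
Proof.
move=> [wg le_g] lt_p; split; first exact/wf_attach.
by rewrite order_attach (leq_trans le_g).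
Qed.

Definition attach_mass (g : rtree K) (b : 'I_K) : R :=
  \sum_(u < order g) kappa (vtype g u) b * (degree g0 g u)%:R.

Lemma attach_massE g b : attach_mass g b =
  \sum_(u < order g) kappa (vtype g u) b * (degree g0 g u)%:R.
Proof. by []. Qed.

Lemma attach_mass_gt0 g b : reachable g -> 0 < attach_mass g b.
Proof.
move=> [wg le_g].
have [u du] : exists u : 'I_(order g), (0 < degree g0 g u)%N.
  have [g1|g1] := eqVneq (order g0) 1%N.
    by exists ord0; rewrite degreeE g1 eqxx orbT addn1.
  have lt1 : (1 < order g)%N by rewrite /order in g1 le_g *; lia.
  by exists (Ordinal lt1); rewrite degreeE /= addn1.
rewrite /attach_mass (bigD1 u) //= ltr_pwDl //.
  by rewrite mulr_gt0 ?ltr0n.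
by apply: sumr_ge0 => i _; rewrite mulr_ge0 ?ler0n // ltW.
Qed.

Definition step_prob (g : rtree K) (b : 'I_K) (p : nat) : R :=
  mu b * attach_prob kappa g0 g b p.

Lemma step_prob_ge0 g b p : reachable g -> 0 <= step_prob g b p.
Proof.
move=> rg; rewrite mulr_ge0 ?(ltW (mu_gt0 _)) //.
rewrite /attach_prob divr_ge0 // ?(ltW (attach_mass_gt0 b rg)) //.
by rewrite mulr_ge0 ?ler0n // ltW.
Qed.

Lemma step_prob_sum_parent g b : reachable g ->
  \sum_(p < order g) step_prob g b p = mu b.
Proof.
move=> rg; rewrite -mulr_sumr -mulr_suml -[\sum_(_ < _) _ as X in X / _]attach_massE.
by rewrite /attach_prob -attach_massE divff ?mulr1 // gt_eqF // attach_mass_gt0.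
Qed.

Lemma step_prob_sum1 g : reachable g ->
  \sum_b \sum_(p < order g) step_prob g b p = 1.
Proof.
by move=> rg; rewrite -mu_sum1; apply: eq_bigr => b _; exact: step_prob_sum_parent.
Qed.

(** Serves as the conditional expectation of [f] at the next arrival given the tree [g];
    [transition] is the corresponding Markov operator. *)
Definition step_mean (f : rtree K -> 'I_K -> nat -> R) (g : rtree K) : R :=
  \sum_b \sum_(p < order g) step_prob g b p * f g b p.

Definition transition (F : rtree K -> R) : rtree K -> R :=
  step_mean (fun g b p => F (attach g b p)).

Lemma step_mean_le (f1 f2 : rtree K -> 'I_K -> nat -> R) g : reachable g ->
  (forall b p, (p < order g)%N -> f1 g b p <= f2 g b p) ->
  step_mean f1 g <= step_mean f2 g.
Proof.
move=> rg le12; apply: ler_sum => b _; apply: ler_sum => p _.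
by rewrite ler_wpM2l ?step_prob_ge0 // le12.
Qed.

Lemma step_mean_lin (f1 f2 : rtree K -> 'I_K -> nat -> R) (a c e : R) g :
  reachable g ->
  step_mean (fun g b p => a * f1 g b p + c * f2 g b p + e) g =
  a * step_mean f1 g + c * step_mean f2 g + e.
Proof.
move=> rg; rewrite -[in RHS](mulr1 e) -(step_prob_sum1 rg) /step_mean !mulr_sumr.
rewrite -!big_split /=; apply: eq_bigr => b _.
rewrite !mulr_sumr -!big_split /=; apply: eq_bigr => p _; ring.
Qed.

Lemma eq_step_mean (f1 f2 : rtree K -> 'I_K -> nat -> R) g :
  (forall b p, (p < order g)%N -> f1 g b p = f2 g b p) ->
  step_mean f1 g = step_mean f2 g.
Proof.
move=> e12; apply: eq_bigr => b _; apply: eq_bigr => p _.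
by rewrite e12.
Qed.

Lemma step_mean_cst (a : R) g : reachable g -> step_mean (fun _ _ _ => a) g = a.
Proof.
move=> rg; transitivity (step_mean (fun g b p => 0 * 0 + 0 * 0 + a) g).
  by apply: eq_step_mean => b p _; rewrite !mul0r !add0r.
by rewrite (step_mean_lin (fun _ _ _ => 0) (fun _ _ _ => 0)) // !mul0r !add0r.
Qed.

Lemma iter_transition_le (F1 F2 : rtree K -> R) n g : reachable g ->
  (forall h, reachable h -> F1 h <= F2 h) ->
  iter n transition F1 g <= iter n transition F2 g.
Proof.
move=> rg le12; elim: n g rg => [|n IH] g rg; first exact: le12.
by apply: step_mean_le => // b p lt_p; apply: IH; exact: reachable_attach.
Qed.

Lemma iter_transition_scale (F : rtree K -> R) c n g : reachable g ->
  iter n transition (fun h => c * F h) g = c * iter n transition F g.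
Proof.
move=> rg; elim: n g rg => [|n IH] g rg //=.
transitivity (step_mean (fun g b p => c * iter n transition F (attach g b p) +
   0 * 0 + 0) g).
  apply: eq_step_mean => b p lt_p.
  by rewrite IH ?mul0r ?addr0 //; exact: reachable_attach.
by rewrite (step_mean_lin _ (fun _ _ _ => 0)) // mul0r !addr0.
Qed.

Section Martingale.
Variables (f : rtree K -> 'I_K -> nat -> R) (C : R).
Hypothesis f_bound : forall g b p, reachable g -> (p < order g)%N ->
  `|f g b p| <= C.

Lemma step_mean_bound g : reachable g -> `|step_mean f g| <= C.
Proof.
move=> rg; rewrite ler_norml -[X in X <= _](step_mean_cst (- C) rg).
rewrite -[X in _ && (_ <= X)](step_mean_cst C rg).
by apply/andP; split; apply: step_mean_le => // b p lt_p;
  move: (f_bound b rg lt_p); rewrite ler_norml => /andP[].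
Qed.

Definition history_trunc (g : rtree K) (i : nat) : rtree K := (g.1, take i g.2).

Lemma history_trunc_attach g b p i : (i <= size g.2)%N ->
  history_trunc (attach g b p) i = history_trunc g i.
Proof. by move=> le_i; rewrite /history_trunc /= -cats1 takel_cat. Qed.

Lemma history_trunc_size g : history_trunc g (size g.2) = g.
Proof. by case: g => x s; rewrite /history_trunc /= take_size. Qed.

(* The compensated sum of [f] along the construction of [g] from [g0], which is
   a function of [g] because [g] records the order of arrival. *)
Definition compensated (g : rtree K) : R :=
  \sum_(size g0.2 <= i < size g.2)
    (let h := history_trunc g i in
     f h (nth h.1 (unzip1 g.2) i) (nth 0%N (unzip2 g.2) i) - step_mean f h).

Lemma compensated_g0 : compensated g0 = 0.
Proof. by rewrite /compensated big_geq. Qed.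

Lemma compensated_attach g b p : (order g0 <= order g)%N ->
  compensated (attach g b p) = compensated g + (f g b p - step_mean f g).
Proof.
rewrite /order ltnS => le_g; rewrite /compensated /= size_rcons big_nat_recr //=.
congr (_ + _).
  apply: eq_big_nat => i /andP[_ lt_i].
  rewrite (history_trunc_attach _ _ (ltnW lt_i)) /unzip1 /unzip2 !map_rcons.
  by rewrite !nth_rcons !size_map lt_i.
rewrite history_trunc_attach // history_trunc_size /unzip1 /unzip2 !map_rcons.
by rewrite !nth_rcons !size_map ltnn eqxx.
Qed.

(** Orthogonality of martingale increments: with [M] the current value and [m] the mean of [f], one
    step has mean square [M^2 - m^2] plus the mean of [f^2]. The induction removes the first step,
    not the last, in accordance with the way [transition] is iterated. *)
Lemma second_moment n g : reachable g ->
  iter n transition (fun h => compensated h ^+ 2) g <=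
  compensated g ^+ 2 + C ^+ 2 *+ n.
Proof.
elim: n g => [|n IH] g rg; first by rewrite mulr0n addr0.
rewrite iterS; apply: le_trans (_ : _ <= step_mean (fun h b p =>
    compensated (attach h b p) ^+ 2 + C ^+ 2 *+ n) g) _.
  by apply: step_mean_le => // b p lt_p; apply: IH; exact: reachable_attach.
set M := compensated g; set m := step_mean f g.
have -> : step_mean (fun h b p =>
    compensated (attach h b p) ^+ 2 + C ^+ 2 *+ n) g =
  step_mean (fun h b p => (2 * (M - m)) * f h b p + 1 * f h b p ^+ 2 +
     ((M - m) ^+ 2 + C ^+ 2 *+ n)) g.
  apply: eq_step_mean => b p lt_p.
  by rewrite compensated_attach ?(proj2 rg) // -/M -/m; ring.
rewrite (step_mean_lin f (fun h b p => f h b p ^+ 2)) // -/m mulrSr.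
have : step_mean (fun h b p => f h b p ^+ 2) g <= C ^+ 2.
  rewrite -[leRHS](step_mean_cst _ rg); apply: step_mean_le => // b p lt_p.
  rewrite -[leLHS]real_normK ?num_real // ler_sqr ?nnegrE //.
    exact: f_bound.
  exact: le_trans (normr_ge0 _) (f_bound b rg lt_p).
have := sqr_ge0 m; move: (step_mean _ g) (C ^+ 2 *+ n) (C ^+ 2) => a b c.
by rewrite mul1r !expr2; nra.
Qed.

End Martingale.

Section Law.
Context d (T : measurableType d) (P : probability T R).
Variables (ty : nat -> T -> 'I_K) (par : nat -> T -> nat).
Hypothesis G_network : is_network mu kappa P g0 ty par.
Let G := network g0 ty par.

Lemma size_network n w : size (G n w).2 = (size g0.2 + n)%N.
Proof.
elim: n => [|n IH]; first by rewrite addn0.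
by rewrite /= size_rcons IH addnS.
Qed.

Lemma order_network n w : order (G n w) = (order g0 + n)%N.
Proof. by rewrite /order size_network. Qed.

Lemma network_trunc n i w : (i <= n)%N ->
  G i w = history_trunc (G n w) (size g0.2 + i).
Proof.
elim: n => [|n IH].
  by rewrite leqn0 => /eqP ->; rewrite addn0 history_trunc_size.
rewrite leq_eqVlt => /predU1P[->|].
  by rewrite -(size_network n.+1 w) history_trunc_size.
rewrite ltnS => le_in; rewrite IH // history_trunc_attach //.
by rewrite size_network leq_add2l.
Qed.

Lemma measurable_ty n b : measurable [set w | ty n w = b].
Proof. by case: G_network => + _ _ _; apply. Qed.

Lemma measurable_par n v : measurable [set w | par n w = v].
Proof. by case: G_network => _ + _ _; apply. Qed.

Lemma attach_inj (g g' : rtree K) b b' p p' :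
  attach g b p = attach g' b' p' -> [/\ g = g', b = b' & p = p'].
Proof.
by case: g g' => [x s] [x' s'] [-> /rcons_inj[-> -> ->]].
Qed.

Lemma network_step_event n g b p :
  [set w | G n.+1 w = attach g b p] =
  [set w | G n w = g] `&` [set w | ty n w = b] `&` [set w | par n w = p].
Proof.
apply/seteqP; split => w; first by move=> /attach_inj[? ? ?].
by move=> [[/= <- <-] <-].
Qed.

Lemma measurable_network_eq n g : measurable [set w | G n w = g].
Proof.
elim: n g => [|n IH] g.
  have [->|ne] := eqVneq g g0.
    by rewrite (_ : [set w | _] = setT) //; apply/seteqP; split.
  rewrite (_ : [set w | _] = set0) //; apply/seteqP; split => w //= e.
  by rewrite -e eqxx in ne.
elim/rtree_ind: g => [x|g b p _].
  rewrite (_ : [set w | _] = set0) //; apply/seteqP; split => w //= [_ e].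
  by have := congr1 size e; rewrite size_rcons.
rewrite network_step_event; apply: measurableI; last exact: measurable_par.
by apply: measurableI => //; exact: measurable_ty.
Qed.

Lemma measurable_network n (A : set (rtree K)) : measurable [set w | A (G n w)].
Proof.
have -> : [set w | A (G n w)] =
    \bigcup_(g : rtree K) (if pselect (A g) then [set w | G n w = g] else set0).
  apply/seteqP; split => [w /= Aw|w [g _]].
    by exists (G n w) => //; case: pselect.
  by case: pselect => //= Ag e; rewrite e.
apply: countable_bigcupT_measurable; first exact: countableP.
by move=> g; case: pselect => ? /=; first exact: measurable_network_eq.
Qed.

(** The defining property of the network conditions on a whole history, but the history is a
    function of the current tree, so the event [G n = g] already fixes it. A tree [g] of the wrong
    size gives two zero probabilities. *)
Lemma pr_network_step n g b p : (p < order g)%N ->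
  pr P [set w | G n.+1 w = attach g b p] =
  pr P [set w | G n w = g] * step_prob g b p.
Proof.
move=> lt_p; rewrite network_step_event.
have [sz|sz] := eqVneq (size g.2) (size g0.2 + n)%N; last first.
  rewrite (_ : [set w | G n w = g] = set0); last first.
    apply/seteqP; split => w //= e.
    by move: sz; rewrite -e size_network eqxx.
  by rewrite !set0I pr0 mul0r.
pose h i := history_trunc g (size g0.2 + i).
have hn : h n = g by rewrite /h -sz history_trunc_size.
have hE : history G h n = [set w | G n w = g].
  apply/seteqP; split => [w /(_ n (leqnn n)) /= ->//|w /= e i le_i].
  by rewrite (network_trunc _ le_i) e.
have mh := measurable_network_eq n g.
case: G_network => _ _ Hty Hpar; rewrite -/G in Hty Hpar.
have := Hpar n h b p; rewrite hn hE => /(_ lt_p) Hp.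
have := Hty n h b; rewrite hE => Ht.
by rewrite /pr Hp Ht (prE P mh) -!EFinM /= /step_prob mulrA.
Qed.

(** The Markov property, by summing over the possible next trees. [par] may take values outside the
    tree, but by [step_prob_sum1] the valid attachments already carry the full probability of
    [G m = g]; the rest is null. *)
Lemma pr_network_iter k m g (A : pred (rtree K)) : reachable g ->
  pr P ([set w | G m w = g] `&` [set w | A (G (m + k)%N w)]) =
  pr P [set w | G m w = g] * iter k transition (fun h => (A h)%:R) g.
Proof.
elim: k m g => [|k IH] m g rg.
  rewrite addn0 /=; case Ag : (A g); rewrite ?mulr1 ?mulr0; last first.
    rewrite -[RHS](pr0 P); congr pr; apply/seteqP; split => w //= [->].
    by rewrite Ag.
  by congr pr; apply/seteqP; split => [w []//|w /= e]; rewrite e.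
pose C (i : 'I_K * 'I_(order g)) := [set w | G m.+1 w = attach g i.1 i.2].
have mC i : measurable (C i) by exact: measurable_network_eq.
have dC i j : i != j -> C i `&` C j = set0.
  move=> ij; apply/seteqP; split => w // -[Ci Cj].
  have [_ e1 e2] := attach_inj (etrans (esym Ci) Cj).
  by move/eqP: ij; case; case: i j e1 e2 {Ci Cj} => [i1 i2] [j1 j2] /= -> /val_inj ->.
have mg := measurable_network_eq m g.
have CS i : C i `<=` [set w | G m w = g].
  by rewrite /C network_step_event => w [[]].
have ue : uniq (index_enum ('I_K * 'I_(order g))%type) by exact: index_enum_uniq.
have sumC : \sum_(i <- index_enum ('I_K * 'I_(order g))%type) pr P (C i) =
    pr P [set w | G m w = g].
  rewrite -(pair_bigA _ (fun b p => pr P (C (b, p)))) /=.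
  under eq_bigr do under eq_bigr do rewrite pr_network_step //.
  under eq_bigr do rewrite -mulr_sumr.
  by rewrite -mulr_sumr step_prob_sum1 // mulr1.
have rest0 : pr P ([set w | G m w = g] `\`
    \big[setU/set0]_(i <- index_enum ('I_K * 'I_(order g))%type) C i) = 0.
  have := pr_partition P ue mg mC dC.
  rewrite (eq_bigr (fun i => pr P (C i))); last first.
    by move=> i _; rewrite [_ `&` C i]setIidr.
  by rewrite sumC; lra.
have mA := measurable_network (m + k.+1) A.
rewrite (pr_partition P ue (measurableI _ _ mg mA) mC dC).
rewrite [X in _ + X](_ : _ = 0); last first.
  apply/le_anti; rewrite pr_ge0 andbT -[leRHS]rest0; apply: pr_le.
  - by apply: measurableD; [exact: measurableI|exact: bigsetU_measurable].
  - by apply: measurableD => //; exact: bigsetU_measurable.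
  - by move=> w [[]].
rewrite addr0 -(pair_bigA _ (fun b p => pr P (_ `&` C (b, p)))) /=.
rewrite mulr_sumr; apply: eq_bigr => b _; rewrite mulr_sumr.
apply: eq_bigr => p _; rewrite mulrA -pr_network_step // -IH; last first.
  exact: reachable_attach.
congr pr; rewrite addSnnS setIC; apply/seteqP; split => w; first by move=> [? [_ ?]].
by move=> [Cw Aw]; split=> //; split=> //; exact: (CS (b, p) w Cw).
Qed.

Lemma pr_network n (A : pred (rtree K)) :
  pr P [set w | A (G n w)] = iter n transition (fun h => (A h)%:R) g0.
Proof.
have rg0 : reachable g0 by [].
have := pr_network_iter n 0 A rg0; rewrite add0n.
rewrite (_ : [set w | G 0 w = g0] = setT); last by apply/seteqP; split.
by rewrite setTI prT mul1r.
Qed.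

(** A boolean test, because [pr_network] evaluates boolean predicates: the probability of
    well-formedness is then computed by iterating [transition]. *)
Definition wfb (g : rtree K) : bool :=
  all (fun v => if parent g v is Some p then p < v else true)%N (iota 0 (order g)).

Lemma wfP g : reflect (wf_tree g) (wfb g).
Proof.
apply: (iffP allP) => [H v p Hv|H v _].
  have := H v; rewrite mem_iota add0n leq0n (parent_lt_order Hv) => /(_ isT).
  by rewrite Hv.
by case E: (parent g v) => [p|] //; exact: H.
Qed.

Lemma network_wf_ae : {ae P, forall w, forall n, reachable (G n w)}.
Proof.
apply: ae_foralln => n.
have mW := measurable_network n wfb.
have W1 : pr P [set w | wfb (G n w)] = 1.
  have H m g : reachable g -> iter m transition (fun h => (wfb h)%:R) g = 1.
    elim: m g => [|m IH] g rg /=; first by case: rg => /wfP ->.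
    rewrite -[RHS](step_mean_cst 1 rg); apply: eq_step_mean => b p lt_p.
    by apply: IH; exact: reachable_attach.
  by rewrite pr_network H.
have mWC : measurable (~` [set w | wfb (G n w)]) by exact: measurableC.
have PW : P (~` [set w | wfb (G n w)]) = 0%E.
  by rewrite prE // -setTD prD // prT W1 subrr.
exists (~` [set w | wfb (G n w)]); split=> // w /= Hw Hwf; apply: Hw; split; first exact/wfP.
by rewrite order_network leq_addr.
Qed.

Lemma par_lt_order n w : reachable (G n.+1 w) -> (par n w < order (G n w))%N.
Proof. by move=> [/wf_attach[]]. Qed.

Lemma compensated_network f n w :
  compensated f (G n w) =
  \sum_(i < n) (f (G i w) (ty i w) (par i w) - step_mean f (G i w)).
Proof.
elim: n => [|n IH]; first by rewrite big_ord0 compensated_g0.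
rewrite big_ord_recr /= -IH compensated_attach //.
by rewrite order_network leq_addr.
Qed.

Theorem network_lln (f : rtree K -> 'I_K -> nat -> R) (C : R) :
  (forall g b p, reachable g -> (p < order g)%N -> `|f g b p| <= C) ->
  {ae P, forall w,
    n%:R^-1 * (\sum_(i < n) (f (G i w) (ty i w) (par i w) -
                step_mean f (G i w))) @[n --> \oo] --> 0}.
Proof.
move=> fC.
have rg0 : reachable g0 by [].
have C0 : 0 <= C.
  have lt0 : (0 < order g0)%N by [].
  have [b _] : exists b : 'I_K, true by exists g0.1.
  exact: le_trans (normr_ge0 _) (fC _ b _ rg0 lt0).
(* At time [n = (k + 1)^4] the second moment is at most [C^2 * n]; the square of the threshold
   [(k + 1)^3] exceeds [n] by the factor [(k + 1)^2], which makes the Chebyshev bounds summable. *)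
pose F k := [set w | k.+1%:R ^+ 3 < `|compensated f (G (k.+1 ^ 4)%N w)|].
have mF k : measurable (F k).
  exact: (measurable_network _ [set g | k.+1%:R ^+ 3 < `|compensated f g|]).
have bF k : pr P (F k) <= C ^+ 2 * (k.+1%:R ^+ 2)^-1.
  have k0 : 0 < k.+1%:R :> R by rewrite ltr0n.
  pose t : R := k.+1%:R ^+ 3.
  have t0 : 0 < t by rewrite exprn_gt0.
  have := pr_network (k.+1 ^ 4) [pred g | t < `|compensated f g|].
  rewrite -[pr _ _]/(pr P (F k)) => ->.
  apply: (@le_trans _ _ (iter (k.+1 ^ 4) transition
      (fun h => (t ^+ 2)^-1 * compensated f h ^+ 2) g0)).
    apply: iter_transition_le => // h rh /=.
    case: ltP => /= [lt_t|_]; last first.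
      by rewrite mulr_ge0 ?sqr_ge0 // invr_ge0 sqr_ge0.
    rewrite mulrC ler_pdivlMr ?exprn_gt0 // mul1r -[leRHS]real_normK ?num_real //.
    by rewrite lerXn2r ?nnegrE ?normr_ge0 ?(ltW t0) ?(ltW lt_t).
  rewrite iter_transition_scale // .
  apply: le_trans (ler_wpM2l _ (second_moment fC _ rg0)) _.
    by rewrite invr_ge0 sqr_ge0.
  rewrite compensated_g0 expr0n add0r -mulr_natr natrX /t le_eqVlt; apply/orP; left.
  by apply/eqP; field; rewrite gt_eqF.
have sumB n : \sum_(0 <= k < n) (C ^+ 2 * (k.+1%:R ^+ 2)^-1) <= C ^+ 2 * 2.
  by rewrite -mulr_sumr ler_wpM2l ?sqr_ge0 // sum_inv_square_le.
apply: filterS2 (borel_cantelli mF bF sumB) network_wf_ae => w [k0 Hk0] rG.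
apply: (bounded_increments_interpolation (C := C + C)).
- by rewrite addr_ge0.
- move=> n; rewrite big_ord_recr /= addrAC subrr add0r.
  apply: le_trans (ler_normB _ _) _; apply: lerD.
    by apply: fC => //; exact: par_lt_order.
  exact: step_mean_bound.
- exists k0.+1 => -[//|k]; rewrite ltnS => /Hk0 /= /negP.
  by rewrite -leNgt compensated_network.
Qed.

End Law.
End Transition.

(** * Logarithmic inequalities and the first-order condition at the minimizer *)

Lemma ln_le_sub1 (R : realType) (x : R) : 0 < x -> ln x <= x - 1.
Proof.
move=> x0; have := @le_ln1Dx R (x - 1).
by rewrite [1 + _]addrC subrK; apply; rewrite ltrBrDl subrr.
Qed.

Lemma ln_ge_1subV (R : realType) (x : R) : 0 < x -> 1 - x^-1 <= ln x.
Proof.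
move=> x0; have := @ln_le_sub1 R x^-1; rewrite invr_gt0 => /(_ x0).
by rewrite lnV ?posrE //; lra.
Qed.

Lemma ln1D_ge (R : realType) (u : R) : `|u| <= 2^-1 -> u - 2 * u ^+ 2 <= ln (1 + u).
Proof.
move=> /ler_normlP[]; rewrite lerNl => u1 u2.
have u0 : 0 < 1 + u by lra.
apply: le_trans (ln_ge_1subV u0).
rewrite -subr_ge0.
have -> : 1 - (1 + u)^-1 - (u - 2 * u ^+ 2) = u ^+ 2 * (1 + 2 * u) / (1 + u).
  by field; rewrite gt_eqF.
apply: divr_ge0; last exact: ltW.
by apply: mulr_ge0; [exact: sqr_ge0|lra].
Qed.

Lemma ln1D_ge_pos (R : realType) (u : R) : 0 <= u -> u - u ^+ 2 <= ln (1 + u).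
Proof.
move=> u1; have u0 : 0 < 1 + u by lra.
apply: le_trans (ln_ge_1subV u0).
rewrite -subr_ge0.
have -> : 1 - (1 + u)^-1 - (u - u ^+ 2) = u ^+ 3 / (1 + u).
  by field; rewrite gt_eqF.
by rewrite divr_ge0 ?exprn_ge0 ?(ltW u0).
Qed.

(** Apply [ln s <= s - 1] at [s = sqrt r]. This will turn a small relative entropy into an explicit
    bound on each ratio. *)
Lemma sqr_sqrt_sub1_le (R : realType) (r : R) : 0 < r ->
  (Num.sqrt r - 1) ^+ 2 <= r - 1 - ln r.
Proof.
move=> r0; have s0 : 0 < Num.sqrt r by rewrite sqrtr_gt0.
have rE : Num.sqrt r ^+ 2 = r by rewrite sqr_sqrtr // ltW.
have lnE : ln r = 2 * ln (Num.sqrt r).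
  by rewrite -{1}rE expr2 lnM ?posrE //; ring.
have := ln_le_sub1 s0; rewrite lnE -[X in _ <= X - 1 - _]rE.
by move: (Num.sqrt r) (ln _) => s l; lra.
Qed.

Lemma exists_pos_lower_bound (R : realType) (I : finType) (F : I -> R) :
  (forall i, 0 < F i) -> exists e : R, 0 < e /\ forall i, e <= F i.
Proof.
move=> F0; pose S : R := 1 + \sum_i (F i)^-1.
have S0 : 0 < S.
  by rewrite ltr_pwDl // sumr_ge0 // => i _; rewrite invr_ge0 ltW.
exists S^-1; rewrite invr_gt0; split=> // i.
rewrite -[leRHS]invrK lef_pV2 ?posrE ?invr_gt0 //.
rewrite /S (bigD1 i) //= addrCA lerDl addr_ge0 //.
by apply: sumr_ge0 => j _; rewrite invr_ge0 ltW.
Qed.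

(** Fermat's rule without derivatives: [ln (1 + u) >= u - 2 * u^2] turns the hypothesis into
    [e * A <= 2 * e^2 * B] for small [e] of either sign, and taking [e] proportional to [A] shows
    that [A] is zero. *)
Lemma log_stationarity (R : realType) (I : finType) (m v1 v2 : I -> R) (e0 : R) :
  0 < e0 -> (forall i, 0 <= m i) ->
  (forall e : R, `|e| <= e0 ->
     (forall i, `|e * v1 i| <= 2^-1 /\ `|e * v2 i| <= 2^-1) ->
     \sum_i m i * (ln (1 + e * v1 i) + ln (1 + e * v2 i)) <= 0) ->
  \sum_i m i * (v1 i + v2 i) = 0.
Proof.
move=> e00 m0 H; set A := \sum_i _.
(* One constant serves both smallness conditions: [|e| <= 1 / (2 * M)] gives [|e| <= e0] and keeps
   every increment below one half. *)
pose M : R := e0^-1 + \sum_i (`|v1 i| + `|v2 i|).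
pose B : R := \sum_i m i * (v1 i ^+ 2 + v2 i ^+ 2).
have M0 : 0 < M.
  by rewrite ltr_pwDl ?invr_gt0 // sumr_ge0 // => i _; rewrite addr_ge0.
have Mv i : `|v1 i| + `|v2 i| <= M.
  rewrite /M (bigD1 i) //= addrCA lerDl addr_ge0 ?invr_ge0 ?(ltW e00) //.
  by apply: sumr_ge0 => j _; rewrite addr_ge0.
have B0 : 0 <= B by apply: sumr_ge0 => i _; rewrite mulr_ge0 // addr_ge0 ?sqr_ge0.
have key (e : R) : `|e| <= (2 * M)^-1 -> e * A <= 2 * e ^+ 2 * B.
  move=> le_e.
  have sm i : `|e * v1 i| <= 2^-1 /\ `|e * v2 i| <= 2^-1.
    have h : `|e| * (`|v1 i| + `|v2 i|) <= 2^-1.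
      have p : 0 <= `|v1 i| + `|v2 i| by rewrite addr_ge0.
      apply: le_trans (ler_pM (normr_ge0 e) p le_e (Mv i)) _.
      by rewrite invfM mulfVK ?gt_eqF.
    by rewrite !normrM; split; apply: le_trans h;
      rewrite ler_wpM2l // ?lerDl ?lerDr.
  have le_e0 : `|e| <= e0.
    apply: le_trans le_e _; rewrite -[leRHS]invrK lef_pV2 ?posrE ?invr_gt0 ?mulr_gt0 //.
    have : e0^-1 <= M by rewrite lerDl sumr_ge0 // => i _; rewrite addr_ge0.
    lra.
  rewrite -subr_le0; apply: le_trans (H e le_e0 sm).
  rewrite !mulr_sumr -sumrB; apply: ler_sum => i _.
  have [s1 s2] := sm i.
  have := lerD (ln1D_ge s1) (ln1D_ge s2).
  move=> /(ler_wpM2l (m0 i)); apply: le_trans.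
  by rewrite le_eqVlt; apply/orP; left; apply/eqP; ring.
apply/eqP; apply: contraT => A0.
pose s := (2 * M * (1 + `|A|))^-1.
(* The bound [s] makes [t * A] an admissible [e]; the other one gives [2 * t * B < 1], against the
   inequality that [key] yields. *)
pose t := Num.min s (4 * (B + 1))^-1.
have pA : 0 < 1 + `|A| by rewrite ltr_pwDl.
have s0 : 0 < s by rewrite invr_gt0 !mulr_gt0.
have t0 : 0 < t by rewrite lt_min s0 invr_gt0 mulr_gt0 // ltr_wpDl.
have A2 : 0 < A ^+ 2 by rewrite lt_def sqrf_eq0 A0 sqr_ge0.
have /key : `|t * A| <= (2 * M)^-1.
  rewrite normrM gtr0_norm //; apply: (@le_trans _ _ (s * (1 + `|A|))).
    by apply: ler_pM; rewrite ?(ltW t0) // ?ge_min ?lexx // lerDr.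
  by rewrite /s invfM mulfVK ?gt_eqF.
have -> : t * A * A = t * A ^+ 2 by ring.
have -> : 2 * (t * A) ^+ 2 * B = (t * A ^+ 2) * (2 * t * B) by ring.
have y0 : 0 < t * A ^+ 2 by rewrite mulr_gt0.
rewrite ler_pMr // => h1.
have : t * (4 * (B + 1)) <= 1.
  by rewrite -ler_pdivlMr ?mulr_gt0 ?ltr_wpDl // div1r ge_min lexx orbT.
move=> h2; suff : (1 : R) < 1 by rewrite ltxx.
nra.
Qed.

Section Minimizer.
Context (R : realType) (K : nat).
Variables (mu : 'I_K -> R) (kappa : 'M[R]_K) (eta : 'I_K -> R).
Hypothesis mu_gt0 : forall x, 0 < mu x.
Hypothesis mu_sum1 : \sum_x mu x = 1.
Hypothesis kappa_gt0 : forall x y, 0 < kappa x y.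
Hypothesis eta_min : is_minimizer mu kappa eta.

Lemma eta_gt0 x : 0 < eta x.
Proof. by case: eta_min => -[]. Qed.

Lemma eta_sum1 : \sum_x eta x = 1.
Proof. by case: eta_min => -[]. Qed.

Definition weight (y : 'I_K -> R) (b : 'I_K) : R := \sum_l kappa l b * y l.

Lemma weight_gt0 y b : (forall x, 0 <= y x) -> (exists x, 0 < y x) ->
  0 < weight y b.
Proof.
move=> y0 [x yx]; rewrite /weight (bigD1 x) //= ltr_pwDl ?mulr_gt0 //.
by apply: sumr_ge0 => i _; rewrite mulr_ge0 // ltW.
Qed.

Lemma weight_eta_gt0 b : 0 < weight eta b.
Proof.
by apply: weight_gt0 => [x|]; [exact/ltW/eta_gt0|exists b; exact: eta_gt0].
Qed.

Lemma nu_gt0 b : 0 < nu mu kappa eta b.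
Proof. by rewrite divr_gt0 // -/(weight eta b) weight_eta_gt0. Qed.

Lemma phi_gt0 x b : 0 < phi mu kappa eta x b.
Proof. by rewrite mulr_gt0 // nu_gt0. Qed.

(** Minus twice the partial derivative of [Vpot] at [eta] in the coordinate [x]. *)
Let grad x := mu x / eta x + \sum_b phi mu kappa eta x b.

(** Moving a small mass from type [j] to type [i] stays in the open simplex, so [Vpot] is stationary
    in the direction [dl]; its derivative there is [grad i - grad j] up to a factor. *)
Lemma grad_eq i j : grad i = grad j.
Proof.
have [->//|ij] := eqVneq i j.
pose dl k : R := (k == i)%:R - (k == j)%:R.
pose v1 k := dl k / eta k.
pose v2 k := weight dl k / weight eta k.
have dl_sum : \sum_k dl k = 0.
  have one k0 : \sum_(k < K) (k == k0)%:R = 1 :> R.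
    by rewrite (bigD1 k0) //= eqxx big1 ?addr0 // => k /negbTE ->.
  by rewrite sumrB !one subrr.
have H : \sum_k mu k * (v1 k + v2 k) = 0.
  apply: (@log_stationarity _ _ _ _ _ 1) => // [k|e _ sm]; first exact: ltW.
  pose y k := eta k * (1 + e * v1 k).
  have pos k : 0 < 1 + e * v1 k /\ 0 < 1 + e * v2 k.
    by have [/ler_normlP[+ _] /ler_normlP[+ _]] := sm k; lra.
  have yE k : y k = eta k + e * dl k.
    by rewrite /y /v1; field; rewrite gt_eqF // eta_gt0.
  have ys : open_simplex y.
    split=> [k|]; first by rewrite mulr_gt0 ?eta_gt0 //; case: (pos k).
    under eq_bigr do rewrite yE.
    by rewrite big_split /= eta_sum1 -mulr_sumr dl_sum mulr0 addr0.
  have wy k : \sum_l y l * kappa l k = weight eta k * (1 + e * v2 k).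
    rewrite /v2 mulrDr mulr1 mulrCA [X in _ + _ * X]mulrC divfK; last first.
      by rewrite gt_eqF // weight_eta_gt0.
    rewrite /weight mulr_sumr -big_split /=; apply: eq_bigr => l _.
    by rewrite yE; ring.
  have we k : \sum_l eta l * kappa l k = weight eta k.
    by apply: eq_bigr => l _; rewrite mulrC.
  have := (proj2 eta_min) y ys; rewrite /Vpot lerD2l lerN2 ler_pM2l ?invr_gt0 //.
  rewrite -subr_le0 -sumrB; apply: le_trans; rewrite le_eqVlt; apply/orP; left.
  apply/eqP/eq_bigr => k _; rewrite wy we.
  have [p1 p2] := pos k.
  by rewrite !lnM ?posrE ?eta_gt0 ?weight_eta_gt0 //; ring.
apply/eqP; rewrite -subr_eq0 -H; apply/eqP.
have Hd (F : 'I_K -> R) : \sum_k dl k * F k = F i - F j.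
  rewrite /dl; under eq_bigr do rewrite mulrBl.
  rewrite sumrB; congr (_ - _).
    by rewrite (bigD1 i) //= eqxx mul1r big1 ?addr0 // => k /negbTE ->; rewrite mul0r.
  by rewrite (bigD1 j) //= eqxx mul1r big1 ?addr0 // => k /negbTE ->; rewrite mul0r.
rewrite -Hd; under [RHS]eq_bigr do rewrite mulrDr.
rewrite big_split /= /grad; under eq_bigr do rewrite mulrDr.
rewrite big_split /=; congr (_ + _).
  by apply: eq_bigr => k _; rewrite /v1; ring.
under eq_bigr do rewrite mulr_sumr.
rewrite exchange_big /=; apply: eq_bigr => b _.
rewrite /v2 /weight mulr_suml mulr_sumr; apply: eq_bigr => k _.
by rewrite /phi /nu; ring.
Qed.

(** The common value of the gradient, a Lagrange multiplier, is found by averaging against [eta]: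
    each of the two terms then contributes the total mass 1 of [mu]. *)
Lemma minimizer_stationary x : mu x / eta x + \sum_b phi mu kappa eta x b = 2.
Proof.
rewrite -/(grad x); transitivity ((\sum_k eta k) * grad x).
  by rewrite eta_sum1 mul1r.
rewrite mulr_suml; under eq_bigr => k _ do rewrite (grad_eq x k) mulrDr.
rewrite big_split /= (_ : 2 = 1 + 1); last by ring.
congr (_ + _).
  rewrite -mu_sum1; apply: eq_bigr => k _.
  by rewrite mulrC divfK // gt_eqF // eta_gt0.
under eq_bigr do rewrite mulr_sumr.
rewrite exchange_big /= -mu_sum1; apply: eq_bigr => b _.
rewrite /phi /nu -/(weight eta b).
rewrite (eq_bigr (fun k => mu b / weight eta b * (kappa k b * eta k))); last first.
  by move=> k _; ring.
by rewrite -mulr_sumr -/(weight eta b) divfK // gt_eqF // weight_eta_gt0.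
Qed.

End Minimizer.

(** * Convergence of the type degrees *)

Section StochasticApproximation.
Context (R : realType) (K : nat).
Variables (mu : 'I_K -> R) (kappa : 'M[R]_K) (eta : 'I_K -> R).
Hypothesis mu_gt0 : forall x, 0 < mu x.
Hypothesis mu_sum1 : \sum_x mu x = 1.
Hypothesis kappa_gt0 : forall x y, 0 < kappa x y.
Hypothesis eta_min : is_minimizer mu kappa eta.
Variable g0 : rtree K.
Hypothesis g0_wf : wf_tree g0.

Definition type_degree (g : rtree K) (x : 'I_K) : R :=
  \sum_(v < order g) (vtype g v == x)%:R * (degree g0 g v)%:R.

Definition total_degree (g : rtree K) : R := \sum_x type_degree g x.

Lemma type_degree_ge0 g x : 0 <= type_degree g x.
Proof. by apply: sumr_ge0 => v _; rewrite mulr_ge0. Qed.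

Lemma sum_by_type g (F : 'I_K -> R) :
  \sum_(v < order g) F (vtype g v) * (degree g0 g v)%:R =
  \sum_x F x * type_degree g x.
Proof.
under [RHS]eq_bigr do rewrite mulr_sumr.
rewrite exchange_big /=; apply: eq_bigr => v _.
rewrite (bigD1 (vtype g v)) //= eqxx mul1r big1 ?addr0 // => x.
by rewrite eq_sym => /negbTE ->; rewrite mul0r mulr0.
Qed.

Lemma attach_mass_weight g b :
  attach_mass kappa g0 g b = weight kappa (type_degree g) b.
Proof. by rewrite /attach_mass (sum_by_type g (fun x => kappa x b)). Qed.

Lemma type_degree_attach g b p x : wf_tree g -> (p < order g)%N ->
  type_degree (attach g b p) x =
  type_degree g x + (vtype g p == x)%:R + (b == x)%:R.
Proof.
move=> wg lt_p; rewrite /type_degree order_attach big_ord_recr /=.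
rewrite vtype_attach_new degreeE nchildren_attach (nchildren_ge wg) // ltn_eqF //=.
rewrite mulr1; congr (_ + _).
rewrite (eq_bigr (fun v : 'I_(order g) =>
   (vtype g v == x)%:R * (degree g0 g v)%:R + (vtype g v == x)%:R * (p == v)%:R)).
  rewrite big_split /=; congr (_ + _).
  rewrite (bigD1 (Ordinal lt_p)) //= eqxx mulr1 big1 ?addr0 // => v.
  by rewrite -val_eqE /= eq_sym => /negbTE ->; rewrite mulr0.
move=> v _; rewrite vtype_attach_lt // -mulrDr -natrD !degreeE nchildren_attach.
by congr (_ * _%:R); lia.
Qed.

Lemma total_degree_attach g b p : wf_tree g -> (p < order g)%N ->
  total_degree (attach g b p) = total_degree g + 2.
Proof.
move=> wg lt_p; rewrite /total_degree.
under eq_bigr do rewrite type_degree_attach //.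
rewrite !big_split /= -addrA; congr (_ + _).
have one (k0 : 'I_K) : \sum_(k < K) (k0 == k)%:R = 1 :> R.
  by rewrite (bigD1 k0) //= eqxx big1 ?addr0 // => k; rewrite eq_sym => /negbTE ->.
by rewrite !one.
Qed.

Definition type_increment (g : rtree K) (b : 'I_K) (p : nat) (x : 'I_K) : R :=
  (vtype g p == x)%:R + (b == x)%:R.

Lemma type_increment_bound g b p x : 0 <= type_increment g b p x <= 2.
Proof. by rewrite /type_increment; do 2!case: (_ == x); rewrite /=; lra. Qed.

Lemma step_mean_type_increment g x : reachable g0 g ->
  step_mean mu kappa g0 (fun g b p => type_increment g b p x) g =
  mu x + \sum_b mu b * (kappa x b * type_degree g x) / weight kappa (type_degree g) b.
Proof.
move=> rg; rewrite /step_mean /type_increment.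
under eq_bigr do (under eq_bigr do rewrite mulrDr; rewrite big_split /=).
rewrite big_split /= addrC; congr (_ + _).
  under eq_bigr do rewrite -mulr_suml step_prob_sum_parent //.
  rewrite (bigD1 x) //= eqxx mulr1 big1 ?addr0 // => b /negbTE ->.
  by rewrite mulr0.
apply: eq_bigr => b _; rewrite /step_prob /attach_prob.
set W := weight _ _ b; rewrite /type_degree !mulr_sumr mulr_suml.
apply: eq_bigr => v _.
rewrite -[\sum_(u < order g) _]/(attach_mass kappa g0 g b) attach_mass_weight -/W.
by have [->|_] := eqVneq (vtype g v) x; rewrite /= ?mulr1 ?mul1r ?mulr0 ?mul0r;
  ring.
Qed.

Section Drift.
Variable g : rtree K.
Hypothesis rg : reachable g0 g.
Hypothesis Yg : forall x, 0 < type_degree g x.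

Let tot := total_degree g.
Let r x : R := type_degree g x / tot / eta x.

(** A relative entropy with its logarithms split, so that an arrival can be followed separately in
    the total degree and in each type degree. *)
Definition lyapunov (h : rtree K) : R :=
  \sum_x eta x * (ln (total_degree h) + ln (eta x) - ln (type_degree h x)).

Lemma total_degree_gt0 : 0 < tot.
Proof.
rewrite /tot /total_degree (bigD1 g.1) //= ltr_pwDl // sumr_ge0 // => x _.
exact: type_degree_ge0.
Qed.

Lemma eta_ratio_sum1 : \sum_x eta x * r x = 1.
Proof.
rewrite (eq_bigr (fun x => type_degree g x / tot)); last first.
  move=> x _; rewrite /r mulrC divfK // gt_eqF //.
  exact: eta_gt0 eta_min _.
by rewrite -mulr_suml divff // gt_eqF // total_degree_gt0.
Qed.

Lemma ratio_gt0 x : 0 < r x.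
Proof.
by rewrite !divr_gt0 // ?total_degree_gt0 // (eta_gt0 eta_min).
Qed.

Lemma lyapunov_ratio : lyapunov g = \sum_x eta x * (r x - 1 - ln (r x)).
Proof.
rewrite (eq_bigr (fun x => eta x * r x - eta x - eta x * ln (r x))); last first.
  by move=> x _; ring.
rewrite !sumrB eta_ratio_sum1 (eta_sum1 eta_min) subrr sub0r -sumrN.
apply: eq_bigr => x _; have e0 := eta_gt0 eta_min x.
have t0 := total_degree_gt0.
rewrite /r !ln_div ?posrE ?divr_gt0 // -/tot; ring.
Qed.

Lemma lyapunov_ge x : eta x * (Num.sqrt (r x) - 1) ^+ 2 <= lyapunov g.
Proof.
rewrite lyapunov_ratio (bigD1 x) //=.
apply: (@le_trans _ _ (eta x * (r x - 1 - ln (r x)))).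
  by rewrite ler_wpM2l ?sqr_sqrt_sub1_le ?ratio_gt0 // ltW // (eta_gt0 eta_min).
rewrite lerDl sumr_ge0 // => y _; rewrite mulr_ge0 ?(ltW (eta_gt0 eta_min _)) //.
by have := ln_le_sub1 (ratio_gt0 y); lra.
Qed.

Lemma lyapunov_ge0 : 0 <= lyapunov g.
Proof.
apply: le_trans (lyapunov_ge g.1).
by rewrite mulr_ge0 ?sqr_ge0 // ltW // (eta_gt0 eta_min).
Qed.

(* With [r] and [s] the ratios of the current type degrees and weights to their
   values at the minimizer, stationarity gives [\sum mu r + \sum mu s = 2], and
   [1 / z >= 2 - z] bounds the drift below by [\sum mu (1 - r)^2 / r], which
   dominates the relative entropy. *)
Lemma drift_lower_bound (c0 : R) : 0 <= c0 -> (forall x, c0 * eta x <= mu x) ->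
  (2 + c0 * lyapunov g) / tot <=
  \sum_x eta x * (step_mean mu kappa g0 (fun g b p => type_increment g b p x) g /
                  type_degree g x).
Proof.
move=> c00 Hc; have t0 := total_degree_gt0.
have e0 := eta_gt0 eta_min.
have we := weight_eta_gt0 kappa_gt0 eta_min.
have wy b : 0 < weight kappa (type_degree g) b.
  apply: weight_gt0 => // [x|]; first exact: ltW.
  by exists b.
pose s b := weight kappa (type_degree g) b / tot / weight kappa eta b.
have s0 b : 0 < s b by rewrite !divr_gt0.
have r0 := ratio_gt0.
have E : \sum_x eta x * (step_mean mu kappa g0
      (fun g b p => type_increment g b p x) g / type_degree g x) =
    (\sum_x mu x / r x + \sum_b mu b / s b) / tot.
  under eq_bigr do rewrite step_mean_type_increment // mulrDl mulrDr.
  rewrite big_split mulrDl /=; congr (_ + _).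
    rewrite mulr_suml; apply: eq_bigr => x _; rewrite /r.
    by field; rewrite !gt_eqF.
  under eq_bigr do rewrite mulr_suml mulr_sumr.
  rewrite exchange_big mulr_suml /=; apply: eq_bigr => b _.
  rewrite /s (eq_bigr (fun x => (mu b / weight kappa (type_degree g) b) *
     (kappa x b * eta x))); last first.
    by move=> x _; field; rewrite !gt_eqF.
  rewrite -mulr_sumr -/(weight kappa eta b).
  by field; rewrite !gt_eqF.
rewrite E ler_pM2r ?invr_gt0 //.
have two : \sum_x mu x * r x + \sum_b mu b * s b = 2.
  transitivity (2 * \sum_x eta x * r x); last by rewrite eta_ratio_sum1 mulr1.
  rewrite mulr_sumr.
  rewrite (eq_bigr (fun x => mu x / eta x * (eta x * r x) )
     (F1 := fun x => mu x * r x)); last first.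
    by move=> x _; field; rewrite gt_eqF.
  rewrite (eq_bigr (fun x => mu x / eta x * (eta x * r x) +
    \sum_b phi mu kappa eta x b * (eta x * r x)) (F1 := fun x => 2 * (eta x * r x))); last first.
    move=> x _; rewrite -(minimizer_stationary mu_gt0 mu_sum1 kappa_gt0 eta_min x).
    by rewrite mulrDl mulr_suml.
  rewrite big_split /=; congr (_ + _); rewrite exchange_big /=.
  apply: eq_bigr => b _.
  rewrite (eq_bigr (fun x => mu b / weight kappa eta b / tot *
     (kappa x b * type_degree g x))); last first.
    move=> x _; rewrite /phi /nu -/(weight kappa eta b) /r.
    by field; rewrite !gt_eqF.
  by rewrite -mulr_sumr -/(weight kappa _ b) /s; field; rewrite !gt_eqF.
have invE (z : R) : 0 < z -> z^-1 = 2 - z + (1 - z) ^+ 2 / z.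
  by move=> z0; field; rewrite gt_eqF.
have S1 : \sum_x mu x * (2 - r x) + c0 * lyapunov g <= \sum_x mu x / r x.
  rewrite lyapunov_ratio mulr_sumr -big_split /=; apply: ler_sum => x _.
  rewrite [in leRHS]invE // [leRHS]mulrDr lerD2l mulrA.
  have l0 : 0 <= r x - 1 - ln (r x) by have := ln_le_sub1 (r0 x); lra.
  apply: ler_pM => //; first by rewrite mulr_ge0 // ltW.
  (* [(1 - r)^2 / r] exceeds [r - 1 - ln r] by exactly [ln r - (1 - 1 / r)]. *)
  have := ln_ge_1subV (r0 x).
  have -> : (1 - r x) ^+ 2 / r x = (r x)^-1 - 2 + r x.
    by field; rewrite gt_eqF.
  by lra.
have S2 : \sum_b mu b * (2 - s b) <= \sum_b mu b / s b.
  apply: ler_sum => b _; rewrite ler_wpM2l ?(ltW (mu_gt0 b)) //.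
  by rewrite [leRHS]invE // lerDl divr_ge0 ?sqr_ge0 // ltW.
apply: le_trans (lerD S1 S2).
have D (t : 'I_K -> R) : \sum_x mu x * (2 - t x) = 2 - \sum_x mu x * t x.
  rewrite (eq_bigr (fun x => mu x * 2 - mu x * t x)); last by move=> x _; ring.
  by rewrite sumrB -mulr_suml mu_sum1 mul1r.
rewrite !D; move: two; move: (\sum_x mu x * r x) (\sum_b mu b * s b) (c0 * _).
by move=> u1 u2 u3; lra.
Qed.

(** The inequality [ln (1 + u) >= u - u^2], used for the type degrees, is what costs a second-order
    error; each [u] is at most [2 / m], whence [4 / m^2]. The total degree grows by exactly 2,
    whence [2 / tot]. *)
Lemma lyapunov_step b p (m : R) : (p < order g)%N -> 0 < m ->
  (forall x, m <= type_degree g x) ->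
  lyapunov (attach g b p) <=
  lyapunov g + 2 / tot -
  \sum_x eta x * (type_increment g b p x / type_degree g x) + 4 / m ^+ 2.
Proof.
move=> lt_p m0 mY; have t0 := total_degree_gt0.
have e0 := eta_gt0 eta_min; have [wg _] := rg.
have -> : 4 / m ^+ 2 = \sum_x eta x * (4 / m ^+ 2).
  by rewrite -mulr_suml (eta_sum1 eta_min) mul1r.
have {1}-> : 2 / tot = \sum_x eta x * (2 / tot).
  by rewrite -mulr_suml (eta_sum1 eta_min) mul1r.
rewrite /lyapunov -big_split -sumrB -big_split /=; apply: ler_sum => x _.
rewrite -!mulrDr -mulrBr -mulrDr ler_wpM2l ?(ltW (e0 x)) //.
rewrite total_degree_attach // type_degree_attach //.
rewrite -[_ + _ + (b == x)%:R]addrA -/(type_increment g b p x) -/tot.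
have /andP[i0 i2] := type_increment_bound g b p x.
move: (type_increment g b p x) i0 i2 => i i0 i2.
have Y0 := Yg x.
have -> : ln (tot + 2) = ln tot + ln (1 + 2 / tot).
  rewrite -lnM ?posrE ?ltr_pwDl ?divr_ge0 ?(ltW t0) //.
  by congr ln; field; rewrite gt_eqF.
have -> : ln (type_degree g x + i) = ln (type_degree g x) + ln (1 + i / type_degree g x).
  rewrite -lnM ?posrE ?ltr_pwDl ?divr_ge0 ?(ltW Y0) //.
  by congr ln; field; rewrite gt_eqF.
have l1 : ln (1 + 2 / tot) <= 2 / tot.
  by apply: le_ln1Dx; rewrite (lt_le_trans (ltrN10 _)) // divr_ge0 // ltW.
have l2 := @ln1D_ge_pos R (i / type_degree g x).
have l3 : (i / type_degree g x) ^+ 2 <= 4 / m ^+ 2.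
  rewrite expr_div_n; apply: ler_pM; rewrite ?invr_ge0 ?sqr_ge0 //.
    by rewrite expr2; nra.
  by rewrite lef_pV2 ?posrE ?exprn_gt0 // lerXn2r ?nnegrE ?(ltW m0) ?(ltW Y0).
have {}l2 := l2 (divr_ge0 i0 (ltW Y0)).
move: l1 l2 l3; set u := i / _; set a := ln (1 + u); set q := u ^+ 2.
set a' := ln (1 + _); set c' := 2 / tot; set e' := 4 / _.
by lra.
Qed.

End Drift.

Section Convergence.
Context d (T : measurableType d) (P : probability T R).
Variables (ty : nat -> T -> 'I_K) (par : nat -> T -> nat).
Hypothesis G_network : is_network mu kappa P g0 ty par.
Let G := network g0 ty par.

Let lln := network_lln mu_gt0 mu_sum1 kappa_gt0 g0_wf G_network.
Let wf_ae := network_wf_ae mu_sum1 kappa_gt0 g0_wf G_network.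

Lemma step_mean_type x g : reachable g0 g ->
  step_mean mu kappa g0 (fun _ b _ => (b == x)%:R) g = mu x.
Proof.
move=> rg; rewrite /step_mean.
under eq_bigr do rewrite -mulr_suml step_prob_sum_parent //.
rewrite (bigD1 x) //= eqxx mulr1 big1 ?addr0 // => b /negbTE ->.
by rewrite mulr0.
Qed.

Lemma type_frequency_ae :
  {ae P, forall w, forall x,
     n%:R^-1 * (\sum_(i < n) (ty i w == x)%:R) @[n --> \oo] --> mu x}.
Proof.
have H x : {ae P, forall w,
     n%:R^-1 * (\sum_(i < n) (ty i w == x)%:R) @[n --> \oo] --> mu x}.
  have L := @lln (fun _ b _ => (b == x)%:R) 1.
  have {}L := L (fun g b p _ _ => ltac:(by case: (b == x); rewrite ?normr1 ?normr0)).
  apply: filterS2 L wf_ae => w Lw rG.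
  apply/cvgn_epsP => e e0; have [N HN] := (cvgn_epsP _ _).1 Lw e e0.
  exists (maxn 1 N) => n; rewrite geq_max => /andP[n1 nN].
  have := HN n nN; rewrite subr0 sumrB.
  under [X in _ - X]eq_bigr do rewrite step_mean_type //.
  rewrite sumr_const card_ord mulrBr -[mu x *+ n]mulr_natl mulrA.
  by rewrite mulVf ?mul1r // pnatr_eq0 -lt0n.
have F (s : seq 'I_K) : {ae P, forall w, forall x, x \in s ->
     n%:R^-1 * (\sum_(i < n) (ty i w == x)%:R) @[n --> \oo] --> mu x}.
  elim: s => [|y s IH]; first by apply: aeW.
  apply: filterS2 (H y) IH => w Hy Hs x.
  by rewrite inE => /predU1P[->|/Hs].
by apply: filterS (F (enum 'I_K)) => w Hw x; apply: Hw; rewrite mem_enum.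
Qed.

Lemma type_degree_network_ge n w x : (forall n, reachable g0 (G n w)) ->
  \sum_(i < n) (ty i w == x)%:R <= type_degree (G n w) x.
Proof.
move=> rG; elim: n => [|n IH]; first by rewrite big_ord0 type_degree_ge0.
rewrite big_ord_recr /= type_degree_attach.
- by rewrite lerD // (le_trans IH) // lerDl.
- by case: (rG n).
- exact: par_lt_order (rG n.+1).
Qed.

Lemma total_degree_network n w : (forall n, reachable g0 (G n w)) ->
  total_degree (G n w) = total_degree g0 + 2 * n%:R.
Proof.
move=> rG; elim: n => [|n IH]; first by rewrite mulr0 addr0.
rewrite /= total_degree_attach.
- by rewrite IH -natr1; ring.
- by case: (rG n).
- exact: par_lt_order (rG n.+1).
Qed.

(** The increments of the entropy involve inverse type degrees, which are uncontrolled while a type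
    is rare. The noise is therefore cut off outside the trees where every type has a positive share;
    the frequencies of the arriving types, to which the law of large numbers applies first, show
    that the network eventually stays among these trees. *)
Theorem type_degree_cvg_ae :
  {ae P, forall w, forall x,
     n%:R^-1 * type_degree (G n w) x @[n --> \oo] --> 2 * eta x}.
Proof.
have [e1 [e10 He1]] := exists_pos_lower_bound mu_gt0.
(* Two factors of 2 are lost: the type frequency is only eventually above half its limit, and [n.+1]
   is bounded by [2 * n]. *)
pose ep := e1 / 4.
have ep0 : 0 < ep by rewrite divr_gt0.
(* Equals [n.+1] at time [n], but is defined from the tree alone, as [network_lln] requires of
   [f]. *)
pose age (g : rtree K) : R := (order g - order g0).+1%:R.
pose good g := [forall x, ep * age g <= type_degree g x].
pose lin g b p : R := \sum_x eta x * (type_increment g b p x / type_degree g x).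
pose f g b p : R := if good g then age g * lin g b p else 0.
have e0 := eta_gt0 eta_min.
have fC g b p : reachable g0 g -> (p < order g)%N -> `|f g b p| <= 2 / ep.
  move=> rg lt_p; rewrite /f; case: ifP => [/forallP good_g|_]; last first.
    by rewrite normr0 divr_ge0 // ltW.
  have a0 : 0 < age g by rewrite ltr0n.
  have Yp x : 0 < type_degree g x.
    by apply: lt_le_trans (good_g x); rewrite mulr_gt0.
  rewrite ger0_norm; last first.
    rewrite mulr_ge0 ?(ltW a0) // sumr_ge0 // => x _.
    have /andP[i0 _] := type_increment_bound g b p x.
    by rewrite mulr_ge0 ?divr_ge0 ?(ltW (e0 x)) ?(ltW (Yp x)).
  have -> : 2 / ep = \sum_x eta x * (2 / ep).
    by rewrite -mulr_suml (eta_sum1 eta_min) mul1r.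
  rewrite mulr_sumr; apply: ler_sum => x _; rewrite mulrCA ler_wpM2l ?(ltW (e0 x)) //.
  have /andP[i0 i2] := type_increment_bound g b p x.
  have h : age g <= ep^-1 * type_degree g x by rewrite ler_pdivlMl.
  rewrite mulrA ler_pdivrMr //; apply: (@le_trans _ _ (age g * 2)).
    by rewrite ler_wpM2l // ltW.
  by rewrite mulrC -mulrA ler_wpM2l.
have lln_f := lln fC.
pose t0 := total_degree g0 : R.
have t00 : 0 <= t0 by apply: sumr_ge0 => x _; exact: type_degree_ge0.
have [c0 [c00 Hc0]] : exists c0 : R, 0 < c0 /\ forall x, c0 * eta x <= mu x.
  have [c0 [c00 Hc0]] := exists_pos_lower_bound (F := fun x => mu x / eta x)
    (fun x => divr_gt0 (mu_gt0 x) (e0 x)).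
  by exists c0; split=> // x; rewrite -ler_pdivlMr.
(* Chosen so that [c / n.+1 <= c0 / (t0 + 2 * n)], the total degree at time [n] being
   [t0 + 2 * n]. *)
pose c := c0 / (t0 + 2).
have c_gt0 : 0 < c by rewrite divr_gt0 // ltr_wpDl.
near=> w => /=.
have rG : forall n, reachable g0 (G n w) by near: w.
have fq : forall x, n%:R^-1 * (\sum_(i < n) (ty i w == x)%:R) @[n --> \oo] --> mu x.
  by near: w; exact: type_frequency_ae.
have Lw : n%:R^-1 * (\sum_(i < n) (f (G i w) (ty i w) (par i w) -
     step_mean mu kappa g0 f (G i w))) @[n --> \oo] --> 0 by near: w.
have ageG n : age (G n w) = n.+1%:R.
  by rewrite /age order_network addKn.
have [N1 HN1] : exists N1, forall n, (N1 <= n)%N -> good (G n w).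
  have H x : exists N, forall n, (N <= n)%N ->
      ep * n.+1%:R <= type_degree (G n w) x.
    have [|N HN] := (cvgn_epsP _ _).1 (fq x) (e1 / 2); first by rewrite divr_gt0.
    exists (maxn 1 N) => n; rewrite geq_max => /andP[n1 /HN].
    have n0 : 0 < n%:R :> R by rewrite ltr0n.
    move=> /ler_normlP[+ _]; rewrite opprB lerBlDr -lerBlDl => Hn.
    apply: le_trans (type_degree_network_ge _ _ rG).
    have : mu x / 2 <= n%:R^-1 * \sum_(i < n) (ty i w == x)%:R.
      by apply: le_trans Hn; have := He1 x; lra.
    rewrite ler_pdivlMl // => Hm; apply: le_trans Hm.
    have n2 : n.+1%:R <= 2 * n%:R :> R by rewrite -natrM ler_nat; lia.
    apply: le_trans (ler_wpM2l (ltW ep0) n2) _.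
    have h := ler_wpM2r (ltW n0) (He1 x).
    by rewrite /ep; lra.
  have F (s : seq 'I_K) : exists N, forall n, (N <= n)%N -> forall x, x \in s ->
      ep * n.+1%:R <= type_degree (G n w) x.
    elim: s => [|y s [N HN]]; first by exists 0%N.
    have [N' HN'] := H y; exists (maxn N N') => n; rewrite geq_max => /andP[h h'] x.
    by rewrite inE => /predU1P[->|]; [exact: HN'|exact: HN].
  have [N HN] := F (enum 'I_K); exists N => n /HN h; apply/forallP => x.
  by rewrite ageG h // mem_enum.
have Yp n x : (N1 <= n)%N -> 0 < type_degree (G n w) x.
  by move=> /HN1/forallP/(_ x); apply: lt_le_trans; rewrite mulr_gt0 // ltr0n.
pose L n := lyapunov (G n w).
(* The growth [2 / tot] of the logarithm of the total degree cancels against the 2 in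
   [drift_lower_bound]; what is left is a contraction, centred noise and an error of order
   [1 / n^2]. *)
have recur n : (N1 <= n)%N -> L n.+1 <= L n * (1 - c / n.+1%:R) +
    (- (f (G n w) (ty n w) (par n w) - step_mean mu kappa g0 f (G n w)) +
     4 / ep ^+ 2 / n.+1%:R) / n.+1%:R.
  move=> le_n; have n0 : 0 < n.+1%:R :> R by rewrite ltr0n.
  have gn := HN1 n le_n; have Yn x := Yp n x le_n.
  have lt_p := par_lt_order (rG n.+1).
  have m0 : 0 < ep * n.+1%:R by rewrite mulr_gt0.
  have mY x : ep * n.+1%:R <= type_degree (G n w) x.
    by move/forallP: gn => /(_ x); rewrite ageG.
  have := lyapunov_step (rG n) Yn (ty n w) lt_p m0 mY.
  rewrite -[attach _ _ _]/(G n.+1 w) -/(L n.+1) -/(L n) -/(lin _ _ _).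
  have := drift_lower_bound (rG n) Yn (ltW c00) Hc0.
  rewrite -/(L n) total_degree_network // -/t0.
  have -> : \sum_x eta x * (step_mean mu kappa g0
      (fun g b p => type_increment g b p x) (G n w) / type_degree (G n w) x) =
      step_mean mu kappa g0 lin (G n w).
    rewrite /step_mean /lin.
    under eq_bigr do rewrite mulr_suml mulr_sumr.
    rewrite exchange_big /=; apply: eq_bigr => b _.
    under eq_bigr do rewrite mulr_suml mulr_sumr.
    rewrite exchange_big /=; apply: eq_bigr => p _.
    by rewrite mulr_sumr; apply: eq_bigr => x _; ring.
  have fE b p : f (G n w) b p = n.+1%:R * lin (G n w) b p.
    by rewrite /f gn ageG.
  have -> : step_mean mu kappa g0 f (G n w) =
      n.+1%:R * step_mean mu kappa g0 lin (G n w).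
    rewrite /step_mean mulr_sumr; apply: eq_bigr => b _.
    by rewrite mulr_sumr; apply: eq_bigr => p _; rewrite fE; ring.
  rewrite fE; move: (lin _ _ _) (step_mean _ _ _ _ _) => l1 l2 h1 h2.
  have L0 : 0 <= L n by exact: lyapunov_ge0.
  have tn : 0 < t0 + 2 * n%:R.
    by have := total_degree_gt0 Yn; rewrite total_degree_network.
  have h3 : c / n.+1%:R <= c0 / (t0 + 2 * n%:R).
    rewrite /c -mulrA -invfM ler_wpM2l ?(ltW c00) //.
    have p2 : 0 < t0 + 2 by rewrite ltr_wpDl.
    rewrite lef_pV2 ?posrE ?mulr_gt0 // -natr1.
    have : 0 <= t0 * n%:R by rewrite mulr_ge0.
    by lra.
  have h4 := ler_wpM2l L0 h3.
  rewrite mulrDl in h1.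
  have -> : L n * (1 - c / n.+1%:R) + (- (n.+1%:R * l1 - n.+1%:R * l2) +
     4 / ep ^+ 2 / n.+1%:R) / n.+1%:R =
     L n - L n * (c / n.+1%:R) - l1 + l2 + 4 / (ep * n.+1%:R) ^+ 2.
    by field; rewrite !gt_eqF.
  move: h1 h2 h4; set z := _ / (ep * _) ^+ 2; set z1 := 2 / _.
  set z2 := L n * (c / _); set z3 := L n * (c0 / _).
  have -> : c0 * L n / (t0 + 2 * n%:R) = z3 by rewrite /z3; ring.
  by lra.
have vanish : 4 / ep ^+ 2 / n.+1%:R @[n --> \oo] --> 0.
  rewrite -[X in _ --> X](mulr0 (4 / ep ^+ 2)); apply: cvgM; first exact: cvg_cst.
  exact: cvg_harmonic.
have LwN : n%:R^-1 * (\sum_(i < n) - (f (G i w) (ty i w) (par i w) -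
     step_mean mu kappa g0 f (G i w))) @[n --> \oo] --> 0.
  apply: (@eq_cvgn _ (fun n => - (n%:R^-1 * (\sum_(i < n)
    (f (G i w) (ty i w) (par i w) - step_mean mu kappa g0 f (G i w)))))) => [n|].
    by rewrite sumrN mulrN.
  by rewrite -[X in _ --> X]oppr0; exact: cvgN.
have Lsmall := cesaro_contraction_limsup_le0 c_gt0 recur LwN vanish.
move=> x.
have ratio1 : type_degree (G n w) x / total_degree (G n w) / eta x @[n --> \oo] --> (1 : R).
  apply/cvgn_epsP => e e_gt0.
  (* From [|sqrt r - 1| <= th <= 1] follows [|r - 1| <= th * (2 + th) <= 3 * th <= e]. *)
  pose th := Num.min 1 (e / 3).
  have th0 : 0 < th by rewrite lt_min ltr01 divr_gt0.
  have [|N HN] := Lsmall (eta x * th ^+ 2); first by rewrite mulr_gt0 // exprn_gt0.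
  exists (maxn N1 N) => n; rewrite geq_max => /andP[n1 nN].
  have Yn y := Yp n y n1.
  have := le_trans (lyapunov_ge Yn x) (HN n nN).
  have := ratio_gt0 Yn x.
  move: (_ / eta x) => r r0; rewrite ler_pM2l //.
  rewrite -ler_sqrt ?sqr_ge0 // !sqrtr_sqr [`|th|]gtr0_norm // => /ler_normlP[s1 s2].
  have s0 : 0 <= Num.sqrt r by rewrite sqrtr_ge0.
  rewrite -[r](sqr_sqrtr (ltW r0)).
  have th1 : th <= 1 by rewrite ge_min lexx.
  have th3 : 3 * th <= e by rewrite mulrC -ler_pdivlMr // ge_min lexx orbT.
  move: (Num.sqrt r) s0 s1 s2 => s s0 s1 s2.
  by apply/ler_normlP; split; nra.
have tot2 : n%:R^-1 * total_degree (G n w) @[n --> \oo] --> (2 : R).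
  apply/cvgn_epsP => e e_gt0.
  exists (Num.trunc (t0 / e)).+1 => n le_n.
  have n0 : 0 < n%:R :> R by rewrite ltr0n (leq_trans _ le_n).
  rewrite total_degree_network // -/t0.
  have -> : n%:R^-1 * (t0 + 2 * n%:R) - 2 = t0 / n%:R by field; rewrite gt_eqF.
  rewrite ger0_norm ?divr_ge0 // ?(ltW n0) // ler_pdivrMr // mulrC.
  rewrite -ler_pdivrMr // ltW // (lt_le_trans (truncnS_gt _)) //.
  by rewrite ler_nat.
have H : (n%:R^-1 * total_degree (G n w)) *
    (type_degree (G n w) x / total_degree (G n w) / eta x) * eta x
    @[n --> \oo] --> 2 * 1 * eta x.
  by apply: cvgM; [exact: cvgM|exact: cvg_cst].
rewrite mulr1 in H.
apply/cvgn_epsP => e e_gt0; have [N HN] := (cvgn_epsP _ _).1 H e e_gt0.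
exists (maxn N1 N) => n; rewrite geq_max => /andP[n1 /HN] /=.
have Yn y := Yp n y n1.
have tn := total_degree_gt0 Yn.
set A := (X in `|X - _|) => h; rewrite (_ : _ * _ = A) // /A.
by move: (n%:R^-1) => iv; field; rewrite !gt_eqF.
Unshelve. all: end_near. Qed.

Theorem weight_cvg_ae :
  {ae P, forall w, forall b,
     n%:R^-1 * attach_mass kappa g0 (G n w) b @[n --> \oo] --> 2 * weight kappa eta b}.
Proof.
apply: filterS type_degree_cvg_ae => w H b.
apply: (@eq_cvgn _ (fun n => \sum_l kappa l b * (n%:R^-1 * type_degree (G n w) l))).
  move=> n; rewrite attach_mass_weight /weight mulr_sumr.
  by apply: eq_bigr => l _; ring.
rewrite /weight mulr_sumr.
rewrite (eq_bigr (fun l => kappa l b * (2 * eta l))); last by move=> l _; ring.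
apply: cvgn_sum => l; apply: cvgM; first exact: cvg_cst.
exact: H.
Qed.

End Convergence.
End StochasticApproximation.

(** * Recursion on trees and the weights of branching histories *)

Lemma ae_forall_countable (R : realType) d (T : measurableType d)
    (P : probability T R) (I : countType) (Pr : I -> T -> Prop) :
  (forall i, {ae P, forall w, Pr i w}) -> {ae P, forall w, forall i, Pr i w}.
Proof.
move=> H.
have Hn n : {ae P, forall w, if unpickle n is Some i then Pr i w else True}.
  case: (unpickle n) => [i|]; first exact: H.
  exact: aeW.
apply: filterS (ae_foralln Hn) => w Hw i.
by have := Hw (pickle i); rewrite pickleK.
Qed.

Section TreeFold.
Context (K : nat) (A : Type).
Variables (a0 : 'I_K -> A) (f : rtree K -> 'I_K -> nat -> A -> A).

Let step x (s : seq ('I_K * nat) * A) (e : 'I_K * nat) :=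
  (rcons s.1 e, f (x, s.1) e.1 e.2 s.2).

(* Recursion along the order of arrival of the vertices. *)
Definition rtree_fold (g : rtree K) : A :=
  (foldl (step g.1) ([::], a0 g.1) g.2).2.

Lemma rtree_fold_single x : rtree_fold (x, [::]) = a0 x.
Proof. by []. Qed.

Lemma rtree_fold_attach g b p :
  rtree_fold (attach g b p) = f g b p (rtree_fold g).
Proof.
rewrite /rtree_fold /= foldl_rcons /=.
have H s : (foldl (step g.1) ([::], a0 g.1) s).1 = s.
  by elim/last_ind: s => [|s e IH] //; rewrite foldl_rcons /= IH.
by rewrite H -surjective_pairing.
Qed.

End TreeFold.

Section BranchingWeights.
Context (R : realType) (K : nat).
Variable ph : 'I_K -> 'I_K -> R.

Definition birth_rate (h : rtree K) (b : 'I_K) (p : nat) : R :=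
  ph (vtype h p) b * (nchildren h p).+1%:R.

Definition total_rate (h : rtree K) : R :=
  \sum_b \sum_(p < order h) birth_rate h b p.

(* Probability that the first births before an exponential time of rate 2
   build the family tree [h] in this order. *)
Definition path_weight : rtree K -> R :=
  rtree_fold (fun _ => 1)
    (fun h b p q => q * (birth_rate h b p / (2 + total_rate h))).

Definition stop_weight (h : rtree K) : R :=
  path_weight h * (2 / (2 + total_rate h)).

Hypothesis ph_gt0 : forall x b, 0 < ph x b.

Lemma birth_rate_gt0 h b p : 0 < birth_rate h b p.
Proof. by rewrite mulr_gt0 // ltr0n. Qed.

Lemma total_rate_ge0 h : 0 <= total_rate h.
Proof.
by apply: sumr_ge0 => b _; apply: sumr_ge0 => p _; rewrite ltW // birth_rate_gt0.
Qed.

End BranchingWeights.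

(** * Frequencies of fringe trees *)

Section FringeCount.
Context (R : realType) (K : nat).

(** The root is left out: its degree is set by the convention on [g0], whereas every other vertex
    has degree one more than its number of children, as in the rates of the branching process. A
    single vertex does not affect the limit. *)
Definition fringe_count (h g : rtree K) : R :=
  \sum_(v < order g) ((0 < v)%N && (fringe g v == h))%:R.

Definition fringe_increment (h g : rtree K) (b : 'I_K) (p : nat) : R :=
  ((b, [::]) == h :> rtree K)%:R +
  \sum_(v < order g) ((0 < v)%N && (p \in descendants g v))%:R *
    ((attach (fringe g v) b (index p (descendants g v)) == h)%:R -
     (fringe g v == h)%:R).

Lemma fringe_count_attach h g b p : wf_tree g -> (p < order g)%N ->
  fringe_count h (attach g b p) = fringe_count h g + fringe_increment h g b p.
Proof.
move=> wg lt_p; rewrite /fringe_count order_attach big_ord_recr /= fringe_new.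
rewrite /fringe_increment addrA [RHS]addrAC; congr (_ + _).
rewrite -big_split /=; apply: eq_bigr => v _; rewrite fringe_attach //.
case: (0 < v)%N => /=; last by rewrite mul0r addr0.
by case: ifP => _ /=; ring.
Qed.

Lemma fringe_count_le h g : `|fringe_count h g| <= (order g)%:R.
Proof.
rewrite ger0_norm ?sumr_ge0 //.
apply: le_trans (_ : _ <= \sum_(v < order g) 1) _; last first.
  by rewrite sumr_const card_ord.
by apply: ler_sum => v _; rewrite lern1 leq_b1.
Qed.

Lemma ancestors_of_order_le1 (g : rtree K) p m : wf_tree g ->
  \sum_(v < order g) ((p \in descendants g v) && (order (fringe g v) == m))%:R
  <= 1 :> R.
Proof.
move=> wg.
case: (pickP (fun v : 'I_(order g) =>
   (p \in descendants g v) && (order (fringe g v) == m))) => [v /andP[Hv /eqP mv]|H].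
  rewrite (bigD1 v) //= Hv mv eqxx /= big1 ?addr0 // => u uv.
  case: andP => // -[Hu /eqP mu]; case/eqP: uv; apply: val_inj.
  by apply: (order_fringe_inj wg) Hu Hv _; rewrite ?mu ?mv.
by rewrite big1 ?ler01 // => v _; rewrite H.
Qed.

(** An arrival enlarges the fringe trees of all ancestors of the new vertex, possibly very many, but
    these trees have distinct orders: at most one can turn into [h] and at most one can cease to be
    [h]. The third unit is the new leaf. *)
Lemma fringe_increment_bound h g b p : wf_tree g ->
  `|fringe_increment h g b p| <= 3.
Proof.
move=> wg; rewrite /fringe_increment.
apply: le_trans (ler_normD _ _) _.
have -> : 3 = 1 + (1 + 1) :> R by ring.
apply: lerD; first by rewrite ger0_norm // lern1 leq_b1.
apply: le_trans (ler_norm_sum _ _ _) _.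
have [m hm] : exists m, order h = m.+1 by exists (size h.2).
apply: le_trans (lerD (ancestors_of_order_le1 p m wg)
   (ancestors_of_order_le1 p (order h) wg)).
rewrite -big_split /=; apply: ler_sum => v _.
case: (p \in descendants g v); rewrite ?andbT ?andbF /= ?mul0r ?normr0 ?addr0 //.
rewrite normrM ger0_norm //; apply: (@le_trans _ _ (1 * (
   (attach (fringe g v) b (index p (descendants g v)) == h)%:R +
     (fringe g v == h)%:R))).
  apply: ler_pM => //; first by rewrite lern1 leq_b1.
  by apply: le_trans (ler_normB _ _) _; rewrite !ger0_norm.
rewrite mul1r; apply: lerD; case: eqP => // e; last by rewrite e eqxx.
by move: hm; rewrite -e order_attach => -[->]; rewrite eqxx.
Qed.

End FringeCount.

Section FringeMean.
Context (R : realType) (K : nat).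
Variables (mu : 'I_K -> R) (kappa : 'M[R]_K).
Variable g0 : rtree K.
Hypothesis kappa_gt0 : forall x y, 0 < kappa x y.
Hypothesis mu_sum1 : \sum_x mu x = 1.

Lemma sum_over_descendants (g : rtree K) v (F : nat -> nat -> R) :
  (v < order g)%N ->
  \sum_(p < order g) ((p : nat) \in descendants g v)%:R *
    F p (index (p : nat) (descendants g v)) =
  \sum_(i < order (fringe g v)) F (nth 0%N (descendants g v) i) i.
Proof.
move=> lt_v.
rewrite -(size_descendants lt_v) -(big_mkord xpredT
  (fun i => F (nth 0%N (descendants g v) i) i)).
transitivity (\sum_(p <- descendants g v) F p (index p (descendants g v)));
  last first.
  rewrite [LHS](big_nth 0%N) big_nat_cond [RHS]big_nat_cond.
  apply: eq_bigr => i /andP[/andP[_ lt_i] _].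
  by rewrite index_uniq // descendants_uniq.
have us := descendants_uniq lt_v.
have bd u : u \in descendants g v -> (u < order g)%N.
  by move=> /(descendants_bound lt_v)/andP[].
move: (descendants g v) us bd => s us bd.
rewrite -(big_mkord xpredT (fun p => (p \in s)%:R * F p (index p s))).
rewrite /index_iota subn0.
rewrite (eq_bigr (fun p => if p \in s then F p (index p s) else 0)); last first.
  by move=> p _; case: (p \in s); rewrite ?mul1r ?mul0r.
rewrite -big_mkcond -big_filter; apply: perm_big.
apply: uniq_perm => //; first by rewrite filter_uniq // iota_uniq.
move=> p; rewrite mem_filter mem_iota add0n /=.
by case ps : (p \in s) => //=; rewrite bd.
Qed.

(* The [\sum_p step_prob] that the next vertex has type [b] and hangs below
   the [i]-th vertex of a fringe tree [h]. *)
Definition fringe_rate (g h : rtree K) (b : 'I_K) (i : nat) : R :=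
  mu b * (kappa (vtype h i) b * (nchildren h i).+1%:R) / attach_mass kappa g0 g b.

Lemma step_prob_fringe g v b i : wf_tree g -> (v < order g)%N -> (0 < v)%N ->
  (i < order (fringe g v))%N ->
  step_prob mu kappa g0 g b (nth 0%N (descendants g v) i) =
  fringe_rate g (fringe g v) b i.
Proof.
move=> wg lt_v v0 lt_i; rewrite /step_prob /attach_prob /fringe_rate.
rewrite -[\sum_(u < order g) _]/(attach_mass kappa g0 g b).
rewrite vtype_fringe // nchildren_fringe // degreeE.
have Dv : nth 0%N (descendants g v) i \in descendants g v.
  by rewrite mem_nth // size_descendants.
have /andP[le_v _] := descendants_bound lt_v Dv.
by rewrite (leq_trans v0 le_v) addn1 mulrA.
Qed.

Lemma step_mean_fringe_increment h g : reachable g0 g ->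
  step_mean mu kappa g0 (fringe_increment R h) g =
  \sum_b mu b * ((b, [::]) == h :> rtree K)%:R +
  \sum_(v < order g) (0 < v)%:R *
    \sum_b \sum_(i < order (fringe g v)) fringe_rate g (fringe g v) b i *
      ((attach (fringe g v) b i == h)%:R - (fringe g v == h)%:R).
Proof.
move=> rg; have [wg _] := rg; rewrite /step_mean /fringe_increment.
under eq_bigr do (under eq_bigr do rewrite mulrDr; rewrite big_split /=).
rewrite big_split /=; congr (_ + _).
  by apply: eq_bigr => b _; rewrite -mulr_suml step_prob_sum_parent.
under eq_bigr do (under eq_bigr do rewrite mulr_sumr; rewrite exchange_big /=).
rewrite exchange_big /=; apply: eq_bigr => v _; rewrite mulr_sumr.
apply: eq_bigr => b _.
have [v0|v0] := posnP v.
  by rewrite mul0r big1 // => p _; rewrite mul0r mulr0.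
rewrite mul1r.
transitivity (\sum_(p < order g) ((p : nat) \in descendants g v)%:R *
    (fun q i => step_prob mu kappa g0 g b q *
      ((attach (fringe g v) b i == h)%:R - (fringe g v == h)%:R)) (p : nat)
       (index (p : nat) (descendants g v))).
  by apply: eq_bigr => p _ /=; rewrite mulrCA.
rewrite (sum_over_descendants (fun q i => step_prob mu kappa g0 g b q *
      ((attach (fringe g v) b i == h)%:R - (fringe g v == h)%:R))) //.
by apply: eq_bigr => i _; rewrite step_prob_fringe.
Qed.

Lemma loss_term h g :
  \sum_(v < order g) (0 < v)%:R *
    \sum_b \sum_(i < order (fringe g v)) fringe_rate g (fringe g v) b i *
      (fringe g v == h)%:R =
  fringe_count R h g * \sum_b \sum_(i < order h) fringe_rate g h b i.
Proof.
rewrite /fringe_count mulr_suml; apply: eq_bigr => v _.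
case: (0 < v)%N => /=; rewrite ?mul0r // mul1r.
have [->|_] := eqVneq (fringe g v) h.
  by rewrite mul1r; apply: eq_bigr => b _; apply: eq_bigr => i _; rewrite mulr1.
rewrite mul0r; apply: big1 => b _; apply: big1 => i _; rewrite mulr0.
by [].
Qed.

(** Because trees remember the order of arrival, [attach h b j] has the single predecessor [h] with
    the single arrival [(b, j)]; this is what leaves one gain term in the recursion. *)
Lemma gain_term h b j g : (j < order h)%N ->
  \sum_(v < order g) (0 < v)%:R *
    \sum_c \sum_(i < order (fringe g v)) fringe_rate g (fringe g v) c i *
      (attach (fringe g v) c i == attach h b j)%:R =
  fringe_count R h g * fringe_rate g h b j.
Proof.
move=> lt_j; rewrite /fringe_count mulr_suml; apply: eq_bigr => v _.
case: (0 < v)%N => /=; rewrite ?mul0r // mul1r.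
have [->|ne] := eqVneq (fringe g v) h; last first.
  rewrite mul0r; apply: big1 => c _; apply: big1 => i _.
  case: eqP => [/attach_inj[e]|]; rewrite ?mulr0 //.
  by rewrite e eqxx in ne.
rewrite mul1r (bigD1 b) //= [X in _ + X]big1 ?addr0; last first.
  move=> c cb; apply: big1 => i _.
  by case: eqP => [/attach_inj[_ e]|]; rewrite ?mulr0 //; rewrite e eqxx in cb.
rewrite (bigD1 (Ordinal lt_j)) //= eqxx mulr1 big1 ?addr0 // => i ij.
case: eqP => [/attach_inj[_ _ e]|]; rewrite ?mulr0 //.
by case/eqP: ij; apply: val_inj.
Qed.

Lemma step_mean_fringe_single x g : reachable g0 g ->
  step_mean mu kappa g0 (fringe_increment R (x, [::])) g =
  mu x - fringe_count R (x, [::]) g *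
    \sum_b \sum_(i < order (x, [::] : seq ('I_K * nat))) fringe_rate g (x, [::]) b i.
Proof.
move=> rg; rewrite step_mean_fringe_increment // -loss_term -sumrN.
congr (_ + _).
  rewrite (bigD1 x) //= eqxx mulr1 big1 ?addr0 // => b bx.
  by case: eqP => [[e]|]; rewrite ?mulr0 //; rewrite e eqxx in bx.
apply: eq_bigr => v _; rewrite -mulrN; congr (_ * _); rewrite -sumrN.
apply: eq_bigr => b _; rewrite -sumrN; apply: eq_bigr => i _.
rewrite mulrBr; case: eqP => [[_ e]|]; last by rewrite mulr0 sub0r.
by have := congr1 size e; rewrite size_rcons.
Qed.

Lemma step_mean_fringe_attach h b j g : reachable g0 g -> (j < order h)%N ->
  step_mean mu kappa g0 (fringe_increment R (attach h b j)) g =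
  fringe_count R h g * fringe_rate g h b j -
  fringe_count R (attach h b j) g *
    \sum_c \sum_(i < order (attach h b j)) fringe_rate g (attach h b j) c i.
Proof.
move=> rg lt_j; rewrite step_mean_fringe_increment // -loss_term -gain_term //.
rewrite big1 ?add0r; last first.
  move=> c _; case: eqP => [[_ e]|]; rewrite ?mulr0 //.
  by have := congr1 size e; rewrite size_rcons.
rewrite -sumrB; apply: eq_bigr => v _; rewrite -mulrBr; congr (_ * _).
rewrite -sumrB; apply: eq_bigr => c _; rewrite -sumrB; apply: eq_bigr => i _.
by rewrite mulrBr.
Qed.

End FringeMean.

Section FringeConvergence.
Context (R : realType) (K : nat).
Variables (mu : 'I_K -> R) (kappa : 'M[R]_K) (eta : 'I_K -> R).
Hypothesis mu_gt0 : forall x, 0 < mu x.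
Hypothesis mu_sum1 : \sum_x mu x = 1.
Hypothesis kappa_gt0 : forall x y, 0 < kappa x y.
Hypothesis eta_min : is_minimizer mu kappa eta.
Variable g0 : rtree K.
Hypothesis g0_wf : wf_tree g0.
Context d (T : measurableType d) (P : probability T R).
Variables (ty : nat -> T -> 'I_K) (par : nat -> T -> nat).
Hypothesis G_network : is_network mu kappa P g0 ty par.
Let G := network g0 ty par.
Let ph := phi mu kappa eta.

(** Induction along the arrivals in [h]: the limit found for its predecessor feeds the gain term.
    The attachment mass grows like [2 * n] times [weight], so the rates are half the birth rates;
    dividing by [1 + t / 2], with [t] the total rate, reproduces the factors of [stop_weight] with
    denominator [2 + t]. *)
Theorem fringe_count_cvg_ae :
  {ae P, forall w, forall h, wf_tree h ->
     n%:R^-1 * fringe_count R h (G n w) @[n --> \oo] --> mu h.1 * stop_weight ph h}.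
Proof.
have ph0 x b : 0 < ph x b by exact: (phi_gt0 mu_gt0 kappa_gt0 eta_min).
have we b : 0 < weight kappa eta b by exact: (weight_eta_gt0 kappa_gt0 eta_min).
have lln_ae : {ae P, forall w, forall h : rtree K, n%:R^-1 * (\sum_(i < n)
    (fringe_increment R h (G i w) (ty i w) (par i w) -
     step_mean mu kappa g0 (fringe_increment R h) (G i w))) @[n --> \oo] --> 0}.
  apply: ae_forall_countable => h.
  apply: (network_lln mu_gt0 mu_sum1 kappa_gt0 g0_wf G_network (C := 3)).
  by move=> g b p [wg _] _; exact: fringe_increment_bound.
have wf_ae := network_wf_ae mu_sum1 kappa_gt0 g0_wf G_network.
have w_ae := weight_cvg_ae mu_gt0 mu_sum1 kappa_gt0 eta_min g0_wf G_network.
near=> w => /=.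
have rG : forall n, reachable g0 (G n w) by near: w.
have wcvg : forall b, n%:R^-1 * attach_mass kappa g0 (G n w) b @[n --> \oo] -->
   2 * weight kappa eta b by near: w.
have lln : forall h : rtree K, n%:R^-1 * (\sum_(i < n)
    (fringe_increment R h (G i w) (ty i w) (par i w) -
     step_mean mu kappa g0 (fringe_increment R h) (G i w))) @[n --> \oo] --> 0.
  by near: w.
have rate_cvg h b i : n%:R * fringe_rate mu kappa g0 (G n w) h b i @[n --> \oo] -->
    birth_rate ph h b i / 2.
  have -> : birth_rate ph h b i / 2 =
    mu b * (kappa (vtype h i) b * (nchildren h i).+1%:R) *
      (2 * weight kappa eta b)^-1.
    rewrite /birth_rate /ph /phi /nu -/(weight kappa eta b).
    by field; rewrite gt_eqF.
  apply: (@eq_cvgn _ (fun n => mu b * (kappa (vtype h i) b * (nchildren h i).+1%:R) *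
    (n%:R^-1 * attach_mass kappa g0 (G n w) b)^-1)) => [n|].
    by rewrite /fringe_rate invfM invrK; ring.
  apply: cvgM; first exact: cvg_cst.
  by apply: cvgV => //; rewrite gt_eqF // mulr_gt0.
have total_cvg h : n%:R * (\sum_b \sum_(i < order h)
     fringe_rate mu kappa g0 (G n w) h b i) @[n --> \oo] --> total_rate ph h / 2.
  apply: (@eq_cvgn _ (fun n => \sum_b \sum_(i < order h)
     (n%:R * fringe_rate mu kappa g0 (G n w) h b i))) => [n|].
    by rewrite mulr_sumr; apply: eq_bigr => b _; rewrite mulr_sumr.
  rewrite /total_rate mulr_suml; apply: cvgn_sum => b.
  by rewrite mulr_suml; apply: cvgn_sum => i.
have count_le h n : (0 < n)%N ->
    `|fringe_count R h (G n w)| <= (order g0).+1%:R * n%:R.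
  move=> n0; apply: le_trans (fringe_count_le _ _ _) _.
  rewrite order_network -natrM ler_nat mulSn addnC leq_add2l.
  by rewrite leq_pmulr.
have stepE h n : fringe_count R h (G n.+1 w) = fringe_count R h (G n w) +
   step_mean mu kappa g0 (fringe_increment R h) (G n w) +
   (fringe_increment R h (G n w) (ty n w) (par n w) -
     step_mean mu kappa g0 (fringe_increment R h) (G n w)).
  have [wg _] := rG n.
  rewrite /= fringe_count_attach //; first by ring.
  exact: par_lt_order (rG n.+1).
have t0 h : 0 <= total_rate ph h / 2.
  by rewrite divr_ge0 // total_rate_ge0.
have pos h : 0 < 2 + total_rate ph h by rewrite ltr_pwDl // total_rate_ge0.
apply: wf_tree_ind => [x|h b p wh lt_p IH].
  have -> : mu x * stop_weight ph (x, [::]) =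
      mu x / (1 + total_rate ph (x, [::]) / 2).
    rewrite /stop_weight /path_weight rtree_fold_single.
    have := pos (x, [::]); move: (total_rate _ _) => t tp.
    by field; rewrite !gt_eqF //; lra.
  apply: (linear_recursion_cvg (t0 _) _ (count_le _) _ (total_cvg _) (lln (x, [::]))
    (A := fun=> mu x) (xi := fun n => fringe_increment R (x, [::]) (G n w) (ty n w) (par n w) -
     step_mean mu kappa g0 (fringe_increment R (x, [::])) (G n w))).
    move=> n n0; rewrite stepE step_mean_fringe_single //.
    have n1 : n%:R != 0 :> R by rewrite pnatr_eq0 -lt0n.
    set S := \sum_b _; set N := fringe_count _ _ _; set I := fringe_increment _ _ _ _ _.
    by field.
  exact: cvg_cst.
have -> : mu (attach h b p).1 * stop_weight ph (attach h b p) =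
    mu h.1 * stop_weight ph h * (birth_rate ph h b p / 2) /
      (1 + total_rate ph (attach h b p) / 2).
  rewrite /stop_weight /path_weight rtree_fold_attach.
  have := pos h; have := pos (attach h b p).
  rewrite -/(path_weight ph h); move: (total_rate _ _) (total_rate _ _) => t t' tp tp'.
  by field; rewrite !gt_eqF //; lra.
apply: (linear_recursion_cvg (t0 _) _ (count_le _) _ (total_cvg _) (lln (attach h b p))
  (A := fun n => (n%:R^-1 * fringe_count R h (G n w)) *
     (n%:R * fringe_rate mu kappa g0 (G n w) h b p))
  (xi := fun n => fringe_increment R (attach h b p) (G n w) (ty n w) (par n w) -
     step_mean mu kappa g0 (fringe_increment R (attach h b p)) (G n w))).
  move=> n n0; rewrite stepE step_mean_fringe_attach //.
  have n1 : n%:R != 0 :> R by rewrite pnatr_eq0 -lt0n.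
  set S := \sum_c _; set N := fringe_count _ _ _; set I := fringe_increment _ _ _ _ _.
  by field.
by apply: cvgM.
Unshelve. all: end_near. Qed.

End FringeConvergence.

Lemma le_of_geometric_error (R : realType) (a b c r : R) : 0 <= r < 1 ->
  (forall N, a <= b + c * r ^+ N) -> a <= b.
Proof.
move=> /andP[r0 r1] H; rewrite leNgt; apply/negP => lt_ba.
have cr : c * r ^+ n @[n --> \oo] --> (0 : R).
  rewrite -[X in _ --> X](mulr0 c); apply: cvgM; first exact: cvg_cst.
  by apply: cvg_expr; rewrite ger0_norm.
have [|N HN] := (cvgn_epsP _ _).1 cr ((a - b) / 2); first by rewrite divr_gt0 // subr_gt0.
have := HN N (leqnn N); rewrite subr0 => /ler_normlP[_ h].
by have := H N; lra.
Qed.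

Lemma le_of_linear_error (R : realType) (a b c : R) :
  (forall x : R, 0 < x -> a <= b + c * x) -> a <= b.
Proof.
move=> H; rewrite leNgt; apply/negP => lt_ba.
have c0 : 0 < 1 + `|c| by rewrite ltr_pwDl.
have x0 : 0 < (a - b) / 2 / (1 + `|c|) by rewrite !divr_gt0 // subr_gt0.
have := H _ x0; set x := _ / _ in x0 *.
have : c * x <= (a - b) / 2.
  apply: (@le_trans _ _ ((1 + `|c|) * x)); last by rewrite /x mulrC divfK // gt_eqF.
  rewrite ler_wpM2r ?(ltW x0) //; apply: le_trans (ler_norm c) _.
  by rewrite lerDr.
lra.
Qed.

Lemma one_sub_expRN_bounds (R : realType) (u : R) : 0 <= u ->
  u / (1 + u) <= 1 - expR (- u) <= u.
Proof.
move=> u0; have p : 0 < 1 + u by rewrite ltr_pwDl.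
have h1 := expR_ge1Dx (- u); have h2 := expR_ge1Dx u.
apply/andP; split; last by lra.
rewrite expRN; have : (expR u)^-1 <= (1 + u)^-1.
  by rewrite lef_pV2 ?posrE ?expR_gt0.
have -> : u / (1 + u) = 1 - (1 + u)^-1 by field; rewrite gt_eqF.
lra.
Qed.

(** * Races of exponential variables *)

Section Race.
Context (R : realType) d (T : measurableType d) (P : probability T R).
Context (I : choiceType).
Variable lam : I -> R.
Hypothesis lam_gt0 : forall i, 0 < lam i.

(* On [E], an event of probability [q], the [Z i] with [S i] behave as
   independent exponential variables of rates [lam i]. *)
Definition exp_family (E : set T) (Z : I -> T -> R) (S : I -> Prop) (q : R) :
    Prop :=
  [/\ measurable E, forall i, measurable_fun setT (Z i)
    & forall (s : seq I) (t : I -> R), uniq s -> (forall i, i \in s -> S i) ->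
        (forall i, 0 <= t i) ->
        pr P (E `&` [set w | forall i, i \in s -> t i < Z i w]) =
        q * \prod_(i <- s) expR (- (lam i * t i))].

Lemma exp_family_mass E Z S q : exp_family E Z S q -> pr P E = q.
Proof.
move=> [mE mZ H]; have := H [::] (fun=> 0) isT (fun _ => ltac:(done)) (fun=> lexx 0).
by rewrite big_nil mulr1 => <-; congr pr; apply/seteqP; split => w // [].
Qed.

Lemma measurable_lt (f g : T -> R) : measurable_fun setT f ->
  measurable_fun setT g -> measurable [set w | f w < g w].
Proof.
move=> mf mg.
have := measurable_funB mg mf => mgf.
have -> : [set w | f w < g w] = setT `&` (g \- f) @^-1` `]0, +oo[.
  rewrite setTI; apply/seteqP; split => w /=;
    by rewrite in_itv /= andbT subr_gt0.
exact: mgf.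
Qed.

Lemma measurable_forall_seq (s : seq I) (A : I -> set T) :
  (forall i, measurable (A i)) -> measurable [set w | forall i, i \in s -> A i w].
Proof.
move=> mA; elim: s => [|i s IH].
  by rewrite (_ : [set w | _] = setT) //; apply/seteqP; split.
rewrite (_ : [set w | _] = A i `&` [set w | forall i, i \in s -> A i w]).
  exact: measurableI.
apply/seteqP; split => w /=.
  by move=> H; split; [apply: H; rewrite inE eqxx|move=> j js; apply: H; rewrite inE js orbT].
by move=> [Ai H] j; rewrite inE => /predU1P[->|/H].
Qed.

Section Step.
Variables (E : set T) (Z : I -> T -> R) (S : I -> Prop) (q : R).
Hypothesis EZ : exp_family E Z S q.
Variables (A : seq I) (j : I).
Hypotheses (A_uniq : uniq A) (A_S : forall i, i \in A -> S i) (jA : j \in A).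

Let mE : measurable E. Proof. by case: EZ. Qed.
Let mZ i : measurable_fun setT (Z i). Proof. by case: EZ. Qed.
Let Lam := \sum_(i <- A) lam i.

Section Window.
Variables (s : seq I) (t : I -> R).
Hypotheses (s_uniq : uniq s) (s_S : forall i, i \in s -> S i) (js : j \notin s).
Hypothesis t_ge0 : forall i, 0 <= t i.
Hypothesis As : forall i, i \in A -> i != j -> i \in s.

Let C := \prod_(i <- s) expR (- (lam i * t i)).
Let a i : R := (i \in A)%:R.

Lemma race_rate : \sum_(i <- s) lam i * a i = Lam - lam j.
Proof.
rewrite /Lam (perm_big _ (perm_to_rem jA)) big_cons [RHS]addrAC subrr add0r.
rewrite (eq_bigr (fun i => if i \in A then lam i else 0)); last first.
  by move=> i _; rewrite /a; case: (i \in A); rewrite ?mulr1 ?mulr0.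
rewrite -big_mkcond -big_filter; apply: perm_big; apply: uniq_perm.
- exact: filter_uniq.
- exact: rem_uniq.
- move=> i; rewrite mem_filter mem_rem_uniq // inE.
  case iA : (i \in A) => //=; rewrite ?andbF // andbT.
  case: eqVneq => [->|ij] /=; last by rewrite As.
  exact/negbTE.
Qed.

(** [Z j] is confined to a cell of width [x], and the moving threshold of the window is frozen at
    the left end of the cell ([e] false) or at its right end ([e] true). Boxes of the former kind
    cover the window up to small sets, those of the latter lie inside it. *)
Let box (x : R) (e : bool) (k : nat) : set T :=
  E `&` [set w | k%:R * x < Z j w <= k.+1%:R * x] `&`
  [set w | forall i, i \in s -> t i + a i * ((k + e)%:R * x) < Z i w].

(** [exp_family] provides survival probabilities only; a box is the difference of two such events,
    with the thresholds of the other variables unchanged. *)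
Let tail (x : R) (e : bool) (k l : nat) : set T :=
  E `&` [set w | forall i, i \in j :: s ->
    (if i == j then l%:R * x else t i + a i * ((k + e)%:R * x)) < Z i w].

Let mtail x e k l : measurable (tail x e k l).
Proof.
apply: measurableI => //; apply: measurable_forall_seq => i.
by apply: measurable_lt => //; exact: measurable_cst.
Qed.

Let boxE (x : R) e k : 0 <= x -> box x e k = tail x e k k `\` tail x e k k.+1.
Proof.
move=> x0; apply/seteqP; split => w.
  move=> [[Ew /= /andP[lo hi]] H]; split.
    split=> // i; rewrite inE; case: eqVneq => [->|ij] //=.
    by move=> is_; apply: H.
  move=> [_ /= /(_ j)]; rewrite inE !eqxx => /(_ isT).
  by rewrite ltNge hi.
move=> [[Ew /= H] H']; split.
  split=> //=; have := H j; rewrite inE !eqxx => /(_ isT) -> /=.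
  rewrite leNgt; apply/negP => lt_; apply: H'; split=> // i.
  rewrite inE; case: eqVneq => [->|ij] //= is_.
  by have := H i; rewrite inE (negbTE ij) is_ => /(_ isT).
move=> i is_ /=; have := H i; rewrite inE is_ orbT => /(_ isT).
by case: eqVneq => // ij; case/negP: js; rewrite -ij.
Qed.

Let mbox (x : R) e k : 0 <= x -> measurable (box x e k).
Proof. by move=> x0; rewrite boxE //; apply: measurableD. Qed.

Let pr_tail (x : R) e k l : 0 <= x ->
  pr P (tail x e k l) = q * C * expR (- (lam j * (l%:R * x))) *
    expR (- ((Lam - lam j) * ((k + e)%:R * x))).
Proof.
move=> x0; have [_ _ H] := EZ.
have h i : i \in j :: s -> S i.
  by rewrite inE => /predU1P[->|/s_S //]; exact: A_S.
rewrite [LHS]H //=; last 2 first.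
- by rewrite js.
- move=> i; case: eqP => _; first by rewrite mulr_ge0.
  by rewrite addr_ge0 // !mulr_ge0.
rewrite big_cons eqxx.
rewrite (eq_big_seq (fun i => expR (- (lam i * t i)) *
    expR (- ((lam i * a i) * ((k + e)%:R * x))))); last first.
  move=> i is_; case: eqVneq => [ij|_]; first by case/negP: js; rewrite -ij.
  by rewrite -expRD; congr expR; ring.
rewrite big_split /= -/C -expR_sum sumrN -mulr_suml race_rate; ring.
Qed.

Let pr_box (x : R) e k : 0 <= x ->
  pr P (box x e k) = q * C * expR (- ((Lam - lam j) * (e%:R * x))) *
    (1 - expR (- (lam j * x))) * expR (- (Lam * x)) ^+ k.
Proof.
move=> x0; rewrite boxE // prD //; last first.
  move=> w [Ew /= H]; split=> // i is_; have := H i is_.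
  case: eqP => // _; apply: le_lt_trans.
  by rewrite ler_wpM2r // ler_nat.
rewrite !pr_tail // -expRM_natr -mulrBl -mulrBr.
have -> : expR (- (lam j * (k.+1%:R * x))) =
   expR (- (lam j * (k%:R * x))) * expR (- (lam j * x)).
  by rewrite -expRD -natr1; congr expR; ring.
have -> : expR (- ((Lam - lam j) * ((k + e)%:R * x))) =
   expR (- ((Lam - lam j) * (k%:R * x))) * expR (- ((Lam - lam j) * (e%:R * x))).
  by rewrite -expRD natrD; congr expR; ring.
have -> : expR (- (Lam * x) * k%:R) =
   expR (- (lam j * (k%:R * x))) * expR (- ((Lam - lam j) * (k%:R * x))).
  by rewrite -expRD; congr expR; ring.
ring.
Qed.

Let box_disjoint (x : R) e k l : 0 <= x -> k != l -> box x e k `&` box x e l = set0.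
Proof.
move=> x0.
have H k' l' w : (k' < l')%N -> box x e k' w -> box x e l' w -> False.
  move=> lt_kl [[_ /= /andP[_ hi]] _] [[_ /= /andP[lo _]] _].
  have : Z j w < Z j w; last by rewrite ltxx.
  apply: le_lt_trans hi (le_lt_trans _ lo).
  by rewrite ler_wpM2r // ler_nat.
move=> kl; apply/seteqP; split => w // [bk bl].
by case: (ltngtP k l) kl => // lt_kl _; [exact: (H k l w)|exact: (H l k w)].
Qed.

Let window := E `&` [set w | forall i, i \in s -> t i + a i * Z j w < Z i w].

Let mwindow : measurable window.
Proof.
apply: measurableI => //; apply: measurable_forall_seq => i.
apply: measurable_lt => //; apply: measurable_funD; first exact: measurable_cst.
by apply: measurable_funM => //; exact: measurable_cst.
Qed.

Let Lam_gt0 : 0 < Lam.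
Proof.
rewrite /Lam (perm_big _ (perm_to_rem jA)) big_cons ltr_pwDl //.
by rewrite sumr_ge0 // => i _; exact: ltW.
Qed.

Let q_ge0 : 0 <= q.
Proof. by rewrite -(exp_family_mass EZ) pr_ge0. Qed.

Let C_ge0 : 0 <= C.
Proof. by apply: prodr_ge0 => i _; exact: expR_ge0. Qed.

Let geom (x : R) N : 0 < x -> \sum_(k < N) expR (- (Lam * x)) ^+ k =
  (1 - expR (- (Lam * x)) ^+ N) / (1 - expR (- (Lam * x))).
Proof.
move=> x0; have rho1 : expR (- (Lam * x)) < 1.
  by rewrite expR_lt1 oppr_lt0 mulr_gt0.
have nz : 1 - expR (- (Lam * x)) != 0 by rewrite gt_eqF // subr_gt0.
apply: (mulIf nz); rewrite divfK // mulrC -[1 - _ ^+ N]opprB subrX1.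
by ring.
Qed.

Let expN_itv (y x : R) : 0 < y -> 0 < x -> 0 <= expR (- (y * x)) < 1.
Proof. by move=> y0 x0; rewrite expR_ge0 expR_lt1 oppr_lt0 mulr_gt0. Qed.

Let box_sum (x : R) e N : 0 < x ->
  \sum_(k <- index_iota 0 N) pr P (box x e k) =
  q * C * expR (- ((Lam - lam j) * (e%:R * x))) * (1 - expR (- (lam j * x))) /
    (1 - expR (- (Lam * x))) * (1 - expR (- (Lam * x)) ^+ N).
Proof.
move=> x0; rewrite big_mkord; under eq_bigr do rewrite pr_box ?(ltW x0) //.
by rewrite -mulr_sumr geom //; ring.
Qed.

Let window_ge (x : R) : 0 < x ->
  q * C * expR (- ((Lam - lam j) * x)) * (1 - expR (- (lam j * x))) /
    (1 - expR (- (Lam * x))) <= pr P window.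
Proof.
move=> x0; set B := (X in X <= _).
apply: (le_of_geometric_error (expN_itv Lam_gt0 x0) (c := B)) => N.
rewrite -lerBlDr.
have -> : B - B * expR (- (Lam * x)) ^+ N =
    \sum_(k <- index_iota 0 N) pr P (window `&` box x true k).
  rewrite (eq_bigr (fun k => pr P (box x true k))).
    by rewrite box_sum // mul1r -/B; ring.
  move=> k _; congr pr; apply: setIidr => w [[Ew /= /andP[lo hi]] H].
  split=> // i is_; apply: le_lt_trans (H i is_).
  by rewrite lerD2l ler_wpM2l // addn1.
apply: pr_disjoint_sum_le; rewrite ?iota_uniq //.
  by move=> k; apply/mbox/ltW.
by move=> k l; apply/box_disjoint/ltW.
Qed.

Let pr_nonpos : pr P (E `&` [set w | Z j w <= 0]) = 0.
Proof.
have mj : measurable [set w | 0 < Z j w].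
  by apply: measurable_lt => //; exact: measurable_cst.
have := prID P mE mj; rewrite (exp_family_mass EZ).
have [_ _ H] := EZ; have := H [:: j] (fun=> 0) isT.
rewrite big_seq1 mulr0 oppr0 expR0 mulr1.
rewrite (_ : [set w | forall i, i \in [:: j] -> 0 < Z i w] = [set w | 0 < Z j w]).
  move=> -> //; last by move=> i; rewrite inE => /eqP ->; exact: A_S.
  rewrite (_ : E `\` [set w | 0 < Z j w] = E `&` [set w | Z j w <= 0]); first lra.
  apply/seteqP; split => w /= [Ew h]; split=> //; last by apply/negP; rewrite -leNgt.
  by rewrite leNgt; apply/negP.
apply/seteqP; split => w /= h; first by apply: h; rewrite inE.
by move=> i; rewrite inE => /eqP ->.
Qed.

Let pr_large (y : R) : 0 <= y ->
  pr P (E `&` [set w | y < Z j w]) = q * expR (- (lam j * y)).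
Proof.
move=> y0; have [_ _ H] := EZ; have := H [:: j] (fun=> y) isT.
rewrite big_seq1 => <- //; last by move=> i; rewrite inE => /eqP ->; exact: A_S.
congr pr; apply/seteqP; split => w /= [Ew h]; split=> //.
  by move=> i; rewrite inE => /eqP ->.
by apply: h; rewrite inE.
Qed.

Let window_le (x : R) : 0 < x ->
  pr P window <= q * C * (1 - expR (- (lam j * x))) / (1 - expR (- (Lam * x))).
Proof.
move=> x0; set B := (X in _ <= X).
apply: (le_of_geometric_error (expN_itv (lam_gt0 j) x0) (c := q)) => N.
have B0 : 0 <= B.
  have /andP[_ h1] := expN_itv (lam_gt0 j) x0.
  have /andP[_ h2] := expN_itv Lam_gt0 x0.
  by rewrite /B !mulr_ge0 ?invr_ge0 ?subr_ge0 // ltW.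
have y0 : 0 <= N%:R * x by rewrite mulr_ge0 // ltW.
have mnon : measurable (E `&` [set w | Z j w <= 0]).
  apply: measurableI => //.
  rewrite (_ : [set w | _] = ~` [set w | 0 < Z j w]).
    by apply: measurableC; apply: measurable_lt => //; exact: measurable_cst.
  by apply/seteqP; split => w /=; rewrite leNgt => /negP.
have mlarge : measurable (E `&` [set w | N%:R * x < Z j w]).
  by apply: measurableI => //; apply: measurable_lt => //; exact: measurable_cst.
have mb k : measurable (box x false k) by apply/mbox/ltW.
have mU : measurable (\big[setU/set0]_(k <- index_iota 0 N) box x false k).
  exact: bigsetU_measurable.
(* What the boxes up to [N * x] miss is the null event [Z j <= 0] and a tail whose mass decays
   geometrically in [N]; [le_of_geometric_error] removes the latter. *)
have cover : window `<=` (E `&` [set w | Z j w <= 0]) `|`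
    ((E `&` [set w | N%:R * x < Z j w]) `|`
     \big[setU/set0]_(k <- index_iota 0 N) box x false k).
  move=> w [Ew /= H]; have [le0|gt0] := leP (Z j w) 0; first by left.
  right; have [leN|gtN] := leP (Z j w) (N%:R * x); last by left.
  right; rewrite -bigcup_seq.
  have [k [lt_k lo hi]] : exists k, [/\ (k < N)%N, k%:R * x < Z j w &
      Z j w <= k.+1%:R * x].
    elim: N {y0 mlarge mU} leN => [|N IH] leN.
      by move: leN; rewrite mul0r leNgt gt0.
    have [le'|gt'] := leP (Z j w) (N%:R * x); last by exists N; split.
    by have [k [lt_k lo hi]] := IH le'; exists k; split=> //; apply: ltnW.
  exists k; first by rewrite /= mem_index_iota.
  split; first by split=> //=; rewrite lo hi.
  move=> i is_; apply: le_lt_trans (H i is_).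
  by rewrite lerD2l ler_wpM2l // addn0 ltW.
apply: le_trans (pr_le P mwindow _ cover) _.
  by apply: measurableU => //; exact: measurableU.
apply: le_trans (prU_le P mnon (measurableU _ _ mlarge mU)) _.
rewrite pr_nonpos add0r; apply: le_trans (prU_le P mlarge mU) _.
rewrite addrC; apply: lerD.
  apply: le_trans (pr_bigU_le P _ mb) _.
  rewrite box_sum // mul0r mulr0 oppr0 expR0 mulr1 -/B.
  rewrite -[leRHS]mulr1 ler_wpM2l //.
rewrite pr_large // -expRM_natr ler_wpM2l // le_eqVlt; apply/orP; left.
by apply/eqP; congr expR; ring.
Qed.

(* Cut the values of [Z j] into small steps: on each step the other variables
   are controlled by the survival function, and the steps sum to a geometric
   series. *)
Lemma pr_window : pr P window = q * C * (lam j / Lam).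
Proof.
have lj := lam_gt0 j.
have qC : 0 <= q * C by rewrite mulr_ge0.
have L1 : 0 <= Lam - lam j.
  rewrite -race_rate; apply: sumr_ge0 => i _; apply: mulr_ge0 => //.
  exact/ltW/lam_gt0.
apply/eqP; rewrite eq_le; apply/andP; split.
  apply: (le_of_linear_error (c := q * C * lam j)) => x x0.
  apply: le_trans (window_le x0) _.
  have u0 : 0 < lam j * x by rewrite mulr_gt0.
  have v0 : 0 < Lam * x by rewrite mulr_gt0.
  have /andP[_ h1] := one_sub_expRN_bounds (ltW u0).
  have /andP[h2 _] := one_sub_expRN_bounds (ltW v0).
  have -> : q * C * (lam j / Lam) + q * C * lam j * x =
     q * C * (lam j * x) / (Lam * x / (1 + Lam * x)).
    by field; rewrite !gt_eqF // ltr_pwDl // ltW.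
  apply: ler_pM; rewrite ?ler_wpM2l //.
  - rewrite mulr_ge0 // subr_ge0 ltW //.
    by case/andP: (expN_itv lj x0).
  - rewrite invr_ge0 subr_ge0 ltW //.
    by case/andP: (expN_itv Lam_gt0 x0).
  - rewrite lef_pV2 ?posrE //.
    + by apply: lt_le_trans h2; rewrite divr_gt0 // ltr_pwDl // ltW.
    + by rewrite divr_gt0 // ltr_pwDl // ltW.
apply: (le_of_linear_error (c := q * C * lam j)) => x x0.
rewrite -lerBlDr; apply: le_trans (window_ge x0).
have u0 : 0 < lam j * x by rewrite mulr_gt0.
have v0 : 0 < Lam * x by rewrite mulr_gt0.
have /andP[h1 _] := one_sub_expRN_bounds (ltW u0).
have /andP[_ h2] := one_sub_expRN_bounds (ltW v0).
have h3 := expR_ge1Dx (lam j * x).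
apply: (@le_trans _ _ (q * C * expR (- ((Lam - lam j) * x)) *
    (lam j * x / (1 + lam j * x)) / (Lam * x))); last first.
  apply: ler_pM; rewrite ?ler_wpM2l ?mulr_ge0 ?expR_ge0
    ?invr_ge0 ?(ltW v0) ?(ltW u0) ?(ltW lj) ?(ltW x0) //.
  - by rewrite addr_ge0 // ltW.
  - rewrite lef_pV2 ?posrE // subr_gt0.
    by case/andP: (expN_itv Lam_gt0 x0).
apply: (@le_trans _ _ (q * C * (lam j / Lam) * expR (- (Lam * x)))).
  have := expR_ge1Dx (- (Lam * x)).
  have k0 : 0 <= q * C * (lam j / Lam) by rewrite mulr_ge0 // divr_ge0 // ltW.
  move=> /(ler_wpM2l k0); apply: le_trans; rewrite le_eqVlt; apply/orP; left.
  by apply/eqP; field; rewrite gt_eqF.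
have -> : expR (- (Lam * x)) = expR (- ((Lam - lam j) * x)) * expR (- (lam j * x)).
  by rewrite -expRD; congr expR; ring.
have -> : q * C * expR (- ((Lam - lam j) * x)) * (lam j * x / (1 + lam j * x)) /
    (Lam * x) = q * C * (lam j / Lam) * (expR (- ((Lam - lam j) * x)) *
      (1 + lam j * x)^-1).
  by field; rewrite !gt_eqF // ltr_pwDl // ltW.
rewrite ler_wpM2l ?mulr_ge0 ?invr_ge0 ?(ltW lj) ?(ltW Lam_gt0) //.
rewrite ler_wpM2l ?expR_ge0 // expRN lef_pV2 ?posrE ?expR_gt0 //.
by rewrite ltr_pwDl // ltW.
Qed.

End Window.

(* Memorylessness: once [j] has won the race among [A], the residual times of
   the losers and the untouched variables are again independent exponentials. *)
Lemma race_step (S' : I -> Prop) :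
  (forall i, S' i -> S i /\ i != j) ->
  exp_family
    (E `&` [set w | forall i, i \in A -> i != j -> Z j w < Z i w])
    (fun i w => if i \in A then Z i w - Z j w else Z i w) S'
    (q * (lam j / Lam)).
Proof.
move=> S'S; split.
- apply: measurableI => //.
  rewrite (_ : [set w | _] = [set w | forall i, i \in A ->
     (if i == j then setT else [set w | Z j w < Z i w]) w]).
    apply: (@measurable_forall_seq A (fun i => if i == j then setT else
      [set w | Z j w < Z i w])) => i.
    by case: (i == j); [exact: measurableT|exact: measurable_lt].
  apply/seteqP; split => w /= h i iA; first by case: eqVneq => // ij; exact: h.
  by move=> ij; have := h i iA; rewrite (negbTE ij).
- move=> i; case: (i \in A) => //; exact: measurable_funB.
move=> s t us sS t0.
(* Losers of the race outside [s] are added with threshold 0: for them [Z j < Z i] is the whole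
   requirement, so the window is exactly the event that [j] wins and the prescribed residuals
   survive. *)
pose s' := s ++ [seq i <- A | (i \notin s) && (i != j)].
pose t' i := if i \in s then t i else 0.
have js : j \notin s by apply/negP => /sS/S'S[_]; rewrite eqxx.
have js' : j \notin s' by rewrite mem_cat (negbTE js) mem_filter eqxx andbF.
have us' : uniq s'.
  rewrite cat_uniq us filter_uniq // andbT; apply/hasPn => i.
  by rewrite mem_filter => /andP[/andP[]].
have s'S i : i \in s' -> S i.
  rewrite mem_cat mem_filter => /orP[/sS/S'S[]//|/andP[_ ]]; exact: A_S.
have t'0 i : 0 <= t' i by rewrite /t'; case: ifP.
have As' i : i \in A -> i != j -> i \in s'.
  by move=> iA ij; rewrite mem_cat mem_filter iA ij !andbT orbN.
have := pr_window us' s'S js' t'0 As'.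
have -> : \prod_(i <- s') expR (- (lam i * t' i)) = \prod_(i <- s) expR (- (lam i * t i)).
  rewrite /s' big_cat /= [X in _ * X]big1_seq ?mulr1; last first.
    move=> i /andP[_]; rewrite mem_filter => /andP[/andP[/negbTE h _] _].
    by rewrite /t' h mulr0 oppr0 expR0.
  by apply: eq_big_seq => i is_; rewrite /t' is_.
move=> h; rewrite -mulrA [_ / Lam * _]mulrC mulrA -h; congr pr.
rewrite -setIA; congr (_ `&` _); apply/seteqP; split => w /=.
  move=> [H1 H2] i; rewrite mem_cat mem_filter /t'.
  case is_ : (i \in s) => /=.
    by have := H2 i is_; case iA : (i \in A); rewrite ?mul1r ?mul0r ?addr0 // ltrBrDr.
  by move=> /andP[ij iA]; rewrite iA mul1r add0r; exact: H1.
move=> H; split=> [i iA ij|i is_].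
  have := H i (As' i iA ij); rewrite iA mul1r; apply: le_lt_trans.
  by rewrite lerDr.
have := H i; rewrite mem_cat is_ /t' is_ => /(_ isT).
by case iA : (i \in A); rewrite ?mul1r ?mul0r ?addr0 // ltrBrDr.
Qed.

End Step.
End Race.

(** * The branching process at an exponential time *)

Section Words.
Variable K : nat.
Implicit Types (h : rtree K) (b c : 'I_K) (p v : nat) (u : seq nat).

(* The Ulam-Harris words of the vertices of a family tree. *)
Definition words : rtree K -> seq (seq nat) :=
  rtree_fold (fun _ => [:: [::]])
    (fun h b p ws => rcons ws (nchildren h p :: nth [::] ws p)).

Definition word h v : seq nat := nth [::] (words h) v.

Lemma words_attach h b p :
  words (attach h b p) = rcons (words h) (nchildren h p :: word h p).
Proof. by rewrite /words rtree_fold_attach. Qed.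

Lemma size_words h : size (words h) = order h.
Proof.
elim/rtree_ind: h => [x|h b p IH] //.
by rewrite words_attach size_rcons IH order_attach.
Qed.

Lemma word_attach_lt h b p v : (v < order h)%N ->
  word (attach h b p) v = word h v.
Proof. by move=> lt_v; rewrite /word words_attach nth_rcons size_words lt_v. Qed.

Lemma word_attach_new h b p :
  word (attach h b p) (order h) = nchildren h p :: word h p.
Proof. by rewrite /word words_attach nth_rcons size_words ltnn eqxx. Qed.

Lemma mem_word h v : (v < order h)%N -> word h v \in words h.
Proof. by move=> lt_v; rewrite mem_nth // size_words. Qed.

Lemma mem_wordsP h u : u \in words h -> exists2 v, (v < order h)%N & u = word h v.
Proof.
move=> hu; exists (index u (words h)); first by rewrite -size_words index_mem.
by rewrite /word nth_index.
Qed.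

(** Both claims go through one induction: the new word is fresh by the description of membership,
    combined with the uniqueness of the words already present. *)
Lemma words_spec h : wf_tree h ->
  uniq (words h) /\
  forall k u, k :: u \in words h <->
    exists v, [/\ (v < order h)%N, u = word h v & (k < nchildren h v)%N].
Proof.
move=> wh; elim/wf_tree_ind: h / wh => [x|h b p wh lt_p [IHu IHm]].
  by split=> // k u; split=> [|[v [_ _]]].
have new : nchildren h p :: word h p \notin words h.
  apply/negP => /IHm[v [lt_v ev]].
  suff -> : v = p by rewrite ltnn.
  by apply/eqP; rewrite -(nth_uniq [::] _ _ IHu) ?size_words //; apply/eqP.
split; first by rewrite words_attach rcons_uniq new.
move=> k u; rewrite words_attach mem_rcons inE; split.
  case/predU1P => [[-> ->]|/IHm[v [lt_v -> lt_k]]].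
    exists p; rewrite order_attach word_attach_lt // nchildren_attach eqxx addn1.
    by split=> //; apply: ltnW.
  exists v; rewrite order_attach word_attach_lt // nchildren_attach.
  by split=> //; [apply: ltnW|rewrite ltn_addr].
move=> [v []]; rewrite order_attach ltnS leq_eqVlt => /predU1P[->|lt_v].
  by rewrite nchildren_attach (nchildren_ge wh) // ltn_eqF.
rewrite word_attach_lt // nchildren_attach => -> lt_k.
case: (ltnP k (nchildren h v)) => [lt_k'|le_k].
  by apply/orP; right; apply/IHm; exists v.
case: eqVneq lt_k le_k => [<-|_] lt_k le_k; last by move: lt_k; rewrite addn0 ltnNge le_k.
by rewrite (_ : k = nchildren h p) ?eqxx //; move: lt_k le_k; rewrite addn1; lia.
Qed.

Lemma word_inj h v v' : wf_tree h -> (v < order h)%N -> (v' < order h)%N ->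
  word h v = word h v' -> v = v'.
Proof.
move=> wh lt_v lt_v' e; apply/eqP.
by rewrite -(nth_uniq [::] _ _ (words_spec wh).1) ?size_words //; apply/eqP.
Qed.

Lemma child_word h v k : wf_tree h -> (v < order h)%N ->
  (k :: word h v \in words h) = (k < nchildren h v)%N.
Proof.
move=> wh lt_v; apply/idP/idP => [/(words_spec wh).2[v' [lt_v' e]]|lt_k].
  by rewrite (word_inj wh lt_v lt_v' e).
by apply/(words_spec wh).2; exists v.
Qed.

Lemma child_word_closed h k u : wf_tree h -> k :: u \in words h -> u \in words h.
Proof. by move=> wh /(words_spec wh).2[v [lt_v -> _]]; exact: mem_word. Qed.

Lemma size_word h v l : wf_tree h -> (v < order h)%N ->
  (size (word h v) == l) = (ancestor h l v == Some 0%N).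
Proof.
move=> wh; elim/wf_tree_ind: h / wh v l => [x|h b p wh lt_p IH] v l.
  rewrite order_single ltnS leqn0 => /eqP ->.
  by case: l => [|l] //; rewrite ancestorS.
rewrite order_attach ltnS leq_eqVlt => /predU1P[->|lt_v].
  rewrite word_attach_new; case: l => [|l] //.
  by rewrite ancestor_attach_new // -IH.
by rewrite word_attach_lt // ancestor_attach_lt // IH.
Qed.

Definition clock h b v : option (clock_idx K) :=
  Some (word h v, vtype h v, nchildren h v, b).

(* The clocks that run between the last birth and the next one; [None] stands
   for the observation time. *)
Definition active h : seq (option (clock_idx K)) :=
  None :: [seq clock h b v | b <- enum 'I_K, v <- iota 0 (order h)].

Lemma mem_active h i : i \in active h ->
  i = None \/ exists b v, (v < order h)%N /\ i = clock h b v.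
Proof.
rewrite inE => /predU1P[->|/allpairsP[[b v] [_ + ->]]]; first by left.
by rewrite (mem_iota 0 (order h)) => lt_v; right; exists b, v.
Qed.

Lemma clock_active h b v : (v < order h)%N -> clock h b v \in active h.
Proof.
move=> lt_v; rewrite inE; apply/orP; right; apply/allpairsP; exists (b, v).
by rewrite mem_enum mem_iota.
Qed.

Lemma clock_inj h b b' v v' : wf_tree h -> (v < order h)%N -> (v' < order h)%N ->
  clock h b v = clock h b' v' -> b = b' /\ v = v'.
Proof. by move=> wh lt_v lt_v' [e _ _ ->]; split=> //; exact: word_inj e. Qed.

Lemma active_uniq h : wf_tree h -> uniq (active h).
Proof.
move=> wh; rewrite /active cons_uniq allpairs_uniq ?enum_uniq ?iota_uniq //.
  by rewrite andbT; apply/negP => /allpairsP[[b v] /= [_ _]].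
move=> [b v] [b' v'] /allpairsP[[c u] [_ + [-> ->]]].
rewrite (mem_iota 0 (order h)) => lt_v /allpairsP[[c' u'] [_ + [-> ->]]].
rewrite (mem_iota 0 (order h)) => lt_v'.
by move=> /(clock_inj wh lt_v lt_v')[/= e1 /= e2]; rewrite e1 e2.
Qed.

(** The clocks that have rung. Their values are bound by the recorded history, so they leave the
    family of variables that remain independent exponentials. *)
Definition winners : rtree K -> seq (option (clock_idx K)) :=
  rtree_fold (fun _ => [::]) (fun h b p s => clock h b p :: s).

Lemma winners_attach h b p : winners (attach h b p) = clock h b p :: winners h.
Proof. by rewrite /winners rtree_fold_attach. Qed.

Lemma winner_child h i : wf_tree h -> i \in winners h ->
  exists u x k b, i = Some (u, x, k, b) /\ k :: u \in words h.
Proof.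
move=> wh; elim/wf_tree_ind: h / wh => [x|h b p wh lt_p IH] //.
rewrite winners_attach inE words_attach => /predU1P[->|/IH].
  exists (word h p), (vtype h p), (nchildren h p), b.
  by rewrite mem_rcons inE eqxx.
move=> [u [x [k [c [-> ku]]]]]; exists u, x, k, c.
by rewrite mem_rcons inE ku orbT.
Qed.

(** A clock that has rung carries the rank of a child already born, an active clock the rank of the
    next child; the observation time has not rung. *)
Lemma active_not_winner h i : wf_tree h -> i \in active h -> i \notin winners h.
Proof.
move=> wh /mem_active[->|[b [v [lt_v ->]]]]; apply/negP => /(winner_child wh).
  by move=> [u [x [k [c [//]]]]].
move=> [u [x [k [c [[<- _ <- _]]]]]].
by rewrite child_word // ltnn.
Qed.

End Words.

Section Follow.
Context (R : realType) (K : nat).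
Context d (T : measurableType d) (P : probability T R).
Variable X : option (clock_idx K) -> T -> R.
Variable ph : 'I_K -> 'I_K -> R.
Hypothesis ph_gt0 : forall x b, 0 < ph x b.

Definition clock_rate (i : option (clock_idx K)) : R :=
  if i is Some (u, x, k, b) then ph x b * k.+1%:R else 2.

Lemma clock_rate_gt0 i : 0 < clock_rate i.
Proof. by case: i => [[[[u x] k] b]|] //=; rewrite mulr_gt0 // ltr0n. Qed.

(* Time that clock [i] still has to run just after the birth of the last vertex
   of [h]. *)
Definition residual : rtree K -> option (clock_idx K) -> T -> R :=
  rtree_fold (fun _ => X)
    (fun h b p Z i w => if i \in active h then Z i w - Z (clock h b p) w else Z i w).

Lemma residual_attach h b p : residual (attach h b p) =
  fun i w => if i \in active h then residual h i w - residual h (clock h b p) w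
             else residual h i w.
Proof. by rewrite /residual rtree_fold_attach. Qed.

(* The clocks ring in the order that builds [h], before the observation time. *)
Definition follow : rtree K -> set T :=
  rtree_fold (fun _ => setT)
    (fun h b p E => E `&` [set w | forall i, i \in active h -> i != clock h b p ->
       residual h (clock h b p) w < residual h i w]).

Lemma follow_attach h b p : follow (attach h b p) =
  follow h `&` [set w | forall i, i \in active h -> i != clock h b p ->
       residual h (clock h b p) w < residual h i w].
Proof. by rewrite /follow rtree_fold_attach. Qed.

Definition stop (h : rtree K) : set T :=
  follow h `&` [set w | forall i, i \in active h -> i != None ->
       residual h None w < residual h i w].

Lemma sum_active_rate h :
  \sum_(i <- active h) clock_rate i = 2 + total_rate ph h.
Proof.
rewrite big_cons; congr (_ + _); rewrite big_allpairs_dep /total_rate big_enum.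
apply: eq_bigr => b _; rewrite -(big_mkord xpredT (birth_rate ph h b)).
by rewrite /index_iota subn0.
Qed.

Hypothesis X_exp : exp_family P clock_rate setT X (fun _ => True) 1.

Lemma follow_exp_family h : wf_tree h ->
  exp_family P clock_rate (follow h) (residual h) (fun i => i \notin winners h)
    (path_weight ph h).
Proof.
move=> wh; elim/wf_tree_ind: h / wh => [x|h b p wh lt_p IH].
  rewrite /follow /residual /path_weight !rtree_fold_single.
  by case: X_exp => mE mX H; split=> // s t us _; apply: H.
rewrite follow_attach residual_attach /path_weight rtree_fold_attach.
have -> : birth_rate ph h b p / (2 + total_rate ph h) =
    clock_rate (clock h b p) / \sum_(i <- active h) clock_rate i.
  by rewrite sum_active_rate.
apply: (race_step clock_rate_gt0 IH (active_uniq wh)).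
- by move=> i; exact: active_not_winner.
- exact: clock_active.
- by move=> i; rewrite winners_attach inE negb_or => /andP[].
Qed.

Lemma stop_exp_family h : wf_tree h ->
  exp_family P clock_rate (stop h)
    (fun i w => if i \in active h then residual h i w - residual h None w
                else residual h i w)
    (fun i => i \notin winners h /\ i != None) (stop_weight ph h).
Proof.
move=> wh; rewrite /stop_weight -sum_active_rate.
by apply: (race_step clock_rate_gt0 (follow_exp_family wh) (active_uniq wh)
  (fun i => @active_not_winner _ h i wh) (mem_head _ _)).
Qed.

Lemma measurable_stop h : wf_tree h -> measurable (stop h).
Proof. by case/stop_exp_family. Qed.

Lemma pr_stop h : wf_tree h -> pr P (stop h) = stop_weight ph h.
Proof. by move=> /stop_exp_family; exact: exp_family_mass. Qed.

Lemma follow_trunc h k w : follow h w -> follow (history_trunc h k) w.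
Proof.
elim/rtree_ind: h => [x|h b p IH].
  by rewrite /history_trunc /=; case: k.
rewrite follow_attach => -[fw Hw].
case: (leqP k (size h.2)) => [le_k|lt_k].
  by rewrite history_trunc_attach //; exact: IH.
rewrite /history_trunc take_oversize; last by rewrite /= size_rcons.
by rewrite -surjective_pairing follow_attach.
Qed.

(** Where two histories first differ, the same active clocks compete, and each of the two distinct
    winners would have to ring strictly before the other. *)
Lemma follow_inj h h' w : wf_tree h -> wf_tree h' -> h.1 = h'.1 ->
  size h.2 = size h'.2 -> follow h w -> follow h' w -> h = h'.
Proof.
move=> wh; elim/wf_tree_ind: h / wh h' => [x|h b p wh lt_p IH] h'.
  by case: h' => [x' [|//]] _ /= ->.
elim/rtree_ind: h' => [x'|h' b' p' _]; first by rewrite /= size_rcons.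
move=> /wf_attach[wh' lt_p'] /= e1; rewrite !size_rcons => -[e2].
rewrite !follow_attach => -[f1 H] [f2 H'].
have hh := IH h' wh' e1 e2 f1 f2; rewrite -{}hh in H' lt_p' *.
have [|ne] := eqVneq (clock h b p) (clock h b' p').
  by move=> /(clock_inj wh lt_p lt_p')[-> ->].
have := H _ (clock_active b' lt_p'); rewrite eq_sym ne => /(_ isT) lt1.
have := H' _ (clock_active b lt_p); rewrite ne => /(_ isT) lt2.
by have := lt_trans lt1 lt2; rewrite ltxx.
Qed.

Lemma wf_trunc (h : rtree K) k : wf_tree h -> wf_tree (history_trunc h k).
Proof.
elim/rtree_ind: h => [x|h b p IH]; first by rewrite /history_trunc; case: k.
move=> wa; have [wh _] := (wf_attach _ _ _).1 wa.
case: (leqP k (size h.2)) => [le_k|lt_k].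
  by rewrite history_trunc_attach //; exact: IH.
rewrite /history_trunc take_oversize; last by rewrite /= size_rcons.
by rewrite -surjective_pairing.
Qed.

(** Otherwise the first births of [h'] would be exactly those of [h], and the next event would be
    both a birth and the observation. *)
Lemma stop_size_le h h' w : wf_tree h -> wf_tree h' -> h.1 = h'.1 ->
  stop h w -> follow h' w -> (size h'.2 <= size h.2)%N.
Proof.
move=> wh wh' e1 [fw stop_w] fw'; rewrite leqNgt; apply/negP => lt_s.
pose g := history_trunc h' (size h.2).
have [[b p] e] : exists e, history_trunc h' (size h.2).+1 = attach g e.1 e.2.
  exists (nth (h.1, 0%N) h'.2 (size h.2)).
  by rewrite /history_trunc /attach /= (take_nth (h.1, 0%N)) // -surjective_pairing.
have gh : h = g.
  apply: (follow_inj (w := w)) => //; first exact: wf_trunc.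
    by rewrite /g /history_trunc /= size_take lt_s.
  exact: follow_trunc.
have := follow_trunc (size h.2).+1 fw'; rewrite e follow_attach -gh /= => -[_ H].
have wa := @wf_trunc h' (size h.2).+1 wh'; rewrite e -gh /= in wa.
have [_ lt_p] := (wf_attach _ _ _).1 wa.
have lt1 := H None (mem_head _ _) isT.
have lt2 := stop_w _ (clock_active b lt_p) isT.
by have := lt_trans lt1 lt2; rewrite ltxx.
Qed.

Lemma stop_disjoint h h' : wf_tree h -> wf_tree h' -> h.1 = h'.1 -> h != h' ->
  stop h `&` stop h' = set0.
Proof.
move=> wh wh' e1 ne; apply/seteqP; split => w // [sw sw'].
case/eqP: ne; apply: (follow_inj (w := w)) => //; last 2 first.
- by case: sw.
- by case: sw'.
apply/anti_leq/andP; split.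
  by apply: (stop_size_le (w := w)) => //; case: sw.
by apply: (stop_size_le (w := w)) => //; case: sw'.
Qed.

End Follow.

Lemma word_root K (h : rtree K) : word h 0 = [::].
Proof. by elim/rtree_ind: h => // h b p IH; rewrite word_attach_lt. Qed.

Section Semantics.
Context (R : realType) (K : nat) d (T : measurableType d).
Variable X : option (clock_idx K) -> T -> R.
Variables (a : 'I_K) (w : T).
Hypothesis X_gt0 : forall i, 0 < X i w.

Let clk (i : clock_idx K) : R := X (Some i) w.
Let tau : R := X None w.

Lemma waiting_time_gt0 u x k : 0 < waiting_time clk u x k.
Proof. exact: X_gt0. Qed.

Lemma next_child_eq u x k b :
  (forall c, c != b -> clk (u, x, k, b) < clk (u, x, k, c)) ->
  next_child clk u x k = b.
Proof.
move=> H; rewrite /next_child; case: arg_minP => // i _ min_i.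
have [//|ib] := eqVneq i b.
by have := lt_le_trans (H i ib) (min_i b isT); rewrite ltxx.
Qed.

Lemma birth_time_cons k u : birth_time a clk (k :: u) =
  birth_time a clk u + \sum_(j < k.+1) waiting_time clk u (bp_type a clk u) j.
Proof. by []. Qed.

Lemma birth_time_parent_le k u :
  birth_time a clk u <= birth_time a clk (k :: u).
Proof.
rewrite birth_time_cons lerDl sumr_ge0 // => j _.
exact/ltW/waiting_time_gt0.
Qed.

Definition last_birth : rtree K -> R :=
  rtree_fold (fun _ => 0) (fun h b p t => t + residual X h (clock h b p) w).

Lemma last_birth_attach h b p : last_birth (attach h b p) =
  last_birth h + residual X h (clock h b p) w.
Proof. by rewrite /last_birth rtree_fold_attach. Qed.

(* Time of the last event in the life of vertex [v]: its last child, or its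
   own birth. *)
Definition last_event (h : rtree K) (v : nat) : R :=
  birth_time a clk (word h v) +
  \sum_(j < nchildren h v) waiting_time clk (word h v) (vtype h v) j.

(** Races measure time from the last birth in the whole population, while [birth_time] adds waiting
    times along a line of descent; the invariant translates one into the other. Its last clause,
    that clocks not yet started keep their initial values, is what the clocks set running by a birth
    need. *)
Lemma follow_semantics h : wf_tree h -> h.1 = a -> follow X h w ->
  [/\ forall i, i \in active h -> 0 < residual X h i w,
      forall v, (v < order h)%N -> bp_type a clk (word h v) = vtype h v,
      forall v, (v < order h)%N -> birth_time a clk (word h v) <= last_birth h,
      residual X h None w = tau - last_birth h &
      (forall v b, (v < order h)%N ->
        residual X h (clock h b v) w = last_event h v + X (clock h b v) w - last_birth h) /\
      (forall u x k b, k :: u \notin words h -> Some (u, x, k, b) \notin active h ->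
        residual X h (Some (u, x, k, b)) w = clk (u, x, k, b))].
Proof.
move=> wh; elim/wf_tree_ind: h / wh => [x|h b p wh lt_p IH].
  move=> /= <- _; rewrite /residual /last_birth !rtree_fold_single.
  split=> //=.
  - by move=> v; rewrite order_single ltnS leqn0 => /eqP ->.
  - by move=> v; rewrite order_single ltnS leqn0 => /eqP ->.
  - by rewrite subr0.
  split=> // v c; rewrite order_single ltnS leqn0 => /eqP ->.
  by rewrite /last_event /= big_ord0 !addr0 add0r subr0.
rewrite follow_attach => /= ha [fw win].
have wa : wf_tree (attach h b p) by apply/wf_attach.
have [pos types births rtau [racti rfresh]] := IH ha fw.
set j := clock h b p in win; have j_act : j \in active h by exact: clock_active.
have Zj0 := pos j j_act.
have new_word : nchildren h p :: word h p \notin words h.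
  by rewrite child_word // ltnn.
have typ : bp_type a clk (word h p) = vtype h p by exact: types.
(* The competing clocks of [p] all started at the same [last_event], so their residuals are ordered
   as their values. *)
have nextb : next_child clk (word h p) (vtype h p) (nchildren h p) = b.
  apply: next_child_eq => c cb.
  have ne : clock h c p != j.
    by apply/eqP => /(clock_inj wh lt_p lt_p)[e _]; rewrite e eqxx in cb.
  have := win _ (clock_active c lt_p) ne; rewrite /j !racti //.
  by rewrite ltrD2r ltrD2l.
have wtp : waiting_time clk (word h p) (vtype h p) (nchildren h p) = X j w.
  by rewrite /waiting_time nextb.
have lastE : last_birth (attach h b p) = last_event h p + X j w.
  by rewrite last_birth_attach racti // -/j addrCA subrr addr0.
have birth_new : birth_time a clk (nchildren h p :: word h p) =
    last_birth (attach h b p).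
  by rewrite birth_time_cons typ big_ord_recr /= wtp lastE addrA.
have nch_new : nchildren h (order h) = 0%N by exact: nchildren_ge.
have keep v c : (v < order h)%N -> v != p ->
    clock (attach h b p) c v = clock h c v.
  move=> lt_v vp; rewrite /clock word_attach_lt // vtype_attach_lt //.
  by rewrite nchildren_attach eq_sym (negbTE vp) addn0.
have res_lt v c : (v < order h)%N -> v != p ->
    residual X (attach h b p) (clock (attach h b p) c v) w =
    residual X h (clock h c v) w - residual X h j w.
  by move=> lt_v vp; rewrite keep // residual_attach clock_active.
(* These clocks carry the rank after that of the new child; none was running before, so each starts
   with its full value. *)
have res_p c : residual X (attach h b p) (clock (attach h b p) c p) w =
    X (clock (attach h b p) c p) w.
  have wp : (nchildren h p).+1 :: word h p \notin words h.
    by rewrite child_word // ltnNge leqnSn.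
  rewrite /clock word_attach_lt // vtype_attach_lt // nchildren_attach eqxx addn1.
  rewrite residual_attach; case: ifPn => [/mem_active[//|[c' [v' [lt_v' [e _ ek]]]]]|na].
    move: ek; rewrite (word_inj wh lt_p lt_v' e); lia.
  exact: rfresh.
have res_new c : residual X (attach h b p) (clock (attach h b p) c (order h)) w =
    X (clock (attach h b p) c (order h)) w.
  rewrite /clock word_attach_new vtype_attach_new nchildren_attach nch_new.
  rewrite ltn_eqF // addn0 residual_attach.
  case: ifPn => [/mem_active[//|[c' [v' [lt_v' [e _ _ _]]]]]|na].
    by move: new_word; rewrite e mem_word.
  apply: rfresh => //; apply: contra new_word; exact: child_word_closed.
have res_None : residual X (attach h b p) None w =
    residual X h None w - residual X h j w by rewrite residual_attach.
have last_event_lt v : (v < order h)%N -> v != p ->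
    last_event (attach h b p) v = last_event h v.
  move=> lt_v vp; rewrite /last_event word_attach_lt // vtype_attach_lt //.
  by rewrite nchildren_attach eq_sym (negbTE vp) addn0.
have last_event_p : last_event (attach h b p) p = last_birth (attach h b p).
  rewrite /last_event word_attach_lt // vtype_attach_lt // nchildren_attach.
  by rewrite eqxx addn1 big_ord_recr /= wtp lastE addrA.
have last_event_new : last_event (attach h b p) (order h) = last_birth (attach h b p).
  rewrite /last_event word_attach_new nchildren_attach nch_new.
  by rewrite ltn_eqF // big_ord0 addr0.
split.
- move=> i /mem_active[->|[c [v [+ ->]]]].
    by rewrite res_None subr_gt0; apply: win; rewrite ?mem_head.
  rewrite order_attach ltnS leq_eqVlt => /predU1P[->|lt_v].
    by rewrite res_new.
  have [->|vp] := eqVneq v p; first by rewrite res_p.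
  rewrite res_lt // subr_gt0; apply: win; first exact: clock_active.
  by apply: contraNneq vp => /(clock_inj wh lt_v lt_p)[_ ->].
- move=> v; rewrite order_attach ltnS leq_eqVlt => /predU1P[->|lt_v].
    by rewrite word_attach_new vtype_attach_new /= typ.
  by rewrite word_attach_lt // vtype_attach_lt // types.
- move=> v; rewrite order_attach ltnS leq_eqVlt => /predU1P[->|lt_v].
    by rewrite word_attach_new birth_new.
  rewrite word_attach_lt // last_birth_attach (le_trans (births v lt_v)) //.
  by rewrite lerDl ltW.
- by rewrite res_None rtau last_birth_attach opprD addrA.
split.
- move=> v c; rewrite order_attach ltnS leq_eqVlt => /predU1P[->|lt_v].
    by rewrite res_new last_event_new addrAC subrr add0r.
  have [->|vp] := eqVneq v p; first by rewrite res_p last_event_p addrAC subrr add0r.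
  rewrite res_lt // racti // last_event_lt // keep // last_birth_attach -/j.
  by rewrite opprD addrA.
move=> u x k c; rewrite words_attach mem_rcons inE negb_or => /andP[ku1 ku2] na.
have na' : Some (u, x, k, c) \notin active h.
  apply/negP => /mem_active[//|[c' [v [lt_v e]]]].
  have [vp|vp] := eqVneq v p.
    by case: e ku1 => -> _ -> _; rewrite vp eqxx.
  move/negP: na; apply; rewrite e -keep //; apply: clock_active.
  by rewrite order_attach ltnW.
by rewrite residual_attach (negbTE na'); exact: rfresh.
Qed.

(** A word outside [h] either has its parent outside [h], which by induction is born after the
    observation, or is a further child of a vertex of [h]; its birth then comes no earlier than the
    ring of an active clock, which loses to the observation time. *)
Lemma stop_BP h : wf_tree h -> h.1 = a -> stop X h w ->
  BP a clk tau = [set u | u \in words h].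
Proof.
move=> wh ha [fw sw].
have [pos types births rtau [racti rfresh]] := follow_semantics wh ha fw.
apply/seteqP; split => u /=; last first.
  move=> /mem_wordsP[v lt_v ->]; rewrite /BP /=; apply: le_trans (births v lt_v) _.
  by have := pos None (mem_head _ _); rewrite rtau subr_gt0 => /ltW.
apply: contraPT => Hu; apply/negP; rewrite /BP /= -ltNge.
elim: u Hu => [|k u IH] Hu.
  by move: Hu; rewrite -(word_root h) mem_word.
have [/mem_wordsP[v lt_v uv]|/IH lt_tau] := boolP (u \in words h); last first.
  exact: lt_le_trans lt_tau (birth_time_parent_le _ _).
move: Hu; rewrite uv child_word // -leqNgt => le_k.
rewrite birth_time_cons types //.
set c := next_child clk (word h v) (vtype h v) (nchildren h v).
have lt_c := sw _ (clock_active c lt_v) isT.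
rewrite rtau racti // ltrD2r in lt_c.
apply: lt_le_trans lt_c _.
rewrite /last_event -addrA lerD2l.
have -> : X (clock h c v) w = waiting_time clk (word h v) (vtype h v) (nchildren h v) by [].
have -> : \sum_(j < nchildren h v) waiting_time clk (word h v) (vtype h v) j +
    waiting_time clk (word h v) (vtype h v) (nchildren h v) =
    \sum_(j < (nchildren h v).+1) waiting_time clk (word h v) (vtype h v) j.
  by rewrite big_ord_recr.
rewrite -!(big_mkord xpredT (fun j => waiting_time clk (word h v) (vtype h v) j)).
rewrite [leRHS](big_cat_nat (leq0n (nchildren h v).+1)) ?ltnS //= lerDl.
by apply: sumr_ge0 => i _; exact/ltW/waiting_time_gt0.
Qed.

Lemma stop_generation_size h l : wf_tree h -> h.1 = a -> stop X h w ->
  generation_size a clk tau l = (npaths h l 0)%:R%:E.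
Proof.
move=> wh ha sw; rewrite /generation_size (stop_BP wh ha sw).
pose s := [seq u <- words h | size u == l].
have us : uniq s by rewrite filter_uniq // (words_spec wh).1.
have -> : [set u | u \in words h] `&` [set u | size u = l] = [set` s].
  apply/seteqP; split => u /=; rewrite mem_filter.
    by move=> [-> /= ->]; rewrite eqxx.
  by move=> /andP[/eqP].
rewrite esum_fset //; last exact: finite_seq.
rewrite -fsbig_seq // sumEFin; congr EFin.
rewrite big_const_seq count_predT iter_addr_0 /s size_filter.
congr (_%:R); rewrite /npaths -sum1_card -sum1_count.
rewrite (big_nth [::]) size_words big_mkord; apply: eq_bigl => v.
by rewrite !unfold_in /= -size_word.
Qed.

Lemma stop_pagerank c h : wf_tree h -> h.1 = a -> stop X h w ->
  bp_pagerank a clk c tau = tree_pagerank c h 0.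
Proof.
move=> wh ha sw; rewrite /bp_pagerank /tree_pagerank; congr pagerank.
by apply/funext => l; exact: stop_generation_size.
Qed.

End Semantics.

Lemma tree_pagerank_fringe (R : realType) (K : nat) (c : R) (g : rtree K) v :
  wf_tree g -> (v < order g)%N ->
  tree_pagerank c (fringe g v) 0 = tree_pagerank c g v.
Proof.
move=> wg lt_v; rewrite /tree_pagerank; congr pagerank; apply/funext => l.
by rewrite npaths_fringe.
Qed.

Lemma tree_pagerank_fin_num (R : realType) (K : nat) (c : R) (h : rtree K) v :
  0 <= c -> wf_tree h -> tree_pagerank c h v \is a fin_num.
Proof.
move=> c_ge0 wh; rewrite /tree_pagerank /pagerank.
rewrite (nneseries_split 1 (order h)); last first.
  by move=> k _; rewrite -EFinM lee_fin mulr_ge0 ?exprn_ge0 ?ler0n.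
rewrite [X in (_ + (_ + X))%E]eseries0 => [|k le_k _].
  under eq_bigr do rewrite -EFinM.
  by rewrite sumEFin.
by rewrite npaths_ge_order ?mule0 // ltnW.
Qed.

(** * The laws of the exponential clocks *)

Section Exponential.
Context (R : realType) d (T : measurableType d) (P : probability T R).

Lemma exponential_survival (rate : R) (X : {RV P >-> R}) (t : R) : 0 < rate ->
  exponentially_distributed rate X -> 0 <= t ->
  pr P [set w | t < X w] = expR (- (rate * t)).
Proof.
move=> rate_gt0 HX.
have mX A : measurable A -> measurable (X @^-1` A).
  by move=> mA; rewrite -[_ @^-1` _]setTI; exact: measurable_funP.
have neg : pr P (X @^-1` `]-oo, 0[) = 0.
  rewrite /pr -[P _]/(distribution P X _) HX // /exponential_prob.
  rewrite integral0_eq // => x /=; rewrite in_itv /= => x0.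
  by rewrite lt0_exponential_pdf.
have pos (x : R) : 0 < x -> pr P (X @^-1` `]x, +oo[) = expR (- (rate * x)).
  move=> x0.
  have e : pr P (X @^-1` `[0, x]) = 1 - expR (- (rate * x)).
    rewrite /pr -[P _]/(distribution P X _) HX // exponential_prob_itv0c //.
    by rewrite mulNr.
  have mneg := mX `]-oo, 0[%classic (measurable_itv _).
  have mcc := mX `[0, x]%classic (measurable_itv _).
  have := prD P measurableT mneg (@subsetT _ _); rewrite prT neg subr0.
  rewrite (prID P (measurableD measurableT mneg) mcc).
  have -> : (setT `\` X @^-1` `]-oo, 0[) `&` X @^-1` `[0, x] = X @^-1` `[0, x].
    apply/seteqP; split => w /=; rewrite !in_itv /=; first by case.
    by move=> /andP[w0 wx]; rewrite w0 wx; split=> //; split=> //; rewrite ltNge w0.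
  have -> : (setT `\` X @^-1` `]-oo, 0[) `\` X @^-1` `[0, x] = X @^-1` `]x, +oo[.
    apply/seteqP; split => w /=; rewrite !in_itv /= andbT.
      by move=> [[_ /negP]]; rewrite -leNgt => -> /= /negP; rewrite -ltNge.
    move=> xw; split; last by rewrite [_ <= x]leNgt xw andbF.
    by split=> //; rewrite ltNge (ltW (lt_trans x0 xw)).
  rewrite e; lra.
rewrite le_eqVlt => /predU1P[<-|t0]; last first.
  by rewrite -pos //; congr pr; apply/seteqP; split => w /=; rewrite in_itv /= andbT.
have E x : [set w | x < X w] = X @^-1` `]x, +oo[.
  by apply/seteqP; split => w /=; rewrite in_itv /= andbT.
rewrite E mulr0 oppr0 expR0; apply/le_anti/andP; split.
  by apply: pr_le1; exact: mX.
set p := pr _ _; rewrite leNgt; apply/negP => p1.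
(* If the probability [p] of [X > 0] were below 1, then for this [x] the probability of [X > x]
   would be at least [1 - rate * x = 1 - (1 - p) / 2 > p]. *)
pose x := (1 - p) / (2 * rate).
have x0 : 0 < x by rewrite divr_gt0 ?subr_gt0 // mulr_gt0.
have : pr P (X @^-1` `]x, +oo[) <= p.
  apply: pr_le; [exact: mX|exact: mX|] => w /=; rewrite !in_itv /= !andbT.
  exact: lt_trans.
rewrite pos //.
have := expR_ge1Dx (- (rate * x)).
have -> : rate * x = (1 - p) / 2 by rewrite /x; field; rewrite gt_eqF.
lra.
Qed.

Lemma independent_survival (I : choiceType) (rate : I -> R) (X : I -> {RV P >-> R})
    (s : seq I) (t : I -> R) :
  (forall i, 0 < rate i) -> (forall i, exponentially_distributed (rate i) (X i)) ->
  mutually_independent X -> uniq s -> (forall i, 0 <= t i) ->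
  pr P [set w | forall i, i \in s -> t i < X i w] =
  \prod_(i <- s) expR (- (rate i * t i)).
Proof.
move=> rate_gt0 HX ind us t_ge0.
have mX i : measurable (X i @^-1` `]t i, +oo[).
  by rewrite -[_ @^-1` _]setTI; exact: measurable_funP.
have -> : [set w | forall i, i \in s -> t i < X i w] =
    \big[setI/setT]_(i <- s) (X i @^-1` `]t i, +oo[).
  rewrite -bigcap_seq; apply/seteqP; split => w /= H i /H; rewrite /preimage /=;
    by rewrite in_itv /= andbT.
rewrite /pr ind //.
have -> : (\prod_(i <- s) P (X i @^-1` `]t i, +oo[))%E =
    (\prod_(i <- s) expR (- (rate i * t i)))%:E.
  rewrite -prodEFin; apply: eq_bigr => i _; rewrite prE //; congr EFin.
  rewrite -(exponential_survival (rate_gt0 i) (HX i) (t_ge0 i)); congr pr.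
  by apply/seteqP; split => w /=; rewrite in_itv /= andbT.
by [].
Qed.

End Exponential.

Section Alarms.
Context (R : realType) (K : nat) d (T : measurableType d) (P : probability T R).
Variable ph : 'I_K -> 'I_K -> R.
Hypothesis ph_gt0 : forall x b, 0 < ph x b.
Variables (clk : clock_idx K -> {RV P >-> R}) (tau : {RV P >-> R}).
Hypothesis clk_tau : bp_clocks ph clk tau.

Definition alarm (o : option (clock_idx K)) : {RV P >-> R} :=
  if o is Some i then clk i else tau.

Lemma alarm_exponential o : exponentially_distributed (clock_rate ph o) (alarm o).
Proof.
have [clk_exp tau_exp _] := clk_tau.
by case: o => [[[[u x] k] b]|]; [exact: clk_exp|exact: tau_exp].
Qed.

Lemma alarm_exp_family :
  exp_family P (clock_rate ph) setT (fun o w => alarm o w) (fun _ => True) 1.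
Proof.
split=> // s t us _ t_ge0.
rewrite setTI mul1r; apply: (independent_survival (X := alarm)) => //.
- exact: clock_rate_gt0.
- exact: alarm_exponential.
- by case: clk_tau.
Qed.

Lemma alarm_gt0_ae : {ae P, forall w, forall o, 0 < alarm o w}.
Proof.
apply: ae_forall_countable => o.
have m : measurable [set w | 0 < alarm o w].
  by apply: measurable_lt; [exact: measurable_cst|exact: measurable_funP].
have e : P (~` [set w | 0 < alarm o w]) = 0%E.
  rewrite prE; last exact: measurableC.
  rewrite -setTD prD // prT.
  rewrite (exponential_survival (clock_rate_gt0 ph_gt0 o) (@alarm_exponential o)) //.
  by rewrite mulr0 oppr0 expR0 subrr.
by exists (~` [set w | 0 < alarm o w]); split => //; exact: measurableC.
Qed.

End Alarms.

(** * Measurability of the score of the branching process *)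

Lemma esum_countable (R : realType) (I : countType) (a : I -> \bar R) (x : I) :
  (forall i, (0 <= a i)%E) ->
  (\esum_(i in [set: I]) a i =
   \sum_(0 <= n <oo | (pickle_inv n : option I)) a (odflt x (pickle_inv n)))%E.
Proof.
move=> a0.
rewrite -(@esum_pred_image R I a (fun n => odflt x (pickle_inv n))
  (fun n => pickle_inv n : option I)) => [|n _|m n]; last 2 first.
- exact: a0.
- rewrite !inE /=; have := pickle_invK (T := I) m; have := pickle_invK (T := I) n.
  case: (pickle_inv m : option I) => [i|] //=.
  by case: (pickle_inv n : option I) => [j|] //= <- <- _ _ ->.
congr (\esum_(i in _) _); apply/seteqP; split => // i _ /=.
by exists (pickle i); rewrite /= pickleK_inv.
Qed.

Section FiniteSelection.
Context (R : realType) d (T : measurableType d).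

Lemma measurable_finite_fun (I J : finType) (f : I -> T -> bool)
    (psi : {ffun I -> bool} -> J) (y : J) :
  (forall i, measurable [set w | f i w]) ->
  measurable [set w | psi [ffun i => f i w] = y].
Proof.
move=> mf.
have -> : [set w | psi [ffun i => f i w] = y] =
    \bigcup_(m in [set m | psi m = y]) [set w | forall i, i \in enum I -> f i w = m i].
  apply/seteqP; split => w /=.
    by move=> H; exists [ffun i => f i w] => // i _; rewrite ffunE.
  move=> [m /= <- H]; congr psi; apply/ffunP => i; rewrite ffunE H //.
  by rewrite mem_enum.
apply: fin_bigcup_measurable; first exact: finite_finset.
move=> m _; apply: measurable_forall_seq => i.
case: (m i); first exact: mf.
have -> : (fun w => f i w = false) = ~` [set w | f i w].
  by apply/seteqP; split => w /=; [move=> ->|move=> /negP/negbTE].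
exact: measurableC.
Qed.

Lemma measurable_selection (J : finType) (S : T -> J) (F : J -> T -> R) :
  (forall j, measurable [set w | S w = j]) ->
  (forall j, measurable_fun setT (F j)) ->
  measurable_fun setT (fun w => F (S w) w).
Proof.
move=> mS mF.
have -> : (fun w => F (S w) w) =
    (fun w => \sum_(j <- enum J) if S w == j then F j w else 0).
  apply/funext => w; rewrite big_enum (bigD1 (S w)) //= eqxx big1 ?addr0 // => j.
  by rewrite eq_sym => /negbTE ->.
apply: measurable_sum => j; apply: measurable_fun_ifT => //.
apply: (measurable_fun_bool true); rewrite setTI.
rewrite (_ : _ @^-1` _ = [set w | S w = j]) //.
by apply/seteqP; split => w /= /eqP.
Qed.

End FiniteSelection.

Section BranchingMeasurable.
Context (R : realType) (K : nat) d (T : measurableType d).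
Variables (clk : clock_idx K -> T -> R) (tau : T -> R) (a : 'I_K).
Hypothesis mclk : forall i, measurable_fun setT (clk i).
Hypothesis mtau : measurable_fun setT tau.
Let clk_ w i := clk i w.

Lemma measurable_next_child u x k b :
  measurable [set w | next_child (clk_ w) u x k = b].
Proof.
pose f (p : 'I_K * 'I_K) w := clk (u, x, k, p.1) w <= clk (u, x, k, p.2) w.
(* The choice of the minimum depends only on the finite table of pairwise comparisons; the default
   [x] is the one inside [arg_min]. *)
pose psi (m : {ffun 'I_K * 'I_K -> bool}) : 'I_K :=
  odflt x [pick i | [forall j, m (i, j)]].
have -> : [set w | next_child (clk_ w) u x k = b] =
    [set w | psi [ffun p => f p w] = b].
  apply/seteqP; split => w /= <-; rewrite /next_child /Order.arg_min /extremum /psi;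
  congr odflt; apply: eq_pick => i /=; apply/eq_forallb => j;
  by rewrite ffunE.
apply: (measurable_finite_fun (f := f)) => -[i j].
have mf := measurable_fun_ler (mclk (u, x, k, i)) (mclk (u, x, k, j)).
have := mf measurableT [set true] I.
by rewrite setTI.
Qed.

Lemma measurable_bp_type u b : measurable [set w | bp_type a (clk_ w) u = b].
Proof.
elim: u b => [|k u IH] b /=.
  have [->|ab] := eqVneq a b.
    by rewrite (_ : [set w | _] = setT) //; apply/seteqP; split.
  rewrite (_ : [set w | _] = set0) //; apply/seteqP; split => w //= e.
  by rewrite e eqxx in ab.
have -> : [set w | next_child (clk_ w) u (bp_type a (clk_ w) u) k = b] =
    \bigcup_(x in [set: 'I_K]) ([set w | bp_type a (clk_ w) u = x] `&`
      [set w | next_child (clk_ w) u x k = b]).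
  apply/seteqP; split => w /=; first by move=> H; exists (bp_type a (clk_ w) u).
  by move=> [x _ [/= <-]].
apply: fin_bigcup_measurable; first exact: finite_finset.
by move=> x _; apply: measurableI => //; exact: measurable_next_child.
Qed.

Lemma measurable_birth_time u :
  measurable_fun setT (fun w => birth_time a (clk_ w) u).
Proof.
elim: u => [|k u IH] /=; first exact: measurable_cst.
apply: measurable_funD => //; apply: measurable_sum => j.
apply: (measurable_selection (S := fun w => bp_type a (clk_ w) u)
  (F := fun x w => waiting_time (clk_ w) u x j)).
  exact: measurable_bp_type.
move=> x; apply: (measurable_selection (S := fun w => next_child (clk_ w) u x j)
  (F := fun b w => clk (u, x, nat_of_ord j, b) w)) => // b.
exact: measurable_next_child.
Qed.

Lemma measurable_generation_size l :
  measurable_fun setT (fun w => generation_size a (clk_ w) (tau w) l).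
Proof.
pose f u w : \bar R := if birth_time a (clk_ w) u <= tau w then
  (if size u == l then 1%E else 0%E) else 0%E.
have f0 u w : (0 <= f u w)%E by rewrite /f; case: ifP => // _; case: ifP.
have -> : (fun w => generation_size a (clk_ w) (tau w) l) =
    (fun w => \sum_(0 <= n <oo | (pickle_inv n : option (seq nat)))
      f (odflt [::] (pickle_inv n)) w)%E.
  apply/funext => w; rewrite -(@esum_countable _ _ (f ^~ w)) //.
  rewrite /generation_size esum_mkcond; apply: eq_esum => u _; rewrite /f.
  case: (boolP (u \in _)) => [|nu].
    by rewrite inE => -[/= -> /= ->]; rewrite eqxx.
  case: ifP => // b1; case: eqP => // b2; case/negP: nu; rewrite inE.
  by split.
apply: ge0_emeasurable_sum => // n _.
apply: measurable_fun_ifT.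
- exact: measurable_fun_ler (measurable_birth_time _) mtau.
- exact: measurable_cst.
- exact: measurable_cst.
Qed.

Lemma measurable_bp_pagerank c : 0 <= c ->
  measurable_fun setT (fun w => bp_pagerank a (clk_ w) c (tau w)).
Proof.
move=> c0; apply: measurable_funeM; apply: emeasurable_funD.
  exact: measurable_cst.
under eq_fun do rewrite ereal_series.
apply: ge0_emeasurable_sum => [l w _ _|l _].
  by rewrite mule_ge0 ?lee_fin ?exprn_ge0 // esum_ge0.
by apply: measurable_funeM; exact: measurable_generation_size.
Qed.

End BranchingMeasurable.

(** * Non-explosion of the branching process *)

Section Levels.
Variable K : nat.
Implicit Types (h : rtree K) (b : 'I_K) (p m : nat).

Definition births h : seq ('I_K * nat) :=
  [seq (b, p) | b <- enum 'I_K, p <- iota 0 (order h)].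

(* Histories of [m] births from a root of type [a]. *)
Fixpoint level (a : 'I_K) m : seq (rtree K) :=
  if m is m'.+1 then [seq attach h e.1 e.2 | h <- level a m', e <- births h]
  else [:: (a, [::])].

Lemma births_uniq h : uniq (births h).
Proof.
rewrite /births allpairs_uniq ?enum_uniq ?iota_uniq //.
by move=> [b p] [b' p'] _ _ [-> ->].
Qed.

Lemma level_uniq a m : uniq (level a m).
Proof.
elim: m => [//|m IH]; rewrite [level _ _]/=.
apply: allpairs_uniq_dep => // [h _|]; first exact: births_uniq.
move=> [h [b p]] [h' [b' p']] _ _ /= /attach_inj[e1 e2 e3].
by rewrite e1 e2 e3.
Qed.

Lemma levelP a m h : h \in level a m -> [/\ wf_tree h, h.1 = a & size h.2 = m].
Proof.
elim: m h => [|m IH] h.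
  by rewrite inE => /eqP ->; split=> // v p; case: v => [|[|v]].
rewrite [level _ _]/= => /allpairsPdep[g [[b p] [/IH[wg ga gm] + ->]]].
move=> /allpairsP[[b' p'] [_ + [-> ->]]] /=; rewrite (mem_iota 0 (order g)) => lt_p.
by split=> //; [apply/wf_attach|rewrite size_rcons gm].
Qed.

Lemma sum_nchildren_le h N : (\sum_(p < N) nchildren h p <= size h.2)%N.
Proof.
rewrite /nchildren; elim: h.2 => [|e s IH].
  by rewrite big1.
rewrite [size _]/= -add1n; under eq_bigr do rewrite [count _ _]/=.
rewrite big_split /= leq_add //; apply: (@leq_trans (\sum_(p < N | p == e.2 :> nat) 1)).
  rewrite [leqRHS]big_mkcond; apply: leq_sum => p _.
  by rewrite eq_sym; case: eqP.
rewrite sum1_card; apply/card_le1_eqP => p q.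
by rewrite !unfold_in => /eqnP hp /eqnP hq; apply/val_inj; rewrite /= hp hq.
Qed.

Section Mass.
Context (R : realType) (ph : 'I_K -> 'I_K -> R).
Hypothesis ph_gt0 : forall x b, 0 < ph x b.
Variable a : 'I_K.

Lemma path_weight_attach h b p : path_weight ph (attach h b p) =
  path_weight ph h * (birth_rate ph h b p / (2 + total_rate ph h)).
Proof. by rewrite /path_weight rtree_fold_attach. Qed.

Lemma path_weight_ge0 h : 0 <= path_weight ph h.
Proof.
elim/rtree_ind: h => [x|h b p IH]; first by rewrite /path_weight rtree_fold_single.
rewrite path_weight_attach mulr_ge0 // divr_ge0 ?(ltW (birth_rate_gt0 _ _ _ _)) //.
by rewrite addr_ge0 // total_rate_ge0.
Qed.

(** After [h], either the observation time or one of the birth clocks rings next, and the chances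
    add up to 1. *)
Lemma path_weight_split h : path_weight ph h =
  stop_weight ph h + \sum_(e <- births h) path_weight ph (attach h e.1 e.2).
Proof.
rewrite /births big_allpairs_dep /= big_enum /=.
under eq_bigr do under eq_bigr do rewrite path_weight_attach.
under eq_bigr do rewrite -mulr_sumr -mulr_suml.
rewrite -mulr_sumr -mulr_suml /stop_weight -mulrDr.
have -> : \sum_b \sum_(p <- iota 0 (order h)) birth_rate ph h b p = total_rate ph h.
  apply: eq_bigr => b _; rewrite -(big_mkord xpredT (birth_rate ph h b)).
  by rewrite /index_iota subn0.
have := total_rate_ge0 ph_gt0 h; set t := total_rate ph h => t0.
by field; rewrite gt_eqF // ltr_wpDr.
Qed.

Let M : R := \sum_x \sum_b ph x b.

Lemma total_rate_le h : total_rate ph h <= M * (2 * (size h.2).+1%:R).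
Proof.
rewrite /total_rate exchange_big /=.
(* The numbers of children plus one sum to at most edges plus vertices, that is
   [2 * size h.2 + 1]. *)
apply: (@le_trans _ _ (\sum_(p < order h) M * (nchildren h p).+1%:R)).
  apply: ler_sum => p _; rewrite /birth_rate -mulr_suml ler_wpM2r //.
    rewrite [leRHS](bigD1 (vtype h p)) //= lerDl.
  by apply: sumr_ge0 => x _; apply: sumr_ge0 => b _; exact: ltW.
rewrite -mulr_sumr ler_wpM2l //.
  by apply: sumr_ge0 => x _; apply: sumr_ge0 => b _; exact: ltW.
rewrite -natr_sum -natrM ler_nat.
under eq_bigr do rewrite -addn1.
rewrite big_split /= sum1_card card_ord.
have := sum_nchildren_le h (order h).
set S := (X in (X <= size _)%N); rewrite -/S -[order h]/((size h.2).+1); lia.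
Qed.

Let W m := \sum_(h <- level a m) path_weight ph h.

Lemma level_weight m : W m.+1 = W m - \sum_(h <- level a m) stop_weight ph h.
Proof.
rewrite /W [level _ m.+1]/= big_allpairs_dep -sumrB; apply: eq_bigr => h _.
by rewrite [X in _ = X - _]path_weight_split addrAC subrr add0r.
Qed.

Lemma level_weight_contraction :
  exists2 c : R, 0 < c & forall m, W m.+1 <= W m * (1 - c / m.+1%:R).
Proof.
have M0 : 0 <= M by apply: sumr_ge0 => x _; apply: sumr_ge0 => b _; exact: ltW.
(* With [t <= 2 * M * n] and [n = m.+1 >= 1], stopping has chance [2 / (2 + t) >= 1 / (1 + M * n) >=
   1 / ((1 + M) * n)]. *)
exists (1 + M)^-1; first by rewrite invr_gt0 ltr_wpDr.
move=> m; rewrite level_weight mulrBr mulr1 lerD2l lerN2 /W mulr_suml.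
rewrite [leLHS]big_seq [leRHS]big_seq; apply: ler_sum => h /levelP[_ _ hm].
rewrite /stop_weight ler_wpM2l ?path_weight_ge0 //.
have := total_rate_le h; have := total_rate_ge0 ph_gt0 h; rewrite hm.
set t := total_rate ph h => t0 tM.
have m1 : 1 <= m.+1%:R :> R by rewrite ler1n.
set n : R := m.+1%:R in tM m1 *.
have n0 : 0 < n by apply: lt_le_trans m1.
rewrite -invfM -[leRHS]invrK lef_pV2 ?posrE ?mulr_gt0 ?invr_gt0 ?divr_gt0 //;
  rewrite ?ltr_wpDr //.
rewrite invf_div ler_pdivrMr //; nra.
Qed.

(* Non-explosion: the total rate grows at most linearly with the number of
   births, so the weight of the trees that are still growing is multiplied by at
   most [1 - c / m.+1] at the [m]-th birth. *)
Lemma stop_weight_exhausts (eps : R) : 0 < eps ->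
  exists s : seq (rtree K), [/\ uniq s, forall h, h \in s -> wf_tree h /\ h.1 = a
    & 1 - eps <= \sum_(h <- s) stop_weight ph h].
Proof.
move=> eps0; have [c c0 HW] := level_weight_contraction.
have [N HN] : exists N, forall n, (N <= n)%N -> W n <= eps.
  apply: (contraction_limsup_le0 (x := W) (e := fun=> 0) (N0 := 0%N) c0) => //.
    by move=> n _; rewrite mul0r addr0.
  exact: cvg_cst.
have {HN} := HN N (leqnn N).
have [s [us ws e]] : exists s : seq (rtree K), [/\ uniq s,
    forall h, h \in s -> [/\ wf_tree h, h.1 = a & (size h.2 < N)%N]
    & \sum_(h <- s) stop_weight ph h = 1 - W N].
  elim: N => [|N [s [us ws e]]].
    exists [::]; split=> //; rewrite big_nil /W /= big_seq1 /path_weight.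
    by rewrite rtree_fold_single subrr.
  exists (level a N ++ s); split.
  - rewrite cat_uniq level_uniq us andbT; apply/hasPn => h /ws[_ _ lt_h].
    by apply/negP => /levelP[_ _ hN]; rewrite hN ltnn in lt_h.
  - move=> h; rewrite mem_cat => /orP[/levelP[wh ha ->]|/ws[wh ha lt_h]].
      by split.
    by split=> //; exact: ltnW.
  - by rewrite big_cat /= e level_weight; lra.
move=> HN; exists s; split=> // [h /ws[]//|]; rewrite e; lra.
Qed.

End Mass.

End Levels.

(** * Squeezing the proportion of large scores between finite families of trees *)

Lemma cvgn_sum_seq (R : realType) (I : eqType) (s : seq I) (D : pred I)
    (u : I -> nat -> R) (l : I -> R) :
  (forall i, i \in s -> u i n @[n --> \oo] --> l i) ->
  (\sum_(i <- s | D i) u i n) @[n --> \oo] --> \sum_(i <- s | D i) l i.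
Proof.
move=> H; rewrite big_seq_cond big_mkcond /=.
under eq_fun do rewrite big_seq_cond big_mkcond /=.
apply: (cvgn_sum (u := fun i n => if (i \in s) && D i then u i n else 0)
  (l := fun i => if (i \in s) && D i then l i else 0)) => i.
case: (boolP (i \in s)) => [/H Hi|_] /=; last exact: cvg_cst.
by case: (D i) => //; exact: cvg_cst.
Qed.

Section Counting.
Context (R : realType) (K : nat).
Implicit Types (g h : rtree K) (B : seq (rtree K)) (D : pred (rtree K)).

Lemma sum_fringe_count B D g : uniq B ->
  \sum_(h <- B | D h) fringe_count R h g =
  \sum_(v < order g)
    [&& (0 < v)%N, fringe g v \in B & D (fringe g v)]%:R.
Proof.
move=> uB; rewrite exchange_big /=; apply: eq_bigr => v _.
elim: B uB => [_|h B IH /= /andP[hB uB]]; first by rewrite big_nil andbF.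
rewrite big_cons (IH uB) inE.
have [e|ne] := eqVneq (fringe g v) h.
  by rewrite e (negbTE hB) andbF andbT /=; case: (D h); rewrite ?addr0 ?andbF ?andbT.
by rewrite andbF add0r /=; case: (D h).
Qed.

Lemma type_count_network d (T : measurableType d) g0
    (ty : nat -> T -> 'I_K) (par : nat -> T -> nat) a n w :
  \sum_(v < order (network g0 ty par n w)) (vtype (network g0 ty par n w) v == a)%:R =
  \sum_(v < order g0) (vtype g0 v == a)%:R + \sum_(i < n) (ty i w == a)%:R :> R.
Proof.
elim: n => [|n IH]; first by rewrite big_ord0 addr0.
rewrite [X in _ = _ + X]big_ord_recr /= addrA -IH; set g := network _ _ _ _ _.
rewrite order_attach [LHS]big_ord_recr /= vtype_attach_new; congr (_ + _).
by apply: eq_bigr => v _; rewrite vtype_attach_lt.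
Qed.

Variables (c r : R) (a : 'I_K).
Let Q h : bool := (r%:E < tree_pagerank c h 0)%E.
Let count g : R :=
  \sum_(v < order g) ((vtype g v == a) && (r%:E < tree_pagerank c g v)%E)%:R.

Lemma pagerank_count_ge B g : wf_tree g -> uniq B -> (forall h, h \in B -> h.1 = a) ->
  \sum_(h <- B | Q h) fringe_count R h g <= count g.
Proof.
move=> wg uB Ba; rewrite sum_fringe_count //; apply: ler_sum => v _.
rewrite ler_nat /Q tree_pagerank_fringe //.
case: (boolP (fringe g v \in B)) => [/Ba /= ->|_]; last by rewrite andbF.
by rewrite eqxx /=; case: (0 < v)%N.
Qed.

(** A bound by the complement: non-root vertices of type [a] whose fringe tree lies in [B] and has a
    small score are discounted, while fringe trees outside [B], about which nothing is known, and
    the root stay in the count. *)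
Lemma pagerank_count_le B g : wf_tree g -> uniq B -> (forall h, h \in B -> h.1 = a) ->
  count g <= \sum_(v < order g) (vtype g v == a)%:R -
    \sum_(h <- B | ~~ Q h) fringe_count R h g.
Proof.
move=> wg uB Ba; rewrite (@sum_fringe_count B (fun h => ~~ Q h)) // lerBrDr -big_split /=.
apply: ler_sum => v _; rewrite -natrD ler_nat /Q tree_pagerank_fringe //.
case: (boolP (fringe g v \in B)) => [/Ba /= ->|_]; last first.
  by rewrite /= andbF addn0; case: (_ == _) => //; case: (_ < _)%E.
by rewrite eqxx /=; case: (_ < _)%E; case: (0 < v)%N.
Qed.

End Counting.

Section StopMass.
Context (R : realType) (K : nat) d (T : measurableType d) (P : probability T R).
Variable ph : 'I_K -> 'I_K -> R.
Hypothesis ph_gt0 : forall x b, 0 < ph x b.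
Variables (clk : clock_idx K -> {RV P >-> R}) (tau : {RV P >-> R}).
Hypothesis clk_tau : bp_clocks ph clk tau.
Variables (c : R) (a : 'I_K).
Let Rbp w := bp_pagerank a (fun i => clk i w) c (tau w).

(** The events [stop h] are disjoint and, off the null set where some clock is not positive, the
    score on [stop h] is that of the finite tree [h]; so their probabilities add up inside [A]. *)
Lemma stop_weight_sum_le (B : seq (rtree K)) (D : pred (rtree K)) (A : set T) :
  uniq B -> (forall h, h \in B -> wf_tree h /\ h.1 = a) -> measurable A ->
  (forall h w, h \in B -> D h -> Rbp w = tree_pagerank c h 0 -> A w) ->
  \sum_(h <- B | D h) stop_weight ph h <= pr P A.
Proof.
move=> uB wB mA HA.
have X_exp := alarm_exp_family ph_gt0 clk_tau.
have [Z [mZ PZ HZ]] := alarm_gt0_ae ph_gt0 clk_tau.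
pose X (o : option (clock_idx K)) w := alarm clk tau o w.
pose C h : set T := if (h \in B) && D h then stop X h else set0.
have mC h : measurable (C h).
  rewrite /C; case: andP => [[/wB[wh _] _]|_] //.
  exact: (measurable_stop ph_gt0 X_exp).
have dC h h' : h != h' -> C h `&` C h' = set0.
  move=> ne; rewrite /C; case: andP => [[/wB[wh ha] _]|_]; last by rewrite set0I.
  case: andP => [[/wB[wh' ha'] _]|_]; last by rewrite setI0.
  by apply: stop_disjoint => //; rewrite ha.
apply: le_trans (pr_disjoint_sum_le P uB mA mC dC).
rewrite big_seq_cond big_mkcond [leRHS]big_seq [leRHS]big_mkcond /=; apply: ler_sum => h _.
case hB : (h \in B) => //=; case Dh : (D h); last exact: pr_ge0.
have [wh ha] := wB _ hB.
rewrite -(pr_stop ph_gt0 X_exp wh) /C hB Dh /= -/X.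
have mS := measurable_stop ph_gt0 X_exp wh; rewrite -/X in mS *.
rewrite (prID P mS mZ) [X in X + _](_ : _ = 0) ?add0r.
  apply: pr_le; [exact: measurableD|exact: measurableI|].
  move=> w [sw nZ]; split=> //; apply: (HA h w hB Dh).
  have X0 o : 0 < X o w.
    by apply: contrapT => H; apply: nZ; apply: HZ => /(_ o).
  exact: (stop_pagerank X0 c wh ha sw).
apply/le_anti/andP; split; last exact: pr_ge0.
have -> : 0 = pr P Z by rewrite /pr PZ.
by apply: pr_le => //; exact: measurableI.
Qed.

Hypothesis c_ge0 : 0 <= c.

Lemma measurable_Rbp : measurable_fun setT Rbp.
Proof. exact: measurable_bp_pagerank. Qed.

(** Finite trees have finite scores, and by non-explosion finitely many histories carry probability
    arbitrarily close to 1; an infinite score with positive probability would leave them no room. *)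
Lemma bp_pagerank_fin_num_ae : {ae P, forall w, Rbp w \is a fin_num}.
Proof.
have := emeasurable_fin_num measurableT measurable_Rbp; rewrite setTI => mF.
have p1 : pr P [set w | Rbp w \is a fin_num] = 1.
  apply/le_anti/andP; split; first exact: pr_le1.
  rewrite leNgt; apply/negP => lt1; set p := pr _ _ in lt1.
  have [B [uB wB HB]] := stop_weight_exhausts ph_gt0 a (ltac:(lra) : 0 < (1 - p) / 2).
  suff : \sum_(h <- B) stop_weight ph h <= p by move: HB lt1; lra.
  apply: stop_weight_sum_le => // h w /wB[wh _] _ /= ->.
  exact: tree_pagerank_fin_num.
have e : P (~` [set w | Rbp w \is a fin_num]) = 0%E.
  rewrite prE; last exact: measurableC.
  by rewrite -setTD prD // prT p1 subrr.
by exists (~` [set w | Rbp w \is a fin_num]); split => //; exact: measurableC.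
Qed.

Lemma measurable_Rbp_gt r : measurable [set w | (r%:E < Rbp w)%E].
Proof.
have := measurable_Rbp measurableT (emeasurable_itv `]r%:E, +oo[).
rewrite setTI (_ : _ @^-1` _ = [set w | (r%:E < Rbp w)%E]) //.
by apply/seteqP; split => w /=; rewrite in_itv /= andbT.
Qed.

(** The histories in [B] with a large score weigh at most the probability of the event, the others
    at most that of its complement; as together they weigh at least [1 - eps], both bounds are tight
    up to [eps]. *)
Lemma bp_pagerank_bracket r (eps : R) : 0 < eps ->
  exists B : seq (rtree K), [/\ uniq B, forall h, h \in B -> wf_tree h /\ h.1 = a,
    pr P [set w | (r%:E < Rbp w)%E] - eps <=
      \sum_(h <- B | (r%:E < tree_pagerank c h 0)%E) stop_weight ph h
    & 1 - \sum_(h <- B | ~~ (r%:E < tree_pagerank c h 0)%E) stop_weight ph h <=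
      pr P [set w | (r%:E < Rbp w)%E] + eps].
Proof.
move=> eps0; have mA := measurable_Rbp_gt r; set A := [set _ | _] in mA *.
have [B [uB wB HB]] := stop_weight_exhausts ph_gt0 a eps0.
exists B; set U := \sum_(_ <- _ | ~~ _) _; set L := \sum_(_ <- _ | _) _.
have LA : L <= pr P A.
  by apply: stop_weight_sum_le => // h w _ Qh; rewrite /A /= => ->.
have UA : U <= pr P (~` A).
  apply: stop_weight_sum_le => //; first exact: measurableC.
  by move=> h w _ Qh; rewrite /A /= => ->; apply/negP.
rewrite -setTD prD // prT in UA.
have e : \sum_(h <- B) stop_weight ph h = L + U.
  by rewrite (bigID (fun h => (r%:E < tree_pagerank c h 0)%E)).
rewrite e in HB; split=> //; lra.
Qed.

End StopMass.

Section Convergence.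
Context (R : realType) (K : nat).
Variables (mu : 'I_K -> R) (kappa : 'M[R]_K) (eta : 'I_K -> R).
Hypotheses (mu_gt0 : forall x, 0 < mu x) (mu_sum1 : \sum_x mu x = 1).
Hypothesis kappa_gt0 : forall x y, 0 < kappa x y.
Hypothesis eta_min : is_minimizer mu kappa eta.
Context (g0 : rtree K) (g0_wf : wf_tree g0).
Context d (T : measurableType d) (P : probability T R).
Variables (ty : nat -> T -> 'I_K) (par : nat -> T -> nat).
Hypothesis G_network : is_network mu kappa P g0 ty par.
Let G := network g0 ty par.

Lemma type_proportion_ae : {ae P, forall w a,
  n%:R^-1 * \sum_(v < order (G n w)) (vtype (G n w) v == a)%:R
  @[n --> \oo] --> mu a}.
Proof.
apply: filterS (type_frequency_ae mu_gt0 mu_sum1 kappa_gt0 g0_wf G_network) => w H a.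
pose C : R := \sum_(v < order g0) (vtype g0 v == a)%:R.
apply: (@eq_cvgn _ (fun n => n%:R^-1 * C + n%:R^-1 * \sum_(i < n) (ty i w == a)%:R))
  => [n|]; first by rewrite /G type_count_network mulrDr.
rewrite -[X in _ --> X]add0r; apply: cvgD; last exact: H.
rewrite -[X in _ --> X](mul0r C); apply: cvgM; last exact: cvg_cst.
by rewrite -cvg_shiftS; exact: cvg_harmonic.
Qed.

Theorem pagerank_proportion_ae (c : R) (a : 'I_K)
    d' (T' : measurableType d') (Pa : probability T' R)
    (clk : clock_idx K -> {RV Pa >-> R}) (tau : {RV Pa >-> R}) (r : R) :
  0 <= c -> bp_clocks (phi mu kappa eta) clk tau ->
  {ae P, forall w,
    n%:R^-1 * \sum_(v < order (G n w))
      ((vtype (G n w) v == a) && (r%:E < tree_pagerank c (G n w) v)%E)%:R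
    @[n --> \oo] -->
    mu a * pr Pa [set w' | (r%:E < bp_pagerank a (fun i => clk i w') c (tau w'))%E]}.
Proof.
move=> c_ge0 clk_tau; set p := pr _ _.
have ph_gt0 := phi_gt0 mu_gt0 kappa_gt0 eta_min.
apply: filterS3 (network_wf_ae mu_sum1 kappa_gt0 g0_wf G_network) type_proportion_ae
  (fringe_count_cvg_ae mu_gt0 mu_sum1 kappa_gt0 eta_min g0_wf G_network) => w wG Ha Hf.
apply/cvgn_epsP => e e0.
(* After multiplication by [mu a] this error becomes [e / 2]; the other half is spent on the
   convergence in [n]. *)
have eps0 : 0 < e / (2 * mu a) by rewrite divr_gt0 // mulr_gt0.
have [B [uB wB HL HU]] := bp_pagerank_bracket ph_gt0 clk_tau a c_ge0 r eps0.
rewrite -/p in HL HU.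
set L := \sum_(_ <- _ | _) _ in HL; set U := \sum_(_ <- _ | _) _ in HU.
have Ba h : h \in B -> h.1 = a by move=> /wB[].
have cv (D : pred (rtree K)) :
    n%:R^-1 * \sum_(h <- B | D h) fringe_count R h (G n w) @[n --> \oo] -->
    mu a * \sum_(h <- B | D h) stop_weight (phi mu kappa eta) h.
  apply: (@eq_cvgn _ (fun n => \sum_(h <- B | D h) n%:R^-1 * fringe_count R h (G n w)))
    => [n|]; first by rewrite mulr_sumr.
  rewrite mulr_sumr; apply: cvgn_sum_seq => h hB; rewrite -(Ba h hB).
  by apply: Hf; case: (wB h hB).
have lower := cv (fun h => (r%:E < tree_pagerank c h 0)%E).
have upper : n%:R^-1 * \sum_(v < order (G n w)) (vtype (G n w) v == a)%:R -
    n%:R^-1 * \sum_(h <- B | ~~ (r%:E < tree_pagerank c h 0)%E)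
      fringe_count R h (G n w) @[n --> \oo] --> mu a - mu a * U.
  by apply: cvgB; [exact: Ha|exact: cv].
have e2 : 0 < e / 2 by rewrite divr_gt0.
have [N1 HN1] := (cvgn_epsP _ _).1 lower _ e2.
have [N2 HN2] := (cvgn_epsP _ _).1 upper _ e2.
exists (maxn N1 N2) => n; rewrite geq_max => /andP[/HN1 + /HN2].
have wg : wf_tree (G n w) by case: (wG n).
have n0 : 0 <= n%:R^-1 :> R by rewrite invr_ge0.
have := ler_wpM2l n0 (pagerank_count_ge c r wg uB Ba).
have := ler_wpM2l n0 (pagerank_count_le c r wg uB Ba).
rewrite -/L -/U.
rewrite mulrBr /=.
set S := _^-1 * _.
have ep : mu a * (e / (2 * mu a)) = e / 2 by field; rewrite gt_eqF.
have := ler_wpM2l (ltW (mu_gt0 a)) HL; have := ler_wpM2l (ltW (mu_gt0 a)) HU.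
rewrite mulrBr mulrDr mulrBr ep mulr1 !ler_norml.
move=> h1 h2 h3 h4 /andP[h5 h6] /andP[h7 h8].
by apply/andP; split; lra.
Qed.

End Convergence.

Theorem theorem3p9 (R : realType) (K : nat) (K_gt0 : (0 < K)%N)
  (mu : 'I_K -> R) (kappa : 'M[R]_K)
  (mu_gt0 : forall x, 0 < mu x) (mu_sum1 : \sum_x mu x = 1)
  (kappa_gt0 : forall x y, 0 < kappa x y)
  (d : measure_display) (T : measurableType d) (P : probability T R)
  (g0 : rtree K) (g0_wf : wf_tree g0)
  (ty : nat -> T -> 'I_K) (par : nat -> T -> nat)
  (G_network : is_network mu kappa P g0 ty par)
  (eta : 'I_K -> R) (eta_min : is_minimizer mu kappa eta)
  (c : R) (c_gt0 : 0 < c) (c_lt1 : c < 1) (a : 'I_K)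
  (d' : measure_display) (T' : measurableType d') (Pa : probability T' R)
  (clk : clock_idx K -> {RV Pa >-> R}) (tau : {RV Pa >-> R})
  (clk_tau : bp_clocks (phi mu kappa eta) clk tau) :
  let G := network g0 ty par in
  let Rbp := fun w : T' => bp_pagerank a (fun i => clk i w) c (tau w) in
  {ae Pa, forall w, Rbp w \is a fin_num} /\
  (forall r : R,
    {for r, continuous (fun x : R => fine (Pa [set w | (Rbp w <= x%:E)%E]))} ->
    {ae P, forall w,
      n%:R^-1 * \sum_(v < order (G n w))
        ((vtype (G n w) v == a) && (r%:E < tree_pagerank c (G n w) v)%E)%:R
      @[n --> \oo] --> mu a * fine (Pa [set w' | (r%:E < Rbp w')%E])}).
Proof.
move=> G Rbp; split=> [|r _].
  exact: (bp_pagerank_fin_num_ae (phi_gt0 mu_gt0 kappa_gt0 eta_min) clk_tau a (ltW c_gt0)).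
exact: (pagerank_proportion_ae mu_gt0 mu_sum1 kappa_gt0 eta_min g0_wf G_network a r
  (ltW c_gt0) clk_tau).
Qed.
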